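(* Let $N=(\mathbb{C}^2,0)$ with coordinates $(q_1,q_2)$, $D=\{q_1q_2=0\}$, and let $\mathcal{G}^{\log}$ be the bundle on $\mathbb{P}^1\times N$ with basis of global sections $\omega=(\omega_0,\omega_1,\omega_2,\omega_3)$, equipped with the connection $\nabla$ and the bilinear form $S$ defined in the context (coming from the Landau–Ginzburg model $u_1+u_2+q_1\frac{u_2^2}{u_1}+q_2\frac1{u_2}$ of the Hirzebruch surface $\mathbb{F}_2$). The tuple $\mathcal{Q}^{B,\log}=(\mathcal{G}^{\log},\nabla,S,N,D)$ is a logarithmic quantum differential system. It has a universal unfolding which defines, together with the $\bigtriangledown$-flat section $\omega_0$, a logarithmic Frobenius manifold at the origin of $\mathbb{C}^2$.
   Context: The data. With $\tau=\theta^{-1}$, the connection is given (matrix $(m_{ab})$ of an operator $T$: $T\omega_b=\sum_am_{ab}\omega_a$) by the matrices: of $\tau\nabla_{\partial_\tau}$, $$-\tau\begin{pmatrix}0&2q_2&0&0\\2&0&4q_1q_2&0\\0&4&0&2\\0&0&2q_2(1-4q_1)&0\end{pmatrix}-\mathrm{diag}(0,1,2,1);$$ of $q_2\nabla_{\partial_{q_2}}$, $$-\tau\begin{pmatrix}0&q_2&0&0\\1&0&2q_1q_2&0\\0&2&0&1\\0&0&q_2(1-4q_1)&0\end{pmatrix};$$ of $q_1\nabla_{\partial_{q_1}}$, $$-\tau\begin{pmatrix}0&0&0&\frac{q_1q_2}{1-4q_1}\\0&0&q_1q_2&0\\0&1&0&\frac{2q_1}{4q_1-1}\\1&0&-2q_1q_2&0\end{pmatrix}+\frac{q_1}{4q_1-1}\begin{pmatrix}0&0&0&0\\0&0&0&1\\0&0&0&0\\0&0&0&-2\end{pmatrix}.$$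 The form $S$ is symmetric on the $\omega_i$, with $S(\omega_0,\omega_2)=\theta^2$, $S(\omega_1,\omega_1)=2\theta^2$, $S(\omega_1,\omega_3)=\theta^2$, $S(\omega_3,\omega_3)=\frac{2q_1}{4q_1-1}\theta^2$, $S(\omega_i,\omega_j)=0$ otherwise, extended by $S(h(\theta)a,b)=h(\theta)S(a,b)$, $S(a,h(\theta)b)=h(-\theta)S(a,b)$. Definitions. A logarithmic quantum differential system (logD-trTLEP-structure) of weight $d$ on a germ $(N,D)$, $D$ a normal crossing divisor, consists of a bundle $\mathcal{G}$ on $\mathbb{P}^1\times N$ trivial along the fibers of $\pi:\mathbb{P}^1\times N\to N$, a flat connection $\nabla=\bigtriangledown+\frac\Phi\theta+(\frac{V_0}\theta+V_\infty)\frac{d\theta}\theta$ where on $E=\pi_*\mathcal{G}$: $\bigtriangledown:E\to E\otimes\Omega^1_N(\log D)$ is a connection, $\Phi:E\to E\otimes\Omega^1_N(\log D)$ and $V_0,V_\infty\in\mathrm{End}(E)$ are $\mathcal{O}_N$-linear, and a $\nabla$-flat, $(-1)^d$-symmetric, non-degenerate pairing $S:\mathcal{G}\times j^*\mathcal{G}\to\theta^d\mathcal{O}_{\mathbb{P}^1\times N}$, $j(\theta,q)=(-\theta,q)$. (Here $d=2$.) An unfolding of it is a logarithmic quantum differential system on $(N\times(\mathbb{C}^l,0),D\times\mathbb{C}^l)$ together with an isomorphism of its restriction to $N\times\{0\}$ with the given one. An unfolding over $N\times\mathbb{C}^l$ induces one over $N\times\mathbb{C}^{l'}$ if the latter is isomorphic,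 compatibly with the given isomorphisms, to the pull-back of the former by a holomorphic map of germs $N\times\mathbb{C}^{l'}\to N\times\mathbb{C}^l$, compatible with the divisors and equal to the identity on $N$. It is universal if it induces every unfolding by a unique map and a unique isomorphism. A logarithmic Frobenius manifold is a germ $(\tilde N,\tilde D)$ with a Frobenius manifold structure $(\circ,g,e,\mathcal{E})$ on $\tilde N\setminus\tilde D$ (commutative associative product with unit $e$ on the tangent sheaf, flat metric $g$, Euler field $\mathcal{E}$, satisfying the usual axioms) such that $\circ$ and $g$ extend to the sheaf $\mathrm{Der}(\log\tilde D)$ of logarithmic vector fields, $g$ being non-degenerate on it, and $e,\mathcal{E}\in\mathrm{Der}(\log\tilde D)$. That the universal unfolding (over $\tilde N$, divisor $\tilde D=D\times\mathbb{C}^l$) together with $\omega_0$ (extended to a $\bigtriangledown$-flat section) defines a logarithmic Frobenius manifold means that the period map $v:\mathrm{Der}(\log\tilde D)\to E$, $v(X)=-\Phi_X(\omega_0)$, is an isomorphism and that the structure transported by $v$ (product given by $\Phi_{X\circ Y}=-\Phi_X\Phi_Y$, metric $g(X,Y)=\theta^{-d}S(v(X),v(Y))$, Euler field given by $v(\mathcal{E})=V_0(\omega_0)$) is a logarithmic Frobenius manifold. *)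

(* Defs.v *)
From HB Require Import structures.
From mathcomp Require Import all_boot all_order all_algebra.
From mathcomp Require Import mpoly.
From mathcomp Require Import boolp.

Set Implicit Arguments.
Unset Strict Implicit.
Unset Printing Implicit Defensive.

Import Order.TTheory GRing.Theory Num.Theory.
Local Open Scope ring_scope.

(* The ring O_n of germs of holomorphic functions on (C^n, 0) is taken to be the
   ring C{x_0, ..., x_(n-1)} of convergent power series, a germ being given by
   its Taylor coefficients at 0. *)
Section PowerSeries.
Variables (C : numFieldType) (n : nat).
Implicit Types f g h : 'X_{1..n} -> C.

Definition psnorm N (r : C) f := \sum_(m : 'X_{1..n < N}) `|f m| * r ^+ mdeg m.

(* Absolute convergence at the point (r, ..., r) for some r > 0. *)
Definition convergent f :=
  exists2 r : C, 0 < r & exists K : C, forall N : nat, psnorm N r f <= K.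

Definition ps_mul f g : 'X_{1..n} -> C := fun m =>
  \sum_(k : 'X_{1..n < (mdeg m).+1, (mdeg m).+1} | m == (k.1 + k.2)%MM)
     f k.1 * g k.2.

Definition ps_der (i : 'I_n) f : 'X_{1..n} -> C := fun m =>
  f (m + U_(i))%MM *+ (m i).+1.

Let trunc N f : {mpoly C[n]} := \sum_(m : 'X_{1..n < N}) f m *: 'X_[m].

Let trunc_coef N f m : (mdeg m < N)%N -> (trunc N f)@_m = f m.
Proof. exact: mcoeff_mpoly. Qed.

Let trunc_size N f : (msize (trunc N f) <= N)%N.
Proof.
apply: (leq_trans (msize_sum _ _ _)).
apply/bigmax_leqP => m _; apply: (leq_trans (msizeZ_le _ _)).
by rewrite mmeasureX; exact: bmdeg.
Qed.

Let ps_mulE N f g m : (mdeg m < N)%N -> ps_mul f g m = (trunc N f * trunc N g)@_m.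
Proof.
move=> ltm; rewrite mcoeffM; apply: eq_bigr => k /eqP/(congr1 (@mdeg n)).
rewrite mdegD => e; rewrite !trunc_coef //; apply: leq_ltn_trans ltm.
  exact: leq_trans (leq_addl _ _) (eq_leq (esym e)).
exact: leq_trans (leq_addr _ _) (eq_leq (esym e)).
Qed.

Let ps_mulEN N f g m : (mdeg m < N)%N ->
  ps_mul f g m = \sum_(k : 'X_{1..n < N, N} | m == (k.1 + k.2)%MM) f k.1 * g k.2.
Proof.
move=> ltm; rewrite (ps_mulE _ _ ltm).
rewrite (mpolywME (trunc_size N f) (trunc_size N g)) raddf_sum /= [RHS]big_mkcond.
apply: eq_bigr => -[k1 k2] _ /=; rewrite !trunc_coef ?bmdeg // mcoeffZ mcoeffX.
by rewrite eq_sym; case: eqP; rewrite ?mulr1 ?mulr0.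
Qed.

Lemma ps_mulC f g : ps_mul f g = ps_mul g f.
Proof.
by apply/funext => m; rewrite !(ps_mulE _ _ (ltnSn _)) mulrC.
Qed.

Let mulE_cong (p p' q q' : {mpoly C[n]}) m :
  (forall k, (mdeg k <= mdeg m)%N -> p@_k = p'@_k) ->
  (forall k, (mdeg k <= mdeg m)%N -> q@_k = q'@_k) -> (p * q)@_m = (p' * q')@_m.
Proof.
move=> hp hq; rewrite !mcoeffM; apply: eq_bigr => k /eqP/(congr1 (@mdeg n)).
rewrite mdegD => e; rewrite hp ?hq //.
  exact: leq_trans (leq_addl _ _) (eq_leq (esym e)).
exact: leq_trans (leq_addr _ _) (eq_leq (esym e)).
Qed.

Lemma ps_mulA f g h : ps_mul f (ps_mul g h) = ps_mul (ps_mul f g) h.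
Proof.
apply/funext => m; rewrite !(ps_mulE _ _ (ltnSn _)).
set N := (mdeg m).+1.
transitivity ((trunc N f * (trunc N g * trunc N h))@_m).
  by apply: mulE_cong => // k lek; rewrite trunc_coef // (ps_mulE (N := N)).
by rewrite mulrA; apply: mulE_cong => // k lek; rewrite trunc_coef // (ps_mulE (N := N)).
Qed.

Definition ps_const (c : C) : 'X_{1..n} -> C := fun m => if m == 0%MM then c else 0.

Lemma ps_mul1 f : ps_mul (ps_const 1) f = f.
Proof.
apply/funext => m; rewrite (ps_mulE _ _ (ltnSn _)) -[RHS](trunc_coef _ (ltnSn (mdeg m))).
rewrite -[in RHS](mul1r (trunc _ f)); apply: mulE_cong => // k lek.
by rewrite trunc_coef // mcoeff1 /ps_const; case: eqP.
Qed.

Lemma ps_mulDl f g h : ps_mul (fun m => f m + g m) h = fun m => ps_mul f h m + ps_mul g h m.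
Proof.
by apply/funext => m; rewrite -big_split /=; apply: eq_bigr => k _; rewrite mulrDl.
Qed.

Lemma psnorm_ge0 N (r : C) f : 0 <= r -> 0 <= psnorm N r f.
Proof. by move=> r0; apply: sumr_ge0 => m _; rewrite mulr_ge0 ?exprn_ge0. Qed.

Lemma psnorm_le N (r s : C) f : 0 <= r -> r <= s -> psnorm N r f <= psnorm N s f.
Proof.
move=> r0 rs; apply: ler_sum => m _; rewrite ler_wpM2l // lerXn2r // nnegrE //.
exact: le_trans rs.
Qed.

Lemma psnormM N (r : C) f g : 0 <= r -> psnorm N r (ps_mul f g) <= psnorm N r f * psnorm N r g.
Proof.
move=> r0; rewrite /psnorm big_distrlr /= pair_big /=.
pose F (k : 'X_{1..n < N} * 'X_{1..n < N}) :=
  (`|f k.1| * r ^+ mdeg k.1) * (`|g k.2| * r ^+ mdeg k.2).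
have F0 k : 0 <= F k by rewrite !mulr_ge0 ?exprn_ge0.
apply: (@le_trans _ _ (\sum_(m : 'X_{1..n < N})
   \sum_(k : 'X_{1..n < N, N} | val m == (k.1 + k.2)%MM) F k)).
  apply: ler_sum => m _; rewrite (ps_mulEN _ _ (bmdeg m)).
  apply: (le_trans (ler_wpM2r (exprn_ge0 _ r0) (ler_norm_sum _ _ _))).
  rewrite mulr_suml; apply: ler_sum => k /eqP e.
  by rewrite /F [in X in X <= _]e mdegD exprD normrM mulrACA.
rewrite (exchange_big_dep xpredT) //=; apply: ler_sum => k _.
have [/existsP[m /eqP e]|/existsPn nex] :=
  boolP [exists m : 'X_{1..n < N}, val m == (k.1 + k.2)%MM].
  rewrite (big_pred1 m) // => m' /=.
  by rewrite -e -val_eqE.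
rewrite big_pred0 ?F0 // => m; apply: negbTE; exact: nex.
Qed.

Lemma convergent_common f g : convergent f -> convergent g ->
  exists2 r : C, 0 < r & exists K : C, forall N, psnorm N r f <= K /\ psnorm N r g <= K.
Proof.
move=> [r r0 [K hK]] [s s0 [L hL]].
have K0 : 0 <= K by apply: (le_trans _ (hK 0%N)); apply: psnorm_ge0; exact: ltW.
have L0 : 0 <= L by apply: (le_trans _ (hL 0%N)); apply: psnorm_ge0; exact: ltW.
have [rs|sr] := real_leP (gtr0_real r0) (gtr0_real s0).
  exists r => //; exists (K + L) => N; split.
    by apply: (le_trans (hK N)); rewrite lerDl.
  by apply: (le_trans (psnorm_le _ _ (ltW r0) rs)); apply: (le_trans (hL N)); rewrite lerDr.
exists s => //; exists (K + L) => N; split.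
  by apply: (le_trans (psnorm_le _ _ (ltW s0) (ltW sr))); apply: (le_trans (hK N)); rewrite lerDl.
by apply: (le_trans (hL N)); rewrite lerDr.
Qed.

Lemma convergentD f g : convergent f -> convergent g -> convergent (fun m => f m + g m).
Proof.
move=> cf cg; have [r r0 [K hK]] := convergent_common cf cg.
exists r => //; exists (K + K) => N; have [h1 h2] := hK N.
apply: le_trans (lerD h1 h2); rewrite -big_split /=; apply: ler_sum => m _.
by rewrite -mulrDl ler_wpM2r ?exprn_ge0 ?(ltW r0) // ler_normD.
Qed.

Lemma convergentN f : convergent f -> convergent (fun m => - f m).
Proof.
move=> [r r0 [K hK]]; exists r => //; exists K => N; apply: le_trans (hK N).
by apply: ler_sum => m _; rewrite normrN.
Qed.

Lemma convergent_const c : convergent (ps_const c).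
Proof.
exists 1 => //; exists `|c| => -[|N].
  by rewrite /psnorm big1 ?normr_ge0 // => -[m lm]; exfalso; move: (lm); rewrite ltn0.
rewrite /psnorm (bigD1 (@bm0 n N)) //= /ps_const eqxx expr1n mulr1 big1 ?addr0 // => m.
by rewrite -val_eqE /= => /negbTE ->; rewrite normr0 mul0r.
Qed.

Lemma convergentM f g : convergent f -> convergent g -> convergent (ps_mul f g).
Proof.
move=> cf cg; have [r r0 [K hK]] := convergent_common cf cg.
exists r => //; exists (K * K) => N; have [h1 h2] := hK N.
by apply: (le_trans (psnormM _ _ _ (ltW r0))); rewrite ler_pM // psnorm_ge0 ?(ltW r0).
Qed.

Lemma psnorm_term N (r : C) f m : 0 <= r -> (mdeg m < N)%N -> `|f m| * r ^+ mdeg m <= psnorm N r f.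
Proof.
move=> r0 lm; rewrite /psnorm (bigD1 (BMultinom lm)) //= lerDl.
by apply: sumr_ge0 => k _; rewrite mulr_ge0 ?exprn_ge0.
Qed.

Lemma convergent_cauchy f : convergent f ->
  exists2 r : C, 0 < r & exists2 K : C, 0 <= K & forall m, `|f m| <= K * r ^+ mdeg m.
Proof.
move=> [r r0 [K hK]]; exists r^-1; rewrite ?invr_gt0 //.
have K0 : 0 <= K by apply: (le_trans _ (hK 0%N)); apply: psnorm_ge0; exact: ltW.
exists K => // m; rewrite exprVn ler_pdivlMr ?exprn_gt0 //.
exact: le_trans (psnorm_term _ (ltW r0) (ltnSn _)) (hK _).
Qed.

Let half_sum N : \sum_(j < N) 2^-1 ^+ j <= 2 :> C.
Proof.
have -> : \sum_(j < N) 2^-1 ^+ j = 2 - 2 * 2^-1 ^+ N :> C.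
  elim: N => [|N ih]; first by rewrite big_ord0 mulr1 subrr.
  rewrite big_ord_recr /= ih exprS mulrA divff ?pnatr_eq0 // mul1r.
  by rewrite -addrA; congr (_ + _); rewrite mulr_natl mulr2n opprD addrNK.
by rewrite lerBlDr lerDl mulr_ge0 // exprn_ge0 // invr_ge0.
Qed.

Lemma cauchy_convergent f (r K : C) : 0 < r -> 0 <= K ->
  (forall m, `|f m| <= K * r ^+ mdeg m) -> convergent f.
Proof.
move=> r0 K0 hf; exists (r^-1 * 2^-1); first by rewrite mulr_gt0 ?invr_gt0.
exists (K * 2 ^+ n) => N.
apply: (@le_trans _ _ (\sum_(m : 'X_{1..n < N}) K * 2^-1 ^+ mdeg m)).
  apply: ler_sum => m _; rewrite exprMn mulrA ler_wpM2r ?exprn_ge0 ?invr_ge0 //.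
  by rewrite exprVn ler_pdivrMr ?exprn_gt0.
rewrite -mulr_sumr ler_wpM2l //.
have ltmN (m : 'X_{1..n < N}) i : (val m i < N)%N.
  apply: leq_ltn_trans (bmdeg m); rewrite mdegE (bigD1 i) //=; exact: leq_addr.
pose e (m : 'X_{1..n < N}) : {ffun 'I_n -> 'I_N} := [ffun i => Ordinal (ltmN m i)].
have einj : injective e.
  move=> m m' /ffunP h; apply/val_inj/mnmP => i.
  by have := h i; rewrite !ffunE => -[].
apply: (@le_trans _ _ (\sum_(d : {ffun 'I_n -> 'I_N}) \prod_i 2^-1 ^+ d i)).
  rewrite [X in _ <= X](bigID (mem [set e m | m : 'X_{1..n < N}])) /=.
  rewrite -[X in X <= _]addr0; apply: lerD; last first.
    by apply: sumr_ge0 => d _; apply: prodr_ge0 => i _; rewrite exprn_ge0 ?invr_ge0.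
  rewrite big_imset /=; last by move=> ? ? _ _; exact: einj.
  rewrite le_eqVlt; apply/orP; left; apply/eqP; apply: eq_bigr => m _.
  by rewrite mdegE -prodrXr; apply: eq_bigr => i _; rewrite ffunE.
rewrite -(bigA_distr_bigA (fun (_ : 'I_n) (j : 'I_N) => 2^-1 ^+ j)) /=.
apply: (@le_trans _ _ (\prod_(i < n) (2 : C))).
  apply: ler_prod => i _; rewrite half_sum andbT.
  by apply: sumr_ge0 => j _; rewrite exprn_ge0 ?invr_ge0.
by rewrite prodr_const card_ord.
Qed.

Lemma convergent_der i f : convergent f -> convergent (ps_der i f).
Proof.
move=> /convergent_cauchy[r r0 [K K0 hK]].
apply: (@cauchy_convergent _ (r * 2) (K * r)); rewrite ?mulr_gt0 ?mulr_ge0 ?(ltW r0) //.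
move=> m; rewrite /ps_der normrMn.
have h := hK (m + U_(i))%MM; rewrite mdegD mdeg1 addn1 in h.
rewrite -[X in X <= _]mulr_natr.
apply: (le_trans (ler_wpM2r (ler0n _ _) h)).
rewrite exprMn exprS !mulrA ler_wpM2l ?mulr_ge0 ?exprn_ge0 ?(ltW r0) //.
rewrite -natrX ler_nat.
have le1 : (m i <= mdeg m)%N by rewrite mdegE (bigD1 i) //= leq_addr.
exact: leq_ltn_trans le1 (ltn_expl _ _).
Qed.

End PowerSeries.

Section GermRing.
Variables (C : numFieldType) (n : nat).

Record germ := Germ { gcoef :> 'X_{1..n} -> C; gcoefP : convergent gcoef }.

Lemma germP (f g : germ) : (forall m, f m = g m) -> f = g.
Proof.
case: f g => [f cf] [g cg] /= /funext fg; move: cf; rewrite fg => cf.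
by congr Germ; exact: Prop_irrelevance.
Qed.

HB.instance Definition _ := gen_eqMixin germ.
HB.instance Definition _ := gen_choiceMixin germ.

Definition germ_const c := Germ (convergent_const n c).
Definition germ_add f g := Germ (convergentD (gcoefP f) (gcoefP g)).
Definition germ_opp f := Germ (convergentN (gcoefP f)).
Definition germ_mul f g := Germ (convergentM (gcoefP f) (gcoefP g)).
Definition germ_der i f := Germ (convergent_der i (gcoefP f)).

Lemma germ_addA : associative germ_add.
Proof. by move=> f g h; apply: germP => m /=; rewrite addrA. Qed.
Lemma germ_addC : commutative germ_add.
Proof. by move=> f g; apply: germP => m /=; rewrite addrC. Qed.
Lemma germ_add0 : left_id (germ_const 0) germ_add.
Proof. by move=> f; apply: germP => m /=; rewrite /ps_const if_same add0r. Qed.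
Lemma germ_addN : left_inverse (germ_const 0) germ_opp germ_add.
Proof. by move=> f; apply: germP => m /=; rewrite /ps_const if_same addNr. Qed.

HB.instance Definition _ :=
  GRing.isZmodule.Build germ germ_addA germ_addC germ_add0 germ_addN.

Lemma germ_mulA : associative germ_mul.
Proof. by move=> f g h; apply: germP => m /=; rewrite ps_mulA. Qed.
Lemma germ_mulC : commutative germ_mul.
Proof. by move=> f g; apply: germP => m /=; rewrite ps_mulC. Qed.
Lemma germ_mul1 : left_id (germ_const 1) germ_mul.
Proof. by move=> f; apply: germP => m /=; rewrite ps_mul1. Qed.
Lemma germ_mulDl : left_distributive germ_mul +%R.
Proof. by move=> f g h; apply: germP => m /=; rewrite ps_mulDl. Qed.
Lemma germ_1neq0 : germ_const 1 != 0.
Proof.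
apply/eqP => /(congr1 (fun f : germ => f 0%MM)) /=.
by rewrite /ps_const eqxx; apply/eqP; exact: oner_neq0.
Qed.

HB.instance Definition _ := GRing.Zmodule_isComNzRing.Build germ
  germ_mulA germ_mulC germ_mul1 germ_mulDl germ_1neq0.

Definition germ_unit : {pred germ} := fun f => `[< exists g : germ, g * f = 1 >].
Definition germ_inv (f : germ) : germ :=
  if pselect (exists g : germ, g * f = 1) is left h then sval (cid h) else f.

Lemma germ_mulV : {in germ_unit, left_inverse 1 germ_inv *%R}.
Proof.
move=> f /asboolP h; rewrite /germ_inv; case: pselect => // h'.
exact: (svalP (cid h')).
Qed.
Lemma germ_unitPl (f g : germ) : g * f = 1 -> germ_unit f.
Proof. by move=> h; apply/asboolP; exists g. Qed.
Lemma germ_inv_out : {in [predC germ_unit], germ_inv =1 id}.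
Proof.
move=> f /negP nf; rewrite /germ_inv; case: pselect => // h.
by case: nf; apply/asboolP.
Qed.

HB.instance Definition _ := GRing.ComNzRing_hasMulInverse.Build germ
  germ_mulV germ_unitPl germ_inv_out.

Lemma convergent_var (i : 'I_n) :
  convergent (fun m : 'X_{1..n} => (m == U_(i)%MM)%:R : C).
Proof.
apply: (@cauchy_convergent _ _ _ 1 1) => // m.
by rewrite expr1n mulr1; case: eqP; rewrite ?normr1 ?normr0.
Qed.
Definition germ_var i := Germ (convergent_var i).

End GermRing.

Section Substitution.
Variables (C : numFieldType) (n p : nat).

Lemma psnorm_prod (phi : 'I_n -> germ C p) (r B : C) (N : nat) :
  0 <= r -> (forall i, psnorm N r (phi i) <= B) -> forall a : 'X_{1..n},
  psnorm N r (\prod_i phi i ^+ a i : germ C p) <= B ^+ mdeg a.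
Proof.
move=> r0 hB a.
have h1 : psnorm N r (1 : germ C p) <= 1.
  rewrite /psnorm; case: N {hB} => [|N].
    by rewrite big1 // => -[m lm]; exfalso; move: (lm); rewrite ltn0.
  rewrite (bigD1 (@bm0 p N)) //= /ps_const eqxx mdeg0 normr1 mulr1 big1 ?addr0 // => m.
  by rewrite -val_eqE /= => /negbTE ->; rewrite normr0 mul0r.
have hM (f g : germ C p) (K L : C) :
    psnorm N r f <= K -> psnorm N r g <= L -> psnorm N r (f * g) <= K * L.
  move=> hf hg; apply: (le_trans (psnormM _ _ _ r0)).
  by rewrite ler_pM // psnorm_ge0.
rewrite mdegE -prodrXr.
elim/big_rec2: _ => // i K f _ ih; apply: (hM) => //.
elim: (a i) => [|k ihk]; rewrite ?expr0 // !exprS; exact: hM.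
Qed.

(* Coefficient extraction in f(phi): if phi(0) = 0 only the monomials of f of
   degree at most mdeg m contribute to the coefficient of m.  Only used for phi
   with phi(0) = 0. *)
Definition ps_subst (phi : 'I_n -> germ C p) (f : germ C n) : 'X_{1..p} -> C :=
  fun m => \sum_(a : 'X_{1..n < (mdeg m).+1})
             f a * (\prod_i phi i ^+ a i : germ C p) m.

Lemma convergent_subst phi f : convergent (ps_subst phi f).
Proof.
have [r r0 [K hK]] := gcoefP f.
have {}hK N := hK N.
have /choice[s hs] : forall i, exists s : C * C,
    [/\ 0 < s.1, 0 <= s.2 & forall N, psnorm N s.1 (phi i) <= s.2].
  move=> i; have [s s0 [L hL]] := gcoefP (phi i); exists (s, L); split => //=.
  by apply: (le_trans _ (hL 0%N)); apply: psnorm_ge0; exact: ltW.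
pose t : C := 1 + \sum_i (s i).1^-1.
have t0 : 0 < t.
  by rewrite ltr_wpDr //; apply: sumr_ge0 => i _; rewrite invr_ge0 ltW //; case: (hs i).
pose B : C := \sum_i (s i).2.
have B0 : 0 <= B by apply: sumr_ge0 => i _; case: (hs i).
have hB N i : psnorm N t^-1 (phi i) <= B.
  have [s1 s2 hi] := hs i.
  apply: (@le_trans _ _ (psnorm N (s i).1 (phi i))).
    apply: psnorm_le; first by rewrite invr_ge0 ltW.
    rewrite -[leRHS]invrK lef_pV2 ?posrE ?invr_gt0 //.
    rewrite /t (bigD1 i) //= addrCA lerDl addr_ge0 //.
    by apply: sumr_ge0 => j _; rewrite invr_ge0 ltW //; case: (hs j).
  apply: (le_trans (hi N)); rewrite /B (bigD1 i) //= lerDl.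
  by apply: sumr_ge0 => j _; case: (hs j).
have K0 : 0 <= K by apply: (le_trans _ (hK 0%N)); apply: psnorm_ge0; exact: ltW.
have c0 : 0 <= B / r by rewrite divr_ge0 ?(ltW r0).
apply: (@cauchy_convergent _ _ _ (t * (1 + B / r)) K) => //.
  by rewrite mulr_gt0 // ltr_wpDr.
move=> m; apply: (le_trans (ler_norm_sum _ _ _)).
have -> : K * (t * (1 + B / r)) ^+ mdeg m = K * (1 + B / r) ^+ mdeg m * t ^+ mdeg m.
  by rewrite exprMn [t ^+ _ * _]mulrC mulrA.
apply: (@le_trans _ _ (\sum_(a : 'X_{1..n < (mdeg m).+1})
    `|f a| * r ^+ mdeg a * (1 + B / r) ^+ mdeg m * t ^+ mdeg m)); last first.
  by rewrite -!mulr_suml !ler_wpM2r ?hK ?exprn_ge0 ?(ltW t0) // addr_ge0.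

apply: ler_sum => a _; rewrite normrM -!mulrA ler_wpM2l //.
have h : `|(\prod_i phi i ^+ a i : germ C p) m| <= B ^+ mdeg a * t ^+ mdeg m.
  rewrite -ler_pdivrMr ?exprn_gt0 // -exprVn.
  have ti0 : 0 <= t^-1 by rewrite invr_ge0 ltW.
  apply: le_trans (psnorm_prod ti0 (hB (mdeg m).+1) _).
  exact: psnorm_term.
apply: (le_trans h); rewrite mulrA ler_wpM2r ?exprn_ge0 ?(ltW t0) //.
rewrite -{1}[B](divfK (lt0r_neq0 r0)) exprMn mulrC ler_wpM2l ?exprn_ge0 ?(ltW r0) //.
apply: (@le_trans _ _ ((1 + B / r) ^+ mdeg a)).
  by rewrite lerXn2r // ?nnegrE ?addr_ge0 // lerDr.
rewrite ler_weXn2l //; first by rewrite lerDl.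
by have := bmdeg a; rewrite ltnS.
Qed.

Definition germ_subst phi f := Germ (convergent_subst phi f).

End Substitution.


Section LogQDS.
Variable C : numFieldType.

(* Divisor D = {x_i = 0 for some i < k} in (C^n, 0).  The fields [logder k i],
   i < n, form a commuting O_n-basis of Der(log D). *)
Definition logder (k n : nat) (i : 'I_n) (f : germ C n) : germ C n :=
  (if (i < k)%N then germ_var C i else 1) * germ_der i f.

(* Every bundle on the germ is trivial, and a bundle on P^1 x (C^n, 0) which is
   trivial along the P^1-fibres is the pull-back of E = pi_* G.  Everything is
   written in a global frame (w_0, ..., w_(r-1)) of E with sections as columns
   of coordinates: qds_conn i and qds_higgs i are the matrices of the connection
   on E and of Phi in the direction [logder k i], i.e.
     nabla_(logder i) = logder i + qds_conn i + theta^-1 qds_higgs i,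
     nabla_(theta d/dtheta) = theta d/dtheta + theta^-1 qds_V0 + qds_Vinf,
   and qds_pair is the matrix of theta^-d S(w_a, w_b); it has entries in O_n,
   since these are global sections of O on P^1 x (C^n, 0). *)
Record qds_data (n r : nat) := QdsData {
  qds_conn : 'I_n -> 'M[germ C n]_r;
  qds_higgs : 'I_n -> 'M[germ C n]_r;
  qds_V0 : 'M[germ C n]_r;
  qds_Vinf : 'M[germ C n]_r;
  qds_pair : 'M[germ C n]_r
}.

Section Structure.
Variables (k n r : nat) (T : qds_data n r).

(* Sections of G over (P^1 minus {0}) x (C^n, 0), algebraic in theta^-1: the
   polynomial variable 'X stands for tau = theta^-1. *)
Local Notation sect := 'cV[{poly germ C n}]_r.

Definition lift_mx (m p : nat) (A : 'M[germ C n]_(m, p)) : 'M[{poly germ C n}]_(m, p) :=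
  map_mx polyC A.

Definition qds_nabla (i : 'I_n) (s : sect) : sect :=
  map_mx (map_poly (logder k i)) s
  + (lift_mx (qds_conn T i) + 'X *: lift_mx (qds_higgs T i)) *m s.

(* theta d/dtheta = - tau d/dtau *)
Definition qds_nabla_theta (s : sect) : sect :=
  map_mx (fun f : {poly germ C n} => - ('X * f^`())) s
  + ('X *: lift_mx (qds_V0 T) + lift_mx (qds_Vinf T)) *m s.

(* The action of j : theta |-> - theta. *)
Definition theta_opp (f : {poly germ C n}) : {poly germ C n} := f \Po (- 'X).

(* theta^-d S(s, t), where S(h(theta) a, b) = h(theta) S(a, b) and
   S(a, h(theta) b) = h(- theta) S(a, b). *)
Definition qds_S (s t : sect) : {poly germ C n} :=
  (s^T *m lift_mx (qds_pair T) *m map_mx theta_opp t) 0 0.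

Definition qds_flat : Prop :=
  (forall i j s, qds_nabla i (qds_nabla j s) = qds_nabla j (qds_nabla i s)) /\
  (forall i s, qds_nabla i (qds_nabla_theta s) = qds_nabla_theta (qds_nabla i s)).

(* The second equation is theta d/dtheta applied to S = theta^d qds_S. *)
Definition qds_S_flat (d : int) : Prop :=
  (forall i s t, map_poly (logder k i) (qds_S s t)
     = qds_S (qds_nabla i s) t + qds_S s (qds_nabla i t)) /\
  (forall s t, d%:~R * qds_S s t - 'X * (qds_S s t)^`()
     = qds_S (qds_nabla_theta s) t + qds_S s (qds_nabla_theta t)).

(* S(s, t) = (-1)^d j^* S(t, s): the sign cancels against
   (- theta)^d = (-1)^d theta^d. *)
Definition qds_S_symmetric : Prop :=
  forall s t, qds_S s t = theta_opp (qds_S t s).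

Definition log_qds (d : int) : Prop :=
  [/\ qds_flat, qds_S_flat d, qds_S_symmetric & qds_pair T \in unitmx].

End Structure.

(* P is the matrix, in the chosen frames, of an isomorphism from T to T'. *)
Definition qds_iso (k n r : nat) (T T' : qds_data n r) (P : 'M[germ C n]_r) : Prop :=
  [/\ P \in unitmx,
      forall i s, lift_mx P *m qds_nabla k T i s = qds_nabla k T' i (lift_mx P *m s),
      forall s, lift_mx P *m qds_nabla_theta T s = qds_nabla_theta T' (lift_mx P *m s)
    & forall s t, qds_S T' (lift_mx P *m s) (lift_mx P *m t) = qds_S T s t].

(* A germ of map (C^p, 0) -> (C^n, 0) respecting each component {x_a = 0},
   a < k, of the divisors. *)
Definition log_map (k n p : nat) (phi : {ffun 'I_n -> germ C p}) : Prop :=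
  (forall a, phi a 0%MM = 0) /\
  (forall (a : 'I_n) (b : 'I_p), (a < k)%N -> a = b :> nat ->
     exists2 u : germ C p, u \is a GRing.unit & phi a = u * germ_var C b).

(* J is the matrix of phi^* on logarithmic forms: phi^*(dx_a / x_a) for a < k,
   resp. phi^*(dx_a) for k <= a, is \sum_b J a b * (the form dual to logder k b). *)
Definition log_jacobian (k n p : nat) (phi : {ffun 'I_n -> germ C p})
    (J : 'M[germ C p]_(n, p)) : Prop :=
  forall a b, logder k b (phi a) = (if (a < k)%N then phi a else 1) * J a b.

Definition qds_pullback (n p r : nat) (phi : {ffun 'I_n -> germ C p})
    (J : 'M[germ C p]_(n, p)) (T : qds_data n r) : qds_data p r :=
  let pull (A : 'M[germ C n]_r) := map_mx (germ_subst phi) A in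
  QdsData (fun b => \sum_a J a b *: pull (qds_conn T a))
          (fun b => \sum_a J a b *: pull (qds_higgs T a))
          (pull (qds_V0 T)) (pull (qds_Vinf T)) (pull (qds_pair T)).

(* The inclusion (C^n, 0) -> (C^n x C^l, 0), x |-> (x, 0). *)
Definition zero_section (n l : nat) : {ffun 'I_(n + l) -> germ C n} :=
  [ffun a => if split a is inl i then germ_var C i else 0].

Definition restr_mx (n l m p : nat) (A : 'M[germ C (n + l)]_(m, p)) : 'M[germ C n]_(m, p) :=
  map_mx (germ_subst (zero_section n l)) A.

Definition qds_restr (n l r : nat) (T : qds_data (n + l) r) : qds_data n r :=
  QdsData (fun i => restr_mx (qds_conn T (lshift l i)))
          (fun i => restr_mx (qds_higgs T (lshift l i)))
          (restr_mx (qds_V0 T)) (restr_mx (qds_Vinf T)) (restr_mx (qds_pair T)).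

Section Unfoldings.
Variables (k n r : nat) (d : int) (Q : qds_data n r).

Definition unfolding (l : nat) (T : qds_data (n + l) r) (i : 'M[germ C n]_r) : Prop :=
  log_qds k T d /\ qds_iso k (qds_restr T) Q i.

(* (T, i) induces (T', i') through the map phi and the isomorphism P from T' to
   phi^* T.  As phi is the identity on (C^n, 0), the restriction of phi^* T is
   that of T, and P restricts to i^-1 i'. *)
Definition induces (l l' : nat)
    (T : qds_data (n + l) r) (i : 'M[germ C n]_r)
    (T' : qds_data (n + l') r) (i' : 'M[germ C n]_r)
    (phi : {ffun 'I_(n + l) -> germ C (n + l')}) (P : 'M[germ C (n + l')]_r) : Prop :=
  [/\ log_map k phi,
      forall a, germ_subst (zero_section n l') (phi a) = zero_section n l a,
      exists J, log_jacobian k phi J /\ qds_iso k T' (qds_pullback phi J T) P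
    & i *m restr_mx P = i'].

Definition universal_unfolding (l : nat) (T : qds_data (n + l) r) (i : 'M[germ C n]_r) : Prop :=
  unfolding T i /\
  forall (l' : nat) (T' : qds_data (n + l') r) (i' : 'M[germ C n]_r),
    unfolding T' i' ->
    exists phi P, induces T i T' i' phi P /\
      forall phi' P', induces T i T' i' phi' P' -> phi' = phi /\ P' = P.

End Unfoldings.

Section FrobeniusManifold.
Variables (k n : nat).

(* Logarithmic vector fields, as columns of coordinates in the basis logder. *)
Local Notation vf := 'cV[germ C n]_n.

Definition vf_app (X : vf) (f : germ C n) : germ C n := \sum_i X i 0 * logder k i f.

Definition vf_bracket (X Y : vf) : vf :=
  \col_j (vf_app X (Y j 0) - vf_app Y (X j 0)).

(* The product and the metric are those on Der(log D): fm_mul i is the matrix of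
   multiplication by [logder k i], fm_metric the Gram matrix of the basis. *)
Record frob_data := FrobData {
  fm_mul : 'I_n -> 'M[germ C n]_n;
  fm_metric : 'M[germ C n]_n;
  fm_unit : vf;
  fm_euler : vf
}.

(* Connections on Der(log D), G i being the matrix in the direction logder i.
   The Levi-Civita connection of a metric which is non-degenerate on Der(log D)
   is of this kind by the Koszul formula. *)
Definition vf_nabla (G : 'I_n -> 'M[germ C n]_n) (X Y : vf) : vf :=
  \col_j vf_app X (Y j 0) + \sum_i X i 0 *: (G i *m Y).

Section FrobeniusConditions.
Variable F : frob_data.

Definition fm_prod (X Y : vf) : vf := \sum_i X i 0 *: (fm_mul F i *m Y).
Definition fm_g (X Y : vf) : germ C n := (X^T *m fm_metric F *m Y) 0 0.

Definition fm_algebra : Prop :=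
  [/\ forall X Y, fm_prod X Y = fm_prod Y X,
      forall X Y Z, fm_prod X (fm_prod Y Z) = fm_prod (fm_prod X Y) Z
    & forall X, fm_prod (fm_unit F) X = X].

Definition fm_invariant_metric : Prop :=
  [/\ forall X Y, fm_g X Y = fm_g Y X, fm_metric F \in unitmx
    & forall X Y Z, fm_g (fm_prod X Y) Z = fm_g X (fm_prod Y Z)].

Definition levi_civita (G : 'I_n -> 'M[germ C n]_n) : Prop :=
  (forall X Y, vf_nabla G X Y - vf_nabla G Y X = vf_bracket X Y) /\
  (forall X Y Z, vf_app X (fm_g Y Z) = fm_g (vf_nabla G X Y) Z + fm_g Y (vf_nabla G X Z)).

Definition vf_flat (G : 'I_n -> 'M[germ C n]_n) : Prop :=
  forall X Y Z, vf_nabla G X (vf_nabla G Y Z) - vf_nabla G Y (vf_nabla G X Z)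
    = vf_nabla G (vf_bracket X Y) Z.

(* (nabla_X o)(Y, Z) is symmetric in X and Y, and nabla e = 0. *)
Definition fm_potential (G : 'I_n -> 'M[germ C n]_n) : Prop :=
  let dprod X Y Z := vf_nabla G X (fm_prod Y Z)
    - fm_prod (vf_nabla G X Y) Z - fm_prod Y (vf_nabla G X Z) in
  (forall X Y Z, dprod X Y Z = dprod Y X Z) /\
  (forall X, vf_nabla G X (fm_unit F) = 0).

(* Lie_E(o) = o and Lie_E(g) = c g for a constant c. *)
Definition fm_euler_field : Prop :=
  let E := fm_euler F in
  (forall X Y, vf_bracket E (fm_prod X Y) - fm_prod (vf_bracket E X) Y
     - fm_prod X (vf_bracket E Y) = fm_prod X Y) /\
  exists c : C, forall X Y, vf_app E (fm_g X Y) - fm_g (vf_bracket E X) Y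
     - fm_g X (vf_bracket E Y) = germ_const n c * fm_g X Y.

(* On the complement of D the axioms are equivalent to these identities in O_n,
   the complement being dense and the logder k i a frame there. *)
Definition log_frobenius : Prop :=
  [/\ fm_algebra, fm_invariant_metric,
      exists G, [/\ levi_civita G, vf_flat G & fm_potential G]
    & fm_euler_field].

End FrobeniusConditions.

Section PeriodMap.
Variables (r : nat) (T : qds_data n r) (w : 'cV[germ C n]_r).

Definition conn_flat : Prop :=
  forall i : 'I_n, map_mx (logder k i) w + qds_conn T i *m w = 0.

Definition qds_Phi (X : vf) : 'M[germ C n]_r := \sum_i X i 0 *: qds_higgs T i.

Definition period_map (X : vf) : 'cV[germ C n]_r := - (qds_Phi X *m w).

Definition defines_log_frobenius : Prop :=
  [/\ conn_flat, bijective period_map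
    & exists F : frob_data,
      [/\ log_frobenius F,
          forall X Y, qds_Phi (fm_prod F X Y) = - (qds_Phi X *m qds_Phi Y),
          forall X Y, fm_g F X Y
            = ((period_map X)^T *m qds_pair T *m period_map Y) 0 0
        & period_map (fm_euler F) = qds_V0 T *m w]].

End PeriodMap.
End FrobeniusManifold.

Section HirzebruchF2.

Let q1 : germ C 2 := germ_var C ord0.
Let q2 : germ C 2 := germ_var C ord_max.

Definition mx_of_rows (s : seq (seq (germ C 2))) : 'M[germ C 2]_4 :=
  \matrix_(a, b) nth 0 (nth [::] s a) b.

Definition F2_tau : 'M[germ C 2]_4 := mx_of_rows
  [:: [:: 0; 2 * q2; 0; 0];
      [:: 2; 0; 4 * q1 * q2; 0];
      [:: 0; 4; 0; 2];
      [:: 0; 0; 2 * q2 * (1 - 4 * q1); 0]].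

Definition F2_weights : 'M[germ C 2]_4 := mx_of_rows
  [:: [:: 0; 0; 0; 0];
      [:: 0; 1; 0; 0];
      [:: 0; 0; 2; 0];
      [:: 0; 0; 0; 1]].

Definition F2_q2 : 'M[germ C 2]_4 := mx_of_rows
  [:: [:: 0; q2; 0; 0];
      [:: 1; 0; 2 * q1 * q2; 0];
      [:: 0; 2; 0; 1];
      [:: 0; 0; q2 * (1 - 4 * q1); 0]].

Definition F2_q1 : 'M[germ C 2]_4 := mx_of_rows
  [:: [:: 0; 0; 0; q1 * q2 / (1 - 4 * q1)];
      [:: 0; 0; q1 * q2; 0];
      [:: 0; 1; 0; 2 * q1 / (4 * q1 - 1)];
      [:: 1; 0; - (2 * q1 * q2); 0]].

Definition F2_q1_conn : 'M[germ C 2]_4 := (q1 / (4 * q1 - 1)) *: mx_of_rows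
  [:: [:: 0; 0; 0; 0];
      [:: 0; 0; 0; 1];
      [:: 0; 0; 0; 0];
      [:: 0; 0; 0; - 2]].

Definition F2_pair : 'M[germ C 2]_4 := mx_of_rows
  [:: [:: 0; 0; 1; 0];
      [:: 0; 2; 0; 1];
      [:: 1; 0; 0; 0];
      [:: 0; 1; 0; 2 * q1 / (4 * q1 - 1)]].

(* nabla_(theta d/dtheta) = - nabla_(tau d/dtau), hence the signs of V0, Vinf. *)
Definition F2_qds : qds_data 2 4 := QdsData
  (fun i => if i == ord0 then F2_q1_conn else 0)
  (fun i => if i == ord0 then - F2_q1 else - F2_q2)
  F2_tau F2_weights F2_pair.

Definition F2_omega0 : 'cV[germ C 2]_4 := delta_mx ord0 0.

End HirzebruchF2.

End LogQDS.

(* Main.v *)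
From HB Require Import structures.
Require Import Defs.
From mathcomp Require Import all_boot all_order all_algebra.
From mathcomp Require Import mpoly boolp ring complex reals.

Set Implicit Arguments.
Unset Strict Implicit.
Unset Printing Implicit Defensive.

Import Order.TTheory GRing.Theory Num.Theory.
Local Open Scope ring_scope.

(* In the coordinate Q with q_1 = Q / (1 + Q)^2 the given system becomes the small
   quantum differential system of P^1 x P^1: in the basis 1, h_A, h_B, pt its connection
   on E vanishes, the pairing is constant and the products are polynomial in Q, q_2 and
   1 / (1 - Q), 1 / (1 + Q).
   As 1 generates E under the products with the two divisors, an unfolding by s, t in
   the directions 1 and pt is given by operators A_1, A_2 commuting with the operator Z
   such that Z 1 = pt, with d_t A_i = q_i d_(q_i) Z.  Since Z is a rational expression in
   A_1 and A_2, this is a nonlinear Cauchy problem, solved by a fixed point argument for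
   a weighted l^1 norm; commutativity, closedness, homogeneity and self-adjointness hold
   at t = 0 and propagate.
   Any other unfolding is gauged to a trivial connection on E by parallel transport; the
   closed form - Phi(1) then determines the inducing map by integration, and an operator
   commuting with the products being determined by its value on 1, the pull-back agrees
   with the unfolding to all orders in the parameters. *)

(** * Germs and their derivations *)

(** F_2 is a deformation of P^1 x P^1, whence the change of coordinate: the discriminant 1 - 4 q_1 =
    ((1 - Q) / (1 + Q))^2 becomes a square, and all data of the base are polynomial in Q, q_2 and
    two inverses. The rank is 4 and the base has dimension 2, so the period map can only be an
    isomorphism with two parameters. The direction of the unit is harmless: s only adds s to the
    product with the Euler field. In the direction of pt a plain iteration would lose one derivative
    at each step; the weight of the norm is designed to absorb this loss. The iterates also
    stabilise modulo powers of the maximal ideal, which yields the limit, so that the norm serves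
    only to prove convergence. The same filtrations give all uniqueness statements: a defect which
    vanishes at t = 0, or on the base, and whose derivatives are controlled by itself lies in every
    power of an ideal. The Cauchy problem is written for A_1 and A_2 - A_1 because at the origin
    these map 1 to h_A and h_B: the words 1, a, b, a b applied to 1 then give the standard basis. *)

Section Coefficients.
Variables (C : numFieldType) (n : nat).
Implicit Types (f g h : germ C n) (m : 'X_{1..n}) (S : pred 'I_n).

Lemma gcoefD f g m : (f + g) m = f m + g m. Proof. by []. Qed.
Lemma gcoefN f m : (- f) m = - f m. Proof. by []. Qed.
Lemma gcoefB f g m : (f - g) m = f m - g m. Proof. by []. Qed.
Lemma gcoef0 m : (0 : germ C n) m = 0.
Proof. by change (ps_const 0 m = 0 :> C); rewrite /ps_const if_same. Qed.
Lemma gcoef1 m : (1 : germ C n) m = (m == 0%MM)%:R.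
Proof. by change (ps_const 1 m = (m == 0%MM)%:R :> C); rewrite /ps_const; case: eqP. Qed.

Lemma gcoef_sum (I : Type) (r : seq I) (P : pred I) (F : I -> germ C n) m :
  (\sum_(i <- r | P i) F i) m = \sum_(i <- r | P i) F i m.
Proof. by elim/big_rec2: _ => [|i y x _ <-]; rewrite ?gcoef0. Qed.

Lemma gcoefM f g m : (f * g) m =
  \sum_(k : 'X_{1..n < (mdeg m).+1, (mdeg m).+1} | m == (k.1 + k.2)%MM) f k.1 * g k.2.
Proof. by []. Qed.

Lemma gcoefM_only f g m m1 m2 : m = (m1 + m2)%MM ->
  (forall k1 k2, m = (k1 + k2)%MM -> (k1, k2) != (m1, m2) -> f k1 * g k2 = 0) ->
  (f * g) m = f m1 * g m2.
Proof.
move=> e h; rewrite gcoefM.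
have l1 : (mdeg m1 < (mdeg m).+1)%N by rewrite e mdegD ltnS leq_addr.
have l2 : (mdeg m2 < (mdeg m).+1)%N by rewrite e mdegD ltnS leq_addl.
rewrite (bigD1 (BMultinom l1, BMultinom l2)) /=; last exact/eqP.
rewrite big1 ?addr0 // => -[k1 k2] /andP[/= /eqP e' nk]; exact: h.
Qed.

Lemma gcoefM0 f g : (f * g) 0%MM = f 0%MM * g 0%MM.
Proof.
apply: gcoefM_only => [|k1 k2 e /eqP[]]; first by rewrite addm0.
have /eqP := congr1 (@mdeg n) e.
by rewrite mdeg0 mdegD eq_sym addn_eq0 !mdeg_eq0 => /andP[/eqP-> /eqP->].
Qed.

Lemma gcoefZ (c : C) f m : (germ_const n c * f) m = c * f m.
Proof.
rewrite (gcoefM_only (m1 := 0%MM) (m2 := m)) ?add0m //= /ps_const ?eqxx // => k1 k2 ->.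
case: (k1 =P 0%MM) => [->|_ _]; last by rewrite mul0r.
by rewrite add0m eqxx.
Qed.

Lemma germ_const1 : germ_const n (1 : C) = 1. Proof. by []. Qed.
Lemma germ_constD (a b : C) : germ_const n (a + b) = germ_const n a + germ_const n b.
Proof. by apply: germP => m; rewrite gcoefD /= /ps_const; case: eqP; rewrite ?addr0. Qed.
Lemma germ_constM (a b : C) : germ_const n (a * b) = germ_const n a * germ_const n b.
Proof. by apply: germP => m; rewrite gcoefZ /= /ps_const; case: eqP; rewrite ?mulr0. Qed.
Lemma germ_constMn (k : nat) : germ_const n (k%:R : C) = k%:R.
Proof. by elim: k => // k ih; rewrite -!natr1 germ_constD ih. Qed.

Lemma germ_constN (a : C) : germ_const n (- a) = - germ_const n a.
Proof. by apply/eqP; rewrite -subr_eq0 opprK -germ_constD addNr. Qed.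
Lemma germ_const_int (z : int) : germ_const n (z%:~R : C) = z%:~R.
Proof.
case: z => a; first exact: germ_constMn.
by rewrite NegzE !mulrNz germ_constN; congr (- _); exact: germ_constMn.
Qed.

Lemma germ_const_inv (c : C) : c != 0 -> germ_const n c * germ_const n c^-1 = 1.
Proof. by move=> c0; rewrite -germ_constM divff. Qed.

Lemma gcoef_var (i : 'I_n) m : germ_var C i m = (m == U_(i)%MM)%:R.
Proof. by []. Qed.

Lemma gcoef_varM i f m : (germ_var C i * f) (m + U_(i))%MM = f m.
Proof.
rewrite (gcoefM_only (m1 := U_(i)%MM) (m2 := m)) 1?addmC // ?gcoef_var ?eqxx ?mul1r //.
move=> k1 k2; case: (k1 =P U_(i)%MM) => [-> /addmI ->|/eqP ne _ _]; first by rewrite eqxx.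
by rewrite gcoef_var (negbTE ne) mul0r.
Qed.

(** Allows an identity to be proved for [theta], which carries a factor x_i, and divided by x_i
    afterwards. *)
Lemma germ_varI i f g : germ_var C i * f = germ_var C i * g -> f = g.
Proof.
by move=> e; apply: germP => m; rewrite -(gcoef_varM i) e gcoef_varM.
Qed.

Definition wdeg S m := (\sum_(i | S i) m i)%N.

Lemma wdegD S m1 m2 : wdeg S (m1 + m2)%MM = (wdeg S m1 + wdeg S m2)%N.
Proof. by rewrite /wdeg -big_split; apply: eq_bigr => i _; rewrite mnmDE. Qed.
Lemma wdeg0 S : wdeg S 0%MM = 0%N.
Proof. by rewrite /wdeg big1 // => i _; rewrite mnm0E. Qed.
Lemma wdegU S i : wdeg S U_(i)%MM = S i.
Proof.
rewrite /wdeg; case Si: (S i); last first.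
  by rewrite big1 // => j Sj; rewrite mnm1E; case: eqP Sj => // <-; rewrite Si.
rewrite (bigD1 i) //= mnm1E eqxx big1 ?addn0 // => j /andP[_].
by rewrite mnm1E eq_sym => /negbTE ->.
Qed.
Lemma wdegT m : wdeg predT m = mdeg m.
Proof. by rewrite mdegE. Qed.

(* [vanish S w] is the w-th power of the ideal generated by the variables in S. *)
Definition vanish S w f := forall m, (wdeg S m < w)%N -> f m = 0.

Lemma vanish0 S w : vanish S w 0. Proof. by move=> m _; rewrite gcoef0. Qed.
Lemma vanish_0 S f : vanish S 0 f. Proof. by []. Qed.
Lemma vanishD S w f g : vanish S w f -> vanish S w g -> vanish S w (f + g).
Proof. by move=> hf hg m lm; rewrite gcoefD hf ?hg ?addr0. Qed.
Lemma vanishN S w f : vanish S w f -> vanish S w (- f).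
Proof. by move=> hf m lm; rewrite gcoefN hf ?oppr0. Qed.
Lemma vanishB S w f g : vanish S w f -> vanish S w g -> vanish S w (f - g).
Proof. by move=> hf hg; apply: vanishD => //; apply: vanishN. Qed.
Lemma vanish_sum S w (I : Type) (r : seq I) (P : pred I) (F : I -> germ C n) :
  (forall i, P i -> vanish S w (F i)) -> vanish S w (\sum_(i <- r | P i) F i).
Proof.
move=> h; elim/big_ind: _ => //; [exact: vanish0 | by move=> x y; apply: vanishD].
Qed.
Lemma vanishM S w1 w2 f g : vanish S w1 f -> vanish S w2 g -> vanish S (w1 + w2) (f * g).
Proof.
move=> hf hg m lm; rewrite gcoefM big1 // => -[k1 k2] /= /eqP e.
have [l1|l1] := ltnP (wdeg S k1) w1; first by rewrite hf ?mul0r.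
have ed : wdeg S m = (wdeg S k1 + wdeg S k2)%N by rewrite -wdegD -e.
rewrite hg ?mulr0 //; rewrite ed in lm.
by rewrite -(ltn_add2l w1); apply: leq_ltn_trans lm; rewrite leq_add2r.
Qed.
Lemma vanishMl S w f g : vanish S w g -> vanish S w (f * g).
Proof. by move=> h; have := vanishM (@vanish_0 S f) h. Qed.
Lemma vanishMr S w f g : vanish S w f -> vanish S w (f * g).
Proof. by move=> h; rewrite mulrC; apply: vanishMl. Qed.
Lemma vanish_var S i : S i -> vanish S 1 (germ_var C i).
Proof.
move=> Si m; rewrite gcoef_var; case: eqP => // ->.
by rewrite wdegU Si.
Qed.
Lemma vanishW S w1 w2 f : (w1 <= w2)%N -> vanish S w2 f -> vanish S w1 f.
Proof. by move=> le h m lm; apply: h; apply: leq_trans le. Qed.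
Lemma vanish_sub S S' w f : (forall i, S i -> S' i) -> vanish S w f -> vanish S' w f.
Proof.
move=> h hf m lm; apply: hf; apply: leq_ltn_trans lm.
rewrite /wdeg [leqLHS]big_mkcond [leqRHS]big_mkcond; apply: leq_sum => i _.
by case: ifP => // /h ->.
Qed.
Lemma vanish_eq0 S f : (forall w, vanish S w f) -> f = 0.
Proof. by move=> h; apply: germP => m; rewrite gcoef0 (h (wdeg S m).+1). Qed.
Lemma vanish1_coef f : vanish predT 1 f <-> f 0%MM = 0.
Proof.
split=> [h|h m]; first by apply: h; rewrite wdeg0.
by rewrite wdegT ltnS leqn0 mdeg_eq0 => /eqP ->.
Qed.

(** Being diagonal on monomials, this derivation preserves [vanish S w] for every S, whereas
    [germ_der i] is only shown to do so for i outside S. *)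
Definition theta (i : 'I_n) f : germ C n := germ_var C i * germ_der i f.

Lemma gcoef_theta i f m : theta i f m = f m *+ m i.
Proof.
have [m0|mi] := posnP (m i).
  have v : vanish (pred1 i) 1 (theta i f) by apply/vanishMr/vanish_var => /=.
  by rewrite m0 mulr0n; apply: v; rewrite /wdeg big_pred1_eq m0.
have -> : m = ((m - U_(i)) + U_(i))%MM.
  apply/mnmP => j; rewrite mnmDE mnmBE mnm1E; case: eqP => [<-|_]; first by rewrite subnK.
  by rewrite subn0 addn0.
by rewrite /theta gcoef_varM /= /ps_der mnmDE mnm1E eqxx addn1.
Qed.

Lemma thetaD i f g : theta i (f + g) = theta i f + theta i g.
Proof. by apply: germP => m; rewrite !(gcoefD, gcoef_theta) mulrnDl. Qed.

Lemma thetaM i f g : theta i (f * g) = theta i f * g + f * theta i g.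
Proof.
apply: germP => m; rewrite gcoef_theta gcoefD !gcoefM -big_split -sumrMnl.
apply: eq_bigr => k /eqP e; rewrite !gcoef_theta.
have -> : m i = (k.1 i + k.2 i)%N by rewrite -mnmDE -e.
rewrite mulrnDr; by rewrite mulrnAl mulrnAr.
Qed.

Lemma theta_comm i j f : theta i (theta j f) = theta j (theta i f).
Proof. by apply: germP => m; rewrite !gcoef_theta -!mulrnA mulnC. Qed.

Lemma vanish_theta S w i f : vanish S w f -> vanish S w (theta i f).
Proof. by move=> h m lm; rewrite gcoef_theta h ?mul0rn. Qed.

Lemma vanish_der S w i f : ~~ S i -> vanish S w f -> vanish S w (germ_der i f).
Proof.
move=> Si h m lm /=; rewrite /ps_der h ?mul0rn //.
by rewrite wdegD wdegU (negbTE Si) addn0.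
Qed.

(** Characteristic 0: a monomial of positive degree in S contains some x_i with i in S, and
    [theta i] multiplies its coefficient by the nonzero integer m i. This is the induction step of
    the uniqueness arguments below. *)
Lemma vanishS S w f : vanish S 1 f ->
  (forall i, S i -> vanish S w.+1 (theta i f)) -> vanish S w.+1 f.
Proof.
move=> h1 h m lm; have [l0|] := posnP (wdeg S m); first by rewrite h1 ?l0.
case: (pickP [pred i | S i && (m i != 0)]%N) => [i /andP[Si mi] _|ne]; last first.
  rewrite /wdeg big1 // => i Si; apply/eqP; have := ne i.
  by rewrite /= Si; case: eqP.
have /eqP := h i Si m lm; rewrite gcoef_theta mulrn_eq0 (negbTE mi) => /eqP ->.
by [].
Qed.

Lemma gcoef_der i f m : germ_der i f m = f (m + U_(i))%MM *+ (m i).+1.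
Proof. by []. Qed.
Lemma germ_derD i f g : germ_der i (f + g) = germ_der i f + germ_der i g.
Proof. by apply: germP => m; rewrite !(gcoefD, gcoef_der) mulrnDl. Qed.
(** The Leibniz rule for [theta] is a computation on coefficients; here the factor x_i is cancelled
    from it. *)
Lemma germ_derM i f g : germ_der i (f * g) = germ_der i f * g + f * germ_der i g.
Proof.
apply: (@germ_varI i); have := thetaM i f g.
by rewrite /theta => ->; ring.
Qed.
Lemma germ_der_const i (c : C) : germ_der i (germ_const n c) = 0.
Proof.
apply: germP => m; rewrite gcoef0 gcoef_der /= /ps_const; case: eqP => [e|_]; last by rewrite mul0rn.
by have := congr1 (@mdeg n) e; rewrite mdegD mdeg1 mdeg0 addn1.
Qed.
Lemma germ_der_var (i j : 'I_n) : germ_der i (germ_var C j) = (i == j)%:R.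
Proof.
apply: germP => m; rewrite gcoef_der gcoef_var -germ_constMn /= /ps_const.
have [<-|nij] := eqVneq i j.
  case: (m =P 0%MM) => [->|nm]; first by rewrite add0m eqxx mnm0E.
  case: eqP => [e|_]; last by rewrite mul0rn.
  by case: nm; apply: (can_inj (addmK U_(i)%MM)); rewrite e add0m.
rewrite if_same; case: eqP => [e|_]; last by rewrite mul0rn.
have := congr1 (fun x : 'X_{1..n} => x i) e.
by rewrite mnmDE !mnm1E eqxx eq_sym (negbTE nij) addn1.
Qed.
Lemma germ_der_comm i j f : germ_der i (germ_der j f) = germ_der j (germ_der i f).
Proof.
apply: germP => m; rewrite !gcoef_der -!mulrnA -!addmA [(U_(j) + _)%MM]addmC.
congr (_ *+ _); rewrite !mnmDE !mnm1E [j == i]eq_sym.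
by case: eqP => [->|_]; rewrite ?addn0 // mulnC.
Qed.

Section Logder.
Variable k : nat.

Let lc (i : 'I_n) : germ C n := if (i < k)%N then germ_var C i else 1.

Lemma logderD i f g : logder k i (f + g) = logder k i f + logder k i g.
Proof. by rewrite /logder germ_derD mulrDr. Qed.
Lemma logderM i f g : logder k i (f * g) = logder k i f * g + f * logder k i g.
Proof. by rewrite /logder germ_derM; ring. Qed.
Lemma logder_const i (c : C) : logder k i (germ_const n c) = 0.
Proof. by rewrite /logder germ_der_const mulr0. Qed.
Lemma logder0 (i : 'I_n) : logder k i (0 : germ C n) = 0. Proof. exact: logder_const. Qed.
Lemma logder1 (i : 'I_n) : logder k i (1 : germ C n) = 0. Proof. exact: logder_const. Qed.
Lemma logder_nat i (a : nat) : logder k i (a%:R : germ C n) = 0.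
Proof. by rewrite -germ_constMn logder_const. Qed.
Lemma logderN i f : logder k i (- f) = - logder k i f.
Proof. by apply/eqP; rewrite -subr_eq0 opprK -logderD addNr logder0. Qed.
Lemma logderB i f g : logder k i (f - g) = logder k i f - logder k i g.
Proof. by rewrite logderD logderN. Qed.
Lemma logderMn i f a : logder k i (f *+ a) = logder k i f *+ a.
Proof. by elim: a => [|a ih]; rewrite ?logder0 // !mulrS logderD ih. Qed.
Lemma logder_sum i (I : Type) (r : seq I) (P : pred I) (F : I -> germ C n) :
  logder k i (\sum_(j <- r | P j) F j) = \sum_(j <- r | P j) logder k i (F j).
Proof. by elim/big_rec2: _ => [|j y x _ <-]; rewrite ?logder0 ?logderD. Qed.
Lemma logder_var (i j : 'I_n) : logder k i (germ_var C j) = (i == j)%:R * lc i.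
Proof. by rewrite /logder germ_der_var mulrC. Qed.
Lemma logder_comm (i j : 'I_n) f : logder k i (logder k j f) = logder k j (logder k i f).
Proof.
have [->//|nij] := eqVneq i j.
have d0 (a b : 'I_n) : a != b -> germ_der a (lc b) = 0.
  by move=> ab; rewrite /lc; case: ifP; rewrite ?germ_der_const // germ_der_var (negbTE ab).
have d1 : germ_der i (lc j) = 0 by apply: d0.
have d2 : germ_der j (lc i) = 0 by apply: d0; rewrite eq_sym.
rewrite /logder !germ_derM -/(lc i) -/(lc j) d1 d2 (germ_der_comm i j); ring.
Qed.
Lemma theta_logder i f : theta i f = (if (i < k)%N then 1 else germ_var C i) * logder k i f.
Proof. by rewrite /theta /logder; case: ifP; rewrite mul1r. Qed.
Lemma vanish_logder S w i f : ~~ S i -> vanish S w f -> vanish S w (logder k i f).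
Proof. by move=> Si h; apply/vanishMl/vanish_der. Qed.
End Logder.

End Coefficients.

(** * Weighted norms and fixed points *)

Section WeightedNorms.
Variables (C : numFieldType) (n : nat).
Implicit Types (f g : germ C n) (m : 'X_{1..n}) (S : pred 'I_n).

(* The weighted l^1 norms below make the germs of finite norm a Banach algebra;
   only the truncated sums are used, so that no completeness of C is needed. *)
Record weight (w : 'X_{1..n} -> C) : Prop := Weight {
  weight_gt0 : forall m, 0 < w m;
  weight0 : w 0%MM = 1;
  weightM : forall m1 m2, w (m1 + m2)%MM <= w m1 * w m2;
  weight_exp : exists2 r : C, 0 < r & forall m, r ^+ mdeg m <= w m
}.

Definition bounded (w : 'X_{1..n} -> C) (K : C) (f : 'X_{1..n} -> C) :=
  forall N, \sum_(m : 'X_{1..n < N}) `|f m| * w m <= K.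

Variable w : 'X_{1..n} -> C.
Hypothesis hw : weight w.

Let w0 m : 0 <= w m. Proof. exact/ltW/(weight_gt0 hw). Qed.

Lemma bounded_ge0 K (f : 'X_{1..n} -> C) : bounded w K f -> 0 <= K.
Proof.
by move=> /(_ 0%N); apply: le_trans; apply: sumr_ge0 => m _; rewrite mulr_ge0.
Qed.

Lemma boundedW K L (f : 'X_{1..n} -> C) : K <= L -> bounded w K f -> bounded w L f.
Proof. by move=> le h N; apply: le_trans (h N) le. Qed.

Lemma bounded_le K (f g : 'X_{1..n} -> C) :
  (forall m, `|f m| <= `|g m|) -> bounded w K g -> bounded w K f.
Proof.
by move=> h hg N; apply: le_trans (hg N); apply: ler_sum => m _; rewrite ler_wpM2r.
Qed.

Lemma boundedN K f : bounded w K f -> bounded w K (- f).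
Proof. by apply: bounded_le => m; rewrite gcoefN normrN. Qed.

Lemma boundedD K L f g : bounded w K f -> bounded w L g -> bounded w (K + L) (f + g).
Proof.
move=> hf hg N; apply: le_trans (lerD (hf N) (hg N)); rewrite -big_split.
by apply: ler_sum => m _; rewrite /= -mulrDl ler_wpM2r // ler_normD.
Qed.

Lemma boundedB K L f g : bounded w K f -> bounded w L g -> bounded w (K + L) (f - g).
Proof. by move=> hf /boundedN; apply: boundedD. Qed.

Lemma bounded_const (c : C) : bounded w `|c| (germ_const n c).
Proof.
move=> [|N]; first by rewrite big1 ?normr_ge0 // => -[m lm]; exfalso; move: (lm); rewrite ltn0.
rewrite (bigD1 (@bm0 n N)) //= /ps_const eqxx (weight0 hw) mulr1 big1 ?addr0 // => m.
by rewrite -val_eqE /= => /negbTE ->; rewrite normr0 mul0r.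
Qed.

Lemma bounded0 : bounded w 0 (0 : germ C n).
Proof. by have := bounded_const 0; rewrite normr0. Qed.
Lemma bounded1 : bounded w 1 (1 : germ C n).
Proof. by have := bounded_const 1; rewrite normr1. Qed.

Definition wnorm N (f : 'X_{1..n} -> C) := \sum_(m : 'X_{1..n < N}) `|f m| * w m.

Lemma wnorm_ge0 N (f : 'X_{1..n} -> C) : 0 <= wnorm N f.
Proof. by apply: sumr_ge0 => m _; rewrite mulr_ge0. Qed.

Lemma wnormB N f g : wnorm N (f - g) <= wnorm N f + wnorm N g.
Proof.
rewrite /wnorm -big_split; apply: ler_sum => m _ /=.
by rewrite -mulrDl ler_wpM2r // ler_normB.
Qed.

Lemma wnorm_sum N (I : Type) (r : seq I) (P : pred I) (F : I -> germ C n) :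
  wnorm N (\sum_(i <- r | P i) F i) <= \sum_(i <- r | P i) wnorm N (F i).
Proof.
rewrite /wnorm exchange_big; apply: ler_sum => m _.
rewrite gcoef_sum -mulr_suml ler_wpM2r //; exact: ler_norm_sum.
Qed.

(** The weight is absorbed in the coefficients: with |f m| w m and |g m| w m as new coefficients
    this is [psnormM] at radius 1, and [weightM] compares the products. *)
Lemma wnormM N f g : wnorm N (f * g) <= wnorm N f * wnorm N g.
Proof.
pose F m : C := `|f m| * w m; pose G m : C := `|g m| * w m.
have psn (H : 'X_{1..n} -> C) : (forall m, 0 <= H m) ->
    psnorm N 1 H = \sum_(m : 'X_{1..n < N}) H m.
  by move=> H0; apply: eq_bigr => m _; rewrite expr1n mulr1 ger0_norm.
have F0 m : 0 <= F m by rewrite mulr_ge0.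
have G0 m : 0 <= G m by rewrite mulr_ge0.
have FG0 m : 0 <= ps_mul F G m by apply: sumr_ge0 => k _; rewrite mulr_ge0.
apply: (@le_trans _ _ (psnorm N 1 (ps_mul F G))).
  rewrite psn //; apply: ler_sum => m _; rewrite gcoefM.
  apply: (le_trans (ler_wpM2r (w0 m) (ler_norm_sum _ _ _))).
  rewrite mulr_suml; apply: ler_sum => k /eqP e.
  rewrite normrM /F /G mulrACA ler_wpM2l ?mulr_ge0 //.
  by have := weightM hw k.1 k.2; rewrite -e.
by apply: (le_trans (psnormM _ _ _ ler01)); rewrite !psn.
Qed.

Lemma boundedM K L f g : bounded w K f -> bounded w L g -> bounded w (K * L) (f * g).
Proof.
move=> hf hg N; apply: le_trans (wnormM N f g) _.
by apply: ler_pM; rewrite ?wnorm_ge0 //; [exact: hf | exact: hg].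
Qed.

Lemma bounded_sum (I : Type) (r : seq I) (P : pred I) (K : I -> C) (F : I -> germ C n) :
  (forall i, P i -> bounded w (K i) (F i)) ->
  bounded w (\sum_(i <- r | P i) K i) (\sum_(i <- r | P i) F i).
Proof.
move=> h; elim/big_rec2: _ => [|i y x Pi hx]; first exact: bounded0.
exact: boundedD (h i Pi) hx.
Qed.

Lemma bounded_convergent K (f : 'X_{1..n} -> C) : bounded w K f -> convergent f.
Proof.
move=> hf; have [r r0 hr] := weight_exp hw; have K0 := bounded_ge0 hf.
apply: (@cauchy_convergent _ _ _ r^-1 K); rewrite ?invr_gt0 // => m.
rewrite exprVn ler_pdivlMr ?exprn_gt0 //.
apply: (@le_trans _ _ (`|f m| * w m)); first by rewrite ler_wpM2l.
have := hf (mdeg m).+1; apply: le_trans.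
rewrite (bigD1 (BMultinom (ltnSn (mdeg m)))) //= lerDl.
by apply: sumr_ge0 => k _; rewrite mulr_ge0.
Qed.

(** Since [Psi] gains one degree, the iterates stabilise coefficient by coefficient. The truncation
    of order N of the limit is that of an iterate, so the bound passes to the limit and makes it
    converge. Only deviations from c are bounded, because c itself is merely known to converge. *)
Lemma germ_fixpoint (I : Type) (c : I -> germ C n) (K : C)
    (Psi : (I -> germ C n) -> I -> germ C n) :
  let ok x := forall i, vanish predT 1 (x i - c i) /\ bounded w K (x i - c i) in
  0 <= K -> (forall x, ok x -> ok (Psi x)) ->
  (forall x y N, ok x -> ok y -> (forall i, vanish predT N.+1 (x i - y i)) ->
     forall i, vanish predT N.+2 (Psi x i - Psi y i)) ->
  exists2 x, ok x & forall i, Psi x i = x i.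
Proof.
move=> ok K0 hok hcontr; pose X k := iter k Psi c.
have okc : ok c.
  move=> i; rewrite subrr; split; first exact: vanish0.
  exact: boundedW bounded0.
have okX k : ok (X k) by elim: k => [|k ih] //=; apply: hok.
have agree1 x y : ok x -> ok y -> forall i, vanish predT 1 (x i - y i).
  move=> hx hy i; have -> : x i - y i = (x i - c i) - (y i - c i) by ring.
  by apply: vanishB; [case: (hx i) | case: (hy i)].
have stepX k i : vanish predT k.+1 (X k.+1 i - X k i).
  elim: k i => [|k ih] i; first exact: (agree1 _ _ (okX 1%N) (okX 0%N)).
  exact: (hcontr _ _ _ (okX k.+1) (okX k) ih).
have stabX k d i : vanish predT k.+1 (X (d + k)%N i - X k i).
  elim: d i => [|d ih] i; first by rewrite subrr; exact: vanish0.
  have -> : X (d.+1 + k)%N i - X k i =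
    (X (d + k).+1 i - X (d + k)%N i) + (X (d + k)%N i - X k i) by rewrite addSn; ring.
  by apply: vanishD => //; apply: vanishW (stepX _ _); rewrite ltnS leq_addl.
have coefX k i m : (mdeg m <= k)%N -> X k i m = X (mdeg m) i m.
  move=> le; have := stabX (mdeg m) (k - mdeg m)%N i m.
  rewrite subnK // wdegT ltnSn gcoefB => /(_ isT)/eqP.
  by rewrite subr_eq0 => /eqP.
(* The coefficient at m no longer changes from the iterate of index [mdeg m] on. *)
pose y i m : C := (X (mdeg m) i - c i) m.
have by_ i : bounded w K (y i).
  move=> N; have [_ /(_ N)] := okX N i; apply: le_trans.
  rewrite le_eqVlt; apply/orP; left; apply/eqP; apply: eq_bigr => m _.
  by rewrite /y !gcoefB coefX // ltnW // bmdeg.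
pose x i : germ C n := Germ (bounded_convergent (by_ i)) + c i.
have xX k i : vanish predT k.+1 (x i - X k i).
  move=> m; rewrite wdegT ltnS => le; rewrite gcoefB gcoefD /= /y gcoefB subrK.
  by rewrite (coefX _ _ _ le) subrr.
have okx : ok x.
  move=> i; have e : x i - c i = Germ (bounded_convergent (by_ i)) by rewrite addrK.
  split; last by rewrite e; exact: by_.
  have -> : x i - c i = (x i - X 0%N i) + (X 0%N i - c i) by ring.
  by apply: vanishD; [exact: xX | case: (okX 0%N i)].
exists x => // i; apply/eqP; rewrite -subr_eq0; apply/eqP.
apply: (@vanish_eq0 _ _ predT) => N; apply: (@vanishW _ _ _ _ N.+2); first by rewrite -addn2 leq_addr.
have -> : Psi x i - x i = (Psi x i - Psi (X N) i) + (X N.+1 i - x i) by rewrite /=; ring.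
apply: vanishD; first exact: hcontr.
by rewrite -opprB; apply: vanishN.
Qed.

End WeightedNorms.

(** * Smallness of germs without constant term, and units *)

Section GeometricWeight.
Variables (C : numFieldType) (n : nat).

Lemma weight_geom (r : C) : 0 < r -> weight (fun m : 'X_{1..n} => r ^+ mdeg m).
Proof.
move=> r0; split; rewrite ?mdeg0 ?expr0 //.
- by move=> m; rewrite exprn_gt0.
- by move=> m1 m2; rewrite mdegD exprD.
- by exists r.
Qed.

(** All monomials of a germ without constant term have positive degree, so shrinking the radius from
    s to r gains a factor r / s. Any weight below r ^+ mdeg m is allowed, so that the lemma serves
    for [ck_weight] as well. *)
Lemma germ_small (I : finType) (F : I -> germ C n) (e : C) : 0 < e ->
  (forall i, vanish predT 1 (F i)) ->
  exists2 r0 : C, 0 < r0 & forall r, 0 < r -> r <= r0 ->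
    forall w : 'X_{1..n} -> C, (forall m, 0 <= w m) -> (forall m, w m <= r ^+ mdeg m) ->
    forall i, bounded w e (F i).
Proof.
move=> e0 hF.
have /choice[s hs] (i : I) : exists s : C * C, [/\ 0 < s.1, 0 < s.2 & forall N, psnorm N s.1 (F i) <= s.2].
  have [r r0 [K hK]] := gcoefP (F i).
  have K0 : 0 <= K by apply: (le_trans _ (hK 0%N)); apply: psnorm_ge0; exact: ltW.
  exists (r, K + 1); split=> //=; first by rewrite ltr_wpDl.
  by move=> N; apply: le_trans (hK N) _; rewrite lerDl.
(* For r at most 1 / t, and for each germ of norm at most K at radius s, both r / s and r K / (s e)
   are at most 1; the sum over I plays the part of a maximum. *)
pose t : C := 1 + \sum_i ((s i).1^-1 + (s i).2 / (e * (s i).1)).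
have hp i : 0 < (s i).1^-1 + (s i).2 / (e * (s i).1).
  by have [s1 s2 _] := hs i; rewrite addr_gt0 ?divr_gt0 ?invr_gt0 ?mulr_gt0.
have t0 : 0 < t by rewrite ltr_wpDr // sumr_ge0 // => i _; apply: ltW.
exists t^-1; first by rewrite invr_gt0.
move=> r r0 rt w w0 wr i N; have [s1 s2 hN] := hs i.
have rr : (s i).1^-1 + (s i).2 / (e * (s i).1) <= r^-1.
  apply: (@le_trans _ _ t); last by rewrite -[t]invrK lef_pV2 ?posrE ?invr_gt0.
  rewrite /t (bigD1 i) //= addrCA lerDl addr_ge0 // sumr_ge0 // => j _; exact: ltW.
have rs : r / (s i).1 <= 1.
  rewrite -(ler_pM2l (_ : 0 < r^-1)) ?invr_gt0 // mulrA mulVf ?lt0r_neq0 // mul1r mulr1.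
  by apply: le_trans rr; rewrite lerDl ltW // divr_gt0 // mulr_gt0.
have rK : r / (s i).1 * (s i).2 <= e.
  rewrite -(ler_pM2l (_ : 0 < e^-1 * r^-1)) ?mulr_gt0 ?invr_gt0 //.
  have -> : e^-1 * r^-1 * (r / (s i).1 * (s i).2) = (s i).2 / (e * (s i).1).
    by field; rewrite !lt0r_neq0.
  have -> : e^-1 * r^-1 * e = r^-1 by field; rewrite !lt0r_neq0.
  by apply: le_trans rr; rewrite lerDr ltW // invr_gt0.
apply: le_trans rK; apply: le_trans (ler_wpM2l _ (hN N)); last first.
  by rewrite divr_ge0 ?ltW.
rewrite /psnorm mulr_sumr; apply: ler_sum => m _.
have [m0|] := posnP (mdeg m).
  by rewrite (hF i) ?wdegT ?m0 // normr0 !mul0r mulr0.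
move=> m0; apply: (@le_trans _ _ (`|F i m| * r ^+ mdeg m)); first by rewrite ler_wpM2l.
rewrite mulrCA ler_wpM2l //.
have -> : r ^+ mdeg m = (r / (s i).1) ^+ mdeg m * (s i).1 ^+ mdeg m.
  by rewrite -exprMn divfK ?lt0r_neq0.
rewrite ler_wpM2r ?exprn_ge0 ?(ltW s1) // -(prednK m0) exprS.
have rs0 : 0 <= r / (s i).1 by rewrite divr_ge0 // ltW.
by rewrite ler_piMr // exprn_ile1.
Qed.

Lemma vanish_sub_const (f : germ C n) : vanish predT 1 (f - germ_const n (f 0%MM)).
Proof. by apply/vanish1_coef; rewrite gcoefB /= /ps_const eqxx subrr. Qed.

(** Write f = c (1 + h) with h of norm at most 1/2: the inverse of 1 + h is the fixed point of x ->
    1 - h x in the ball of radius 1 around 1. *)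
Lemma germ_unitE (f : germ C n) : (f \is a GRing.unit) = (f 0%MM != 0).
Proof.
apply/idP/idP => [u|f0].
  apply/eqP => f0; have := gcoefM0 f^-1 f.
  by rewrite mulVr // f0 mulr0 gcoef1 eqxx => /eqP; rewrite oner_eq0.
pose c := f 0%MM; pose h : germ C n := germ_const n c^-1 * (f - germ_const n c).
have vh : vanish predT 1 h by apply/vanishMl/vanish_sub_const.
have [] := @germ_small unit (fun _ => h) 2^-1 _ (fun _ => vh); first by rewrite invr_gt0.
move=> r r0 /(_ r r0 (lexx _) (fun m => r ^+ mdeg m)).
move=> /(_ (fun m => exprn_ge0 _ (ltW r0)) (fun m => lexx _) tt) hb.
have hw := weight_geom r0.
have [] := @germ_fixpoint C n _ hw unit (fun _ => 1) 1 (fun x _ => 1 - h * x tt) => //.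
- move=> x /(_ tt) [v b] _; cbv beta; split.
    have -> : 1 - h * x tt - 1 = - (h * x tt) by ring.
    exact/vanishN/vanishMr.
  have -> : 1 - h * x tt - 1 = - (h * ((x tt - 1) + 1)) by ring.
  apply: boundedN => //; apply: (boundedW _ (boundedM hw hb (boundedD hw b (bounded1 hw)))).
  by rewrite -[1 + 1]/(2%:R) mulVf ?pnatr_eq0.
- move=> x y N _ _ hxy i; cbv beta.
  have -> : 1 - h * x tt - (1 - h * y tt) = h * - (x tt - y tt) by ring.
  by apply: (@vanishM _ _ _ 1 N.+1) => //; apply: vanishN.
move=> x _ /(_ tt) e; apply: (@germ_unitPl _ _ _ (x tt * germ_const n c^-1)).
have -> : f = germ_const n c * (1 + h).
  by rewrite mulrDr mulr1 /h mulrA germ_const_inv // mul1r addrC subrK.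
transitivity (germ_const n c * germ_const n c^-1 * (x tt + h * x tt)); first by ring.
by rewrite germ_const_inv // mul1r -[X in X + _]e subrK.
Qed.

End GeometricWeight.

Section Evaluation.
Variables (C : numFieldType) (n : nat).

Definition germ_at0 (f : germ C n) : C := f 0%MM.

Lemma germ_at0_zmod_morphism : zmod_morphism germ_at0.
Proof. by []. Qed.
Lemma germ_at0_monoid_morphism : monoid_morphism germ_at0.
Proof. by split=> [|f g]; [rewrite /germ_at0 gcoef1 eqxx | exact: gcoefM0]. Qed.
HB.instance Definition _ := GRing.isZmodMorphism.Build _ _ germ_at0 germ_at0_zmod_morphism.
HB.instance Definition _ := GRing.isMonoidMorphism.Build _ _ germ_at0 germ_at0_monoid_morphism.

Lemma unitmx_at0 r (A : 'M[germ C n]_r) : (A \in unitmx) = (map_mx germ_at0 A \in unitmx).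
Proof. by rewrite !unitmxE det_map_mx unitfE germ_unitE. Qed.

End Evaluation.

Section Constants.
Variables (C : numFieldType) (n : nat).
Definition germ_cst : C -> germ C n := germ_const n.
Lemma germ_cst_zmod_morphism : zmod_morphism germ_cst.
Proof. by move=> a b; rewrite /germ_cst germ_constD germ_constN. Qed.
Lemma germ_cst_monoid_morphism : monoid_morphism germ_cst.
Proof. by split=> // a b; exact: germ_constM. Qed.
HB.instance Definition _ := GRing.isZmodMorphism.Build _ _ germ_cst germ_cst_zmod_morphism.
HB.instance Definition _ := GRing.isMonoidMorphism.Build _ _ germ_cst germ_cst_monoid_morphism.
End Constants.

(** * Logarithmic connections *)

Section Integration.
Variables (C : numFieldType) (n : nat).
Implicit Types (f g : germ C n) (m : 'X_{1..n}) (S : pred 'I_n).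

Lemma germ_int_le S f m : `|f m / (wdeg S m)%:R| <= `|f m|.
Proof.
have [->|w0] := posnP (wdeg S m); first by rewrite invr0 mulr0 normr0.
rewrite normrM normfV normr_nat ler_pdivrMr ?ltr0n // ler_peMr //.
by rewrite ler1n.
Qed.

Lemma convergent_int S f : convergent (fun m => f m / (wdeg S m)%:R).
Proof.
have [r r0 [K hK]] := gcoefP f; exists r => //; exists K => N; apply: le_trans (hK N).
by apply: ler_sum => m _; rewrite ler_wpM2r ?exprn_ge0 ?(ltW r0) // germ_int_le.
Qed.

(* Inverse of the Euler field of the variables in S; the terms of weight 0 are
   killed, being divided by 0. *)
Definition germ_int S f : germ C n := Germ (convergent_int S f).

Lemma gcoef_int S f m : germ_int S f m = f m / (wdeg S m)%:R. Proof. by []. Qed.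

Lemma germ_intB S f g : germ_int S (f - g) = germ_int S f - germ_int S g.
Proof. by apply: germP => m; rewrite gcoefB !gcoef_int gcoefB mulrBl. Qed.

Lemma vanish_int S S' w f : vanish S' w f -> vanish S' w (germ_int S f).
Proof. by move=> h m lm; rewrite gcoef_int h ?mul0r. Qed.

Lemma vanish1_int S f : vanish S 1 (germ_int S f).
Proof. by move=> m; rewrite ltnS leqn0 gcoef_int => /eqP ->; rewrite invr0 mulr0. Qed.

Lemma bounded_int (w : 'X_{1..n} -> C) K S f : weight w -> bounded w K f ->
  bounded w K (germ_int S f).
Proof. by move=> hw; apply: bounded_le => // m; exact: germ_int_le. Qed.

Definition euler S f := \sum_(i | S i) theta i f.

Lemma gcoef_euler S f m : euler S f m = f m *+ wdeg S m.
Proof.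
rewrite gcoef_sum /wdeg -sumrMnr; apply: eq_bigr => i _; exact: gcoef_theta.
Qed.

Lemma euler_int S f : vanish S 1 f -> euler S (germ_int S f) = f.
Proof.
move=> v; apply: germP => m; rewrite gcoef_euler gcoef_int.
have [m0|m0] := posnP (wdeg S m); first by rewrite m0 mulr0n v ?m0.
by rewrite -[LHS]mulr_natr divfK // pnatr_eq0 -lt0n.
Qed.

Lemma theta_int1 (i : 'I_n) f : vanish (pred1 i) 1 f -> theta i (germ_int (pred1 i) f) = f.
Proof. by move=> /euler_int; rewrite /euler big_pred1_eq. Qed.

Lemma vanish_euler S w f : vanish S 1 f -> vanish S w.+1 (euler S f) -> vanish S w.+1 f.
Proof.
move=> h1 h m lm; have [l0|l0] := posnP (wdeg S m); first by rewrite h1 ?l0.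
have /eqP := h m lm; rewrite gcoef_euler mulrn_eq0 => /orP[/eqP e|/eqP //].
by rewrite e in l0.
Qed.

End Integration.

Section MatrixCalculus.
Variables (C : numFieldType) (n : nat).
Local Notation G := (germ C n).
Implicit Types (S : pred 'I_n) (w m p q : nat).

Lemma mxeD (R : nmodType) (m p : nat) (A B : 'M[R]_(m, p)) i j : (A + B) i j = A i j + B i j.
Proof. by rewrite mxE. Qed.
Lemma mxeN (R : zmodType) (m p : nat) (A : 'M[R]_(m, p)) i j : (- A) i j = - A i j.
Proof. by rewrite mxE. Qed.
Lemma mxeZ (R : pzSemiRingType) (m p : nat) (c : R) (A : 'M[R]_(m, p)) i j : (c *: A) i j = c * A i j.
Proof. by rewrite mxE. Qed.

Lemma mxe0 (R : nmodType) (m p : nat) i j : (0 : 'M[R]_(m, p)) i j = 0.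
Proof. by rewrite mxE. Qed.

Definition mvanish (S : pred 'I_n) (w m p : nat) (A : 'M[G]_(m, p)) :=
  forall i j, vanish S w (A i j).

Section Ideals.
Variables (S : pred 'I_n) (w : nat).

Lemma mvanish0 m p : mvanish S w (0 : 'M_(m, p)).
Proof. by move=> i j; rewrite mxE; apply: vanish0. Qed.
Lemma mvanishD m p (A B : 'M_(m, p)) : mvanish S w A -> mvanish S w B -> mvanish S w (A + B).
Proof. by move=> hA hB i j; rewrite mxE; apply: vanishD. Qed.
Lemma mvanishN m p (A : 'M_(m, p)) : mvanish S w A -> mvanish S w (- A).
Proof. by move=> hA i j; rewrite mxE; apply: vanishN. Qed.
Lemma mvanishB m p (A B : 'M_(m, p)) : mvanish S w A -> mvanish S w B -> mvanish S w (A - B).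
Proof. by move=> hA hB; apply: mvanishD => //; apply: mvanishN. Qed.
Lemma mvanish_sum m p (I : Type) (r : seq I) (P : pred I) (F : I -> 'M_(m, p)) :
  (forall i, P i -> mvanish S w (F i)) -> mvanish S w (\sum_(i <- r | P i) F i).
Proof.
by move=> h; elim/big_ind: _ => //; [exact: mvanish0 | move=> x y; apply: mvanishD].
Qed.
Lemma mvanishMw w' m p q (A : 'M_(m, p)) (B : 'M_(p, q)) :
  mvanish S w A -> mvanish S w' B -> mvanish S (w + w') (A *m B).
Proof. by move=> hA hB i j; rewrite mxE; apply: vanish_sum => k _; apply: vanishM. Qed.
Lemma mvanishMl m p q (A : 'M_(m, p)) (B : 'M_(p, q)) : mvanish S w B -> mvanish S w (A *m B).
Proof. by move=> hB i j; rewrite mxE; apply: vanish_sum => k _; apply: vanishMl. Qed.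
Lemma mvanishMr m p q (A : 'M_(m, p)) (B : 'M_(p, q)) : mvanish S w A -> mvanish S w (A *m B).
Proof. by move=> hA i j; rewrite mxE; apply: vanish_sum => k _; apply: vanishMr. Qed.
Lemma mvanishZ m p (c : G) (A : 'M_(m, p)) : mvanish S w A -> mvanish S w (c *: A).
Proof. by move=> hA i j; rewrite mxE; apply: vanishMl. Qed.
Lemma mvanishT m p (A : 'M_(m, p)) : mvanish S w A -> mvanish S w A^T.
Proof. by move=> hA i j; rewrite mxE. Qed.
End Ideals.

Lemma mvanish_0 S m p (A : 'M_(m, p)) : mvanish S 0 A. Proof. by move=> i j. Qed.

Lemma mvanish_eq0 S m p (A : 'M_(m, p)) : (forall w, mvanish S w A) -> A = 0.
Proof.
by move=> h; apply/matrixP => i j; rewrite mxE; apply: (@vanish_eq0 _ _ S) => w; exact: h.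
Qed.

Lemma mvanishZS S i w m p (A : 'M_(m, p)) : S i -> mvanish S w A ->
  mvanish S w.+1 (germ_var C i *: A).
Proof.
by move=> Si h a b; rewrite mxE; apply: (@vanishM _ _ _ 1 w) => //; apply: vanish_var.
Qed.

Definition mtheta (i : 'I_n) m p : 'M[G]_(m, p) -> 'M[G]_(m, p) := map_mx (theta i).
Definition mlogder k (i : 'I_n) m p : 'M[G]_(m, p) -> 'M[G]_(m, p) := map_mx (logder k i).

Lemma mthetaD i m p (A B : 'M_(m, p)) : mtheta i (A + B) = mtheta i A + mtheta i B.
Proof. by apply/matrixP => a b; rewrite !mxE thetaD. Qed.
Lemma theta0 i : theta i (0 : G) = 0.
Proof. by apply: germP => m; rewrite gcoef_theta gcoef0 mul0rn. Qed.
Lemma thetaN i (f : G) : theta i (- f) = - theta i f.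
Proof. by apply: germP => m; rewrite !(gcoef_theta, gcoefN) mulNrn. Qed.
Lemma thetaB i (f g : G) : theta i (f - g) = theta i f - theta i g.
Proof. by rewrite thetaD thetaN. Qed.
Lemma theta_sum i (I : Type) (r : seq I) (P : pred I) (F : I -> G) :
  theta i (\sum_(j <- r | P j) F j) = \sum_(j <- r | P j) theta i (F j).
Proof. by elim/big_rec2: _ => [|j y x _ <-]; rewrite ?theta0 ?thetaD. Qed.
Lemma mthetaN i m p (A : 'M_(m, p)) : mtheta i (- A) = - mtheta i A.
Proof. by apply/matrixP => a b; rewrite !mxE thetaN. Qed.
Lemma mthetaB i m p (A B : 'M_(m, p)) : mtheta i (A - B) = mtheta i A - mtheta i B.
Proof. by rewrite mthetaD mthetaN. Qed.
Lemma mthetaM i m p q (A : 'M_(m, p)) (B : 'M_(p, q)) :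
  mtheta i (A *m B) = mtheta i A *m B + A *m mtheta i B.
Proof.
apply/matrixP => a b; rewrite !mxE theta_sum -big_split /=.
by apply: eq_bigr => k _; rewrite !mxE thetaM.
Qed.
Lemma mthetaZ i m p (c : G) (A : 'M_(m, p)) :
  mtheta i (c *: A) = theta i c *: A + c *: mtheta i A.
Proof. by apply/matrixP => a b; rewrite !mxE thetaM. Qed.
Lemma mtheta_comm i j m p (A : 'M_(m, p)) : mtheta i (mtheta j A) = mtheta j (mtheta i A).
Proof. by apply/matrixP => a b; rewrite !mxE theta_comm. Qed.
Lemma mtheta_sum i m p (I : Type) (r : seq I) (P : pred I) (F : I -> 'M_(m, p)) :
  mtheta i (\sum_(j <- r | P j) F j) = \sum_(j <- r | P j) mtheta i (F j).
Proof.
apply/matrixP => a b; rewrite summxE mxE summxE theta_sum.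
by apply: eq_bigr => j _; rewrite mxE.
Qed.
Lemma mvanish_mtheta S w i m p (A : 'M_(m, p)) : mvanish S w A -> mvanish S w (mtheta i A).
Proof. by move=> h a b; rewrite mxE; apply: vanish_theta. Qed.

Section MLogder.
Variable k : nat.
Local Notation d := (mlogder k).
Lemma mlogderD i m p (A B : 'M_(m, p)) : d i (A + B) = d i A + d i B.
Proof. by apply/matrixP => a b; rewrite !mxE logderD. Qed.
Lemma mlogderN i m p (A : 'M_(m, p)) : d i (- A) = - d i A.
Proof. by apply/matrixP => a b; rewrite !mxE logderN. Qed.
Lemma mlogderB i m p (A B : 'M_(m, p)) : d i (A - B) = d i A - d i B.
Proof. by rewrite mlogderD mlogderN. Qed.
Lemma mlogderM i m p q (A : 'M_(m, p)) (B : 'M_(p, q)) :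
  d i (A *m B) = d i A *m B + A *m d i B.
Proof.
apply/matrixP => a b; rewrite !mxE logder_sum -big_split /=.
by apply: eq_bigr => j _; rewrite !mxE logderM.
Qed.
Lemma mlogderZ i m p (c : G) (A : 'M_(m, p)) :
  d i (c *: A) = logder k i c *: A + c *: d i A.
Proof. by apply/matrixP => a b; rewrite !mxE logderM. Qed.
Lemma mlogder_sum i m p (I : Type) (r : seq I) (P : pred I) (F : I -> 'M_(m, p)) :
  d i (\sum_(j <- r | P j) F j) = \sum_(j <- r | P j) d i (F j).
Proof.
apply/matrixP => a b; rewrite summxE mxE summxE logder_sum.
by apply: eq_bigr => j _; rewrite mxE.
Qed.
Lemma mvanish_mlogder S w i m p (A : 'M_(m, p)) : ~~ S i -> mvanish S w A -> mvanish S w (d i A).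
Proof. by move=> Si h a b; rewrite mxE; apply: vanish_logder. Qed.
Lemma mtheta_mlogder i m p (A : 'M_(m, p)) :
  mtheta i A = (if (i < k)%N then 1 else germ_var C i) *: d i A.
Proof. by apply/matrixP => a b; rewrite !mxE (theta_logder k). Qed.
End MLogder.

Lemma mvanish_euler S w m p (A : 'M_(m, p)) : mvanish S 1 A ->
  mvanish S w.+1 (\sum_(i | S i) mtheta i A) -> mvanish S w.+1 A.
Proof.
move=> h1 h a b; apply: vanish_euler; first exact: h1.
have := h a b; rewrite summxE.
by under eq_bigr => i _ do rewrite mxE.
Qed.

Lemma mvanishS S w m p (A : 'M_(m, p)) : mvanish S 1 A ->
  (forall i, S i -> mvanish S w.+1 (mtheta i A)) -> mvanish S w.+1 A.
Proof. by move=> h1 h; apply: mvanish_euler => //; apply: mvanish_sum. Qed.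

Lemma map_mx_scaleI (i : 'I_n) m p (A B : 'M[G]_(m, p)) :
  germ_var C i *: A = germ_var C i *: B -> A = B.
Proof.
move=> /matrixP h; apply/matrixP => a b; have := h a b; rewrite !mxE; exact: germ_varI.
Qed.

End MatrixCalculus.

(** For linear identities between matrices: the entries of products and derivatives become atoms
    before [ring] is called. *)
Ltac mx_group := apply/matrixP => ? ?; rewrite ?(mxeD, mxeN, mxeZ, mxe0);
  repeat match goal with |- context [@fun_of_matrix ?R ?m ?n ?A ?i ?j] =>
    move: (@fun_of_matrix R m n A i j) => ? end; ring.

(** * Flat sections along the variables transversal to the divisor *)

Section FlatConnections.
Variables (C : numFieldType) (n : nat).
Local Notation G := (germ C n).

(** If R lies in the w-th power of the ideal of S, then R N lies in the next one; the Euler field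
    multiplies each monomial by its degree in S, so the gain is transferred to R. *)
Lemma euler_eq0 (S : pred 'I_n) (m r : nat) (R : 'M[G]_(m, r)) (N : 'M[G]_r) :
  mvanish S 1 N -> mvanish S 1 R -> \sum_(i | S i) mtheta i R = R *m N -> R = 0.
Proof.
move=> hN hR e; apply: (@mvanish_eq0 _ _ S); elim=> [|w ih]; first exact: mvanish_0.
apply: mvanish_euler => //; rewrite e -addn1; exact: mvanishMw.
Qed.

(** P is a fixed point of P -> P0 + int (P N). The integration does not increase the norm, and N has
    no constant term, so it is small on a small polydisc. *)
Lemma euler_solve (S : pred 'I_n) (m r : nat) (P0 : 'M[G]_(m, r)) (N : 'M[G]_r) :
  mvanish S 1 N -> \sum_(i | S i) mtheta i P0 = 0 ->
  exists2 P, mvanish S 1 (P - P0) & \sum_(i | S i) mtheta i P = P *m N.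
Proof.
move=> hN hP0.
have hN1 i j : vanish predT 1 (N i j).
  apply/vanish1_coef; apply: hN; by rewrite wdeg0.
(* K bounds P0, hence K + K bounds every matrix of the ball of radius K around it; with the value of
   e below, r (K + K) e = K r / (r + 1) <= K. *)
pose K : C := 1 + \sum_i \sum_j `|P0 i j 0%MM|.
have K0 : 0 < K by rewrite ltr_wpDr // sumr_ge0 // => i _; rewrite sumr_ge0.
pose e : C := (2 * r.+1%:R)^-1.
have e0 : 0 < e by rewrite invr_gt0 mulr_gt0 ?ltr0n.
have e1 : e <= 1 by rewrite invf_le1 -?natrM ?ler1n ?ltr0n.
pose F (x : ('I_m * 'I_r) + ('I_r * 'I_r)) : G := match x with
  | inl p => P0 p.1 p.2 - germ_const n (P0 p.1 p.2 0%MM) | inr p => N p.1 p.2 end.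
have hF x : vanish predT 1 (F x) by case: x => p; [exact: vanish_sub_const | exact: hN1].
have [rho rho0 /(_ rho rho0 (lexx _) (fun m => rho ^+ mdeg m))] := germ_small e0 hF.
move=> /(_ (fun m => exprn_ge0 _ (ltW rho0)) (fun m => lexx _)) hb.
have hw := weight_geom n rho0; set w := fun m : 'X_{1..n} => _ in hw hb.
have hP0b i j : bounded w K (P0 i j).
  rewrite -[P0 i j](subrK (germ_const n (P0 i j 0%MM))).
  apply: (boundedW _ (boundedD hw (hb (inl (i, j))) (bounded_const hw _))).
  apply: lerD => //; rewrite (bigD1 i) //= (bigD1 j) //= -addrA lerDl addr_ge0 // sumr_ge0 // => i' _.
  by rewrite sumr_ge0.
have hNb i j : bounded w e (N i j) by exact: (hb (inr (i, j))).
pose mx (x : 'I_m * 'I_r -> G) : 'M[G]_(m, r) := \matrix_(i, j) x (i, j).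
have [] := @germ_fixpoint C n w hw _ (fun p => P0 p.1 p.2) K
  (fun x p => P0 p.1 p.2 + germ_int S ((mx x *m N) p.1 p.2)).
- exact: ltW.
- move=> x hx p; cbv beta; rewrite addrC addKr.
  split.
    apply: vanish_int; rewrite mxE; apply: vanish_sum => k _; exact: vanishMl.
  apply: bounded_int => //; rewrite mxE.
  have hk k : bounded w ((K + K) * e) (mx x p.1 k * N k p.2).
    apply: boundedM => //; rewrite mxE -[x _](subrK (P0 p.1 k)).
    by apply: boundedD => //; case: (hx (p.1, k)).
  have hs := @bounded_sum _ _ _ hw _ (index_enum _) xpredT _ _ (fun k _ => hk k).
  refine (boundedW _ hs).
  have -> : \sum_(i < r) (K + K) * e = K * (r%:R / r.+1%:R).
    rewrite sumr_const card_ord -mulr_natl /e.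
    have : r.+1%:R != 0 :> C by rewrite pnatr_eq0.
    by move: (r.+1%:R) => b b0; field.
  by rewrite ler_piMr ?(ltW K0) // ler_pdivrMr ?ltr0n // mul1r ler_nat.
- move=> x y k _ _ hxy p; cbv beta.
  rewrite addrAC opprD addrA subrr sub0r addrC -germ_intB.
  apply: vanish_int; rewrite !mxE -sumrB; apply: vanish_sum => a _.
  rewrite -mulrBl -addn1; apply: vanishM => //; rewrite !mxE; exact: hxy.
move=> x _ hx; exists (mx x).
  move=> i j; rewrite mxeD mxeN [mx x i j]mxE -hx /= addrC addKr; exact: vanish1_int.
apply/matrixP => i j; rewrite summxE.
transitivity (euler S (P0 i j + germ_int S ((mx x *m N) i j))).
  by apply: eq_bigr => a _; rewrite mxE; congr (theta a _); rewrite [LHS]mxE -hx.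
have -> : euler S (P0 i j + germ_int S ((mx x *m N) i j)) =
    (\sum_(i | S i) mtheta i P0) i j + euler S (germ_int S ((mx x *m N) i j)).
  rewrite summxE /euler -big_split; apply: eq_bigr => a _.
  by rewrite thetaD [in RHS]/mtheta [map_mx _ _ _ _]mxE.
rewrite hP0 mxE add0r euler_int // mxE; apply: vanish_sum => a _.
exact: vanishMl.
Qed.

(* A logarithmic connection is trivialised along the variables x_i, k <= i, by
   solving the single equation E P = P N for the radial field E of these
   variables; integrability then yields the remaining equations. *)
Lemma flat_trivialisation (k m r : nat) (Gam : 'I_n -> 'M[G]_r) (P0 : 'M[G]_(m, r)) :
  let S := [pred i : 'I_n | (k <= i)%N] in
  (forall i j, mlogder k i (Gam j) + Gam i *m Gam j = mlogder k j (Gam i) + Gam j *m Gam i) ->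
  (forall i, S i -> mtheta i P0 = 0) ->
  (forall i, ~~ S i -> mvanish S 1 (mlogder k i P0 - P0 *m Gam i)) ->
  exists2 P, mvanish S 1 (P - P0) & forall i, mlogder k i P = P *m Gam i.
Proof.
move=> S hflat hP0 hin.
pose c (i : 'I_n) : G := if (i < k)%N then 1 else germ_var C i.
(* Multiplication by c i turns the derivation [logder k i] into [theta i] and gives T i a factor x_i
   when i is in S, which makes N vanish on S = 0. The factor is cancelled at the end. *)
pose T i := c i *: Gam i.
have Sk i : S i = ~~ (i < k)%N by rewrite /S /= leqNgt.
have dc i j : i != j -> logder k i (c j) = 0.
  by move=> ij; rewrite /c; case: ifP; rewrite ?logder1 // logder_var (negbTE ij) mul0r.
have hth i p (A : 'M[G]_(p, r)) : mtheta i A = c i *: mlogder k i A by exact: mtheta_mlogder.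
have Tflat i j : mtheta i (T j) + T i *m T j = mtheta j (T i) + T j *m T i.
  have [->//|ij] := eqVneq i j.
  have d1 : logder k i (c j) = 0 by apply: dc.
  have d2 : logder k j (c i) = 0 by apply: dc; rewrite eq_sym.
  rewrite /T !hth !mlogderZ d1 d2 !scale0r !add0r.
  rewrite -!scalemxAl -!scalemxAr !scalerA [c j * c i]mulrC -!scalerDr; congr (_ *: _).
  exact: hflat.
have hT i : S i -> mvanish S 1 (T i).
  move=> Si; rewrite /T /c; move: (Si); rewrite Sk => /negbTE ->.
  by apply: (@mvanishZS _ _ _ _ 0) => //; exact: mvanish_0.
pose N := \sum_(j | S j) T j.
have hN : mvanish S 1 N by exact: mvanish_sum.
have [|P hP eP] := euler_solve (P0 := P0) hN; first by rewrite big1.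
exists P => // i.
pose R := mtheta i P - P *m T i.
have hR : mvanish S 1 R.
  have -> : R = (mtheta i P0 - P0 *m T i) + (mtheta i (P - P0) - (P - P0) *m T i).
    by rewrite mthetaB mulmxBl /R; mx_group.
  apply: mvanishD; last by apply: mvanishB; [exact: mvanish_mtheta | exact: mvanishMr].
  have [Si|nSi] := boolP (S i).
    by rewrite hP0 // sub0r; apply: mvanishN; apply: mvanishMl; apply: hT.
  rewrite hth /T -scalemxAr -scalerBr; apply: mvanishZ; exact: hin.
(* By integrability the defect R solves the homogeneous equation E R = R N. *)
have R0 : R = 0.
  apply: (euler_eq0 hN hR); rewrite /R.
  have eT : \sum_(j | S j) mtheta j (T i) = mtheta i N + T i *m N - N *m T i.
    rewrite /N mtheta_sum mulmx_sumr mulmx_suml -big_split -sumrB /=.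
    by apply: eq_bigr => j _; rewrite Tflat addrK.
  transitivity (mtheta i (\sum_(j | S j) mtheta j P) - (\sum_(j | S j) mtheta j P) *m T i
     - P *m \sum_(j | S j) mtheta j (T i)).
    rewrite mtheta_sum mulmx_suml mulmx_sumr -!sumrB; apply: eq_bigr => j _.
    by rewrite mthetaB mthetaM mtheta_comm; mx_group.
  rewrite eT eP mthetaM !(mulmxDr, mulmxBr, mulmxBl, mulmxN) !mulmxA; mx_group.
have {}R0 : mtheta i P = P *m T i by apply/eqP; rewrite -subr_eq0; apply/eqP.
move: R0; rewrite hth /T -scalemxAr /c; case: ifP => _; first by rewrite !scale1r.
exact: map_mx_scaleI.
Qed.

Lemma flat_section_unique (k m r : nat) (Gam : 'I_n -> 'M[G]_r) (P P' : 'M[G]_(m, r)) :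
  let S := [pred i : 'I_n | (k <= i)%N] in
  mvanish S 1 (P - P') ->
  (forall i, S i -> mlogder k i P = P *m Gam i) ->
  (forall i, S i -> mlogder k i P' = P' *m Gam i) -> P = P'.
Proof.
move=> S h0 hP hP'; apply/eqP; rewrite -subr_eq0; apply/eqP.
apply: (@mvanish_eq0 _ _ S); elim=> [|w ih]; first exact: mvanish_0.
apply: mvanishS => // i Si.
have -> : mtheta i (P - P') = germ_var C i *: ((P - P') *m Gam i).
  rewrite (mtheta_mlogder k) ltnNge (_ : (k <= i)%N = true) //=.
  by rewrite mlogderB hP // hP' // mulmxBl.
by apply: mvanishZS => //; apply: mvanishMr.
Qed.
End FlatConnections.

(** * Substitution *)

Section Monomials.
Variables (C : numFieldType) (n : nat).
Implicit Types (f g : germ C n) (a b m : 'X_{1..n}).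

Lemma convergent_mono a : convergent (fun m : 'X_{1..n} => (m == a)%:R : C).
Proof.
by apply: (@cauchy_convergent _ _ _ 1 1) => // m; rewrite expr1n mulr1; case: eqP; rewrite ?normr1 ?normr0.
Qed.
Definition mono a : germ C n := Germ (convergent_mono a).

Lemma gcoef_mono a m : mono a m = (m == a)%:R. Proof. by []. Qed.

Lemma monoM a b : mono (a + b) = mono a * mono b.
Proof.
apply: germP => m; rewrite gcoef_mono; case: eqP => [->|ne].
  rewrite (gcoefM_only (m1 := a) (m2 := b)) // ?gcoef_mono ?eqxx ?mulr1 // => k1 k2 _.
  rewrite !gcoef_mono xpair_eqE negb_and => /orP[/negbTE->|/negbTE->]; rewrite ?mul0r ?mulr0 //.
rewrite gcoefM big1 // => k /eqP e; rewrite !gcoef_mono.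
case: eqP => [e1|]; last by rewrite mul0r.
by case: eqP => [e2|]; [case: ne; rewrite e e1 e2 | rewrite mulr0].
Qed.

Lemma mono0 : mono 0%MM = 1.
Proof. by apply: germP => m; rewrite gcoef_mono gcoef1. Qed.
Lemma monoU i : mono U_(i)%MM = germ_var C i.
Proof. exact: germP. Qed.

Lemma vanish_mono_sum f N :
  vanish predT N (f - \sum_(a : 'X_{1..n < N}) germ_const n (f a) * mono a).
Proof.
move=> m; rewrite wdegT => lm; rewrite gcoefB gcoef_sum.
under eq_bigr => a _ do rewrite gcoefZ gcoef_mono.
rewrite (bigD1 (BMultinom lm)) //= eqxx mulr1 big1 ?addr0 ?subrr // => a na.
case: (m =P bmnm a) na => [e|_ _]; last by rewrite mulr0.
by case/eqP; apply: val_inj.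
Qed.

(** Polynomials are dense for the powers of the maximal ideal: f is a truncation plus a rest in a
    high power. M may depend on N to admit derivations, which lose one order. *)
Lemma germ_map_ext p (A B : germ C n -> germ C p) :
  {morph A : f g / f + g} -> {morph B : f g / f + g} ->
  (forall N, exists M, forall f, vanish predT M f -> vanish predT N (A f)) ->
  (forall N, exists M, forall f, vanish predT M f -> vanish predT N (B f)) ->
  (forall c a, A (germ_const n c * mono a) = B (germ_const n c * mono a)) ->
  A =1 B.
Proof.
move=> Ad Bd Ac Bc AB f.
have A0 : A 0 = 0 by apply: (addIr (A 0)); rewrite -Ad !add0r.
have B0 : B 0 = 0 by apply: (addIr (B 0)); rewrite -Bd !add0r.
apply/eqP; rewrite -subr_eq0; apply/eqP.
apply: (@vanish_eq0 _ _ predT) => N; have [M1 h1] := Ac N; have [M2 h2] := Bc N.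
have := @vanish_mono_sum f (M1 + M2)%N.
set s : germ C n := bigop.body _ _ _; set h := f - s => hv.
have -> : f = h + s by rewrite /h subrK.
have es : A s = B s.
  rewrite /s; elim/big_rec: _ => [|a x _ ih]; first by rewrite A0 B0.
  by rewrite Ad Bd AB ih.
rewrite Ad Bd es [B h + _]addrC opprD addrA addrK.
by apply: vanishB; [apply: h1 | apply: h2]; apply: vanishW hv; rewrite ?leq_addr ?leq_addl.
Qed.

Lemma mono_ind (P : germ C n -> Prop) :
  P 1 -> (forall i f, P f -> P (germ_var C i * f)) -> forall a, P (mono a).
Proof.
move=> P1 PM a; move: {2}(mdeg a) (erefl (mdeg a)) => d.
elim: d a => [|d ih] a ed.
  have /eqP -> : a == 0%MM by rewrite -mdeg_eq0 ed.
  by rewrite mono0.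
have [i ai] : exists i, (0 < a i)%N.
  apply/existsP; apply: contraTT isT => /existsPn h.
  suff: mdeg a = 0%N by rewrite ed.
  by rewrite mdegE big1 // => i _; apply/eqP; have := h i; rewrite lt0n negbK.
have e : a = (U_(i) + (a - U_(i)))%MM.
  apply/mnmP => j; rewrite mnmDE mnmBE mnm1E; case: eqP => [<-|_]; first by rewrite subnKC.
  by rewrite subn0.
rewrite e monoM monoU; apply: PM; apply: ih.
by have := congr1 (@mdeg n) e; rewrite mdegD mdeg1 ed => -[].
Qed.

End Monomials.

Section SubstitutionMorphism.
Variables (C : numFieldType) (n p : nat) (phi : 'I_n -> germ C p).
Hypothesis phi0 : forall i, phi i 0%MM = 0.
Implicit Types (f g : germ C n) (a b : 'X_{1..n}).
Local Notation sub := (germ_subst phi).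

Let pw a : germ C p := \prod_i phi i ^+ a i.

Lemma gcoef_subst f m : sub f m =
  \sum_(a : 'X_{1..n < (mdeg m).+1}) f a * (\prod_i phi i ^+ a i : germ C p) m.
Proof. by []. Qed.

Lemma substD f g : sub (f + g) = sub f + sub g.
Proof.
apply: germP => m; rewrite gcoefD !gcoef_subst -big_split; apply: eq_bigr => a _.
by rewrite gcoefD mulrDl.
Qed.

Lemma subst_continuous N f : vanish predT N f -> vanish predT N (sub f).
Proof.
move=> h m; rewrite wdegT => lm; rewrite gcoef_subst big1 // => a _.
rewrite h ?mul0r // wdegT; apply: leq_ltn_trans lm.
by have := bmdeg a; rewrite ltnS.
Qed.

Let vanish_exp (h : germ C p) k : vanish predT 1 h -> vanish predT k (h ^+ k).
Proof.
by move=> v; elim: k => [|k ih]; [exact: vanish_0 | rewrite exprS; apply: (vanishM v ih)].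
Qed.

Let pwD a b : pw (a + b)%MM = pw a * pw b.
Proof. by rewrite /pw -big_split; apply: eq_bigr => i _; rewrite mnmDE exprD. Qed.

Let vanish_pw a : vanish predT (mdeg a) (pw a).
Proof.
rewrite /pw mdegE; elim/big_rec2: _ => [|i y x _ h]; first exact: vanish_0.
by apply: vanishM => //; apply: vanish_exp; apply/vanish1_coef.
Qed.

(** As phi vanishes at 0, the product [pw a] has order at least [mdeg a]; hence the truncation in
    the definition of [ps_subst] omits only zero terms. *)
Let subst_mono c a : sub (germ_const n c * mono C a) = germ_const p c * pw a.
Proof.
apply: germP => m; rewrite gcoefZ gcoef_subst.
have [lt|le] := ltnP (mdeg m) (mdeg a).
  rewrite [pw a m]vanish_pw ?wdegT // mulr0 big1 // => b _.
  rewrite gcoefZ gcoef_mono; case: eqP => [e|_]; last by rewrite mulr0 mul0r.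
  by have := bmdeg b; rewrite e ltnS leqNgt lt.
rewrite -ltnS in le; under eq_bigr => b _ do rewrite gcoefZ gcoef_mono.
rewrite (bigD1 (BMultinom le)) //= eqxx mulr1 [X in _ + X]big1 ?addr0 // => b nb.
case: (bmnm b =P a) nb => [e|_ _]; last by rewrite mulr0 mul0r.
by case/eqP; apply: val_inj.
Qed.

Lemma subst_const c : sub (germ_const n c) = germ_const p c.
Proof.
have := subst_mono c 0%MM; rewrite mono0 mulr1 => ->.
by rewrite /pw big1 ?mulr1 // => i _; rewrite mnm0E.
Qed.
Lemma subst1 : sub 1 = 1. Proof. exact: subst_const. Qed.
Lemma subst0 : sub 0 = 0. Proof. exact: subst_const. Qed.

Lemma subst_var i : sub (germ_var C i) = phi i.
Proof.
have := subst_mono 1 U_(i)%MM; rewrite germ_const1 mul1r monoU => ->.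
rewrite germ_const1 mul1r /pw (bigD1 i) //= mnm1E eqxx expr1 big1 ?mulr1 // => j.
by rewrite mnm1E eq_sym => /negbTE ->.
Qed.

Lemma substM f g : sub (f * g) = sub f * sub g.
Proof.
have vl N (h : germ C n) f1 : vanish predT N f1 -> vanish predT N (h * f1) by exact: vanishMl.
have subM_mono c b f1 : sub (f1 * (germ_const n c * mono C b)) = sub f1 * sub (germ_const n c * mono C b).
  apply: (@germ_map_ext _ _ _ (fun f1 => sub (f1 * (germ_const n c * mono C b)))
    (fun f1 => sub f1 * sub (germ_const n c * mono C b))) => [x y|x y|N|N|c' a].
  - by rewrite mulrDl substD.
  - by rewrite substD mulrDl.
  - by exists N => x hx; apply: subst_continuous; apply: vanishMr.
  - by exists N => x hx; apply: vanishMr; apply: subst_continuous.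
  have -> : germ_const n c' * mono C a * (germ_const n c * mono C b) =
      germ_const n (c' * c) * mono C (a + b)%MM by rewrite germ_constM monoM; ring.
  by rewrite !subst_mono germ_constM pwD; ring.
apply: (@germ_map_ext _ _ _ (fun g => sub (f * g)) (fun g => sub f * sub g)) => [x y|x y|N|N|c a].
- by rewrite mulrDr substD.
- by rewrite substD mulrDr.
- by exists N => x hx; apply: subst_continuous; apply: vanishMl.
- by exists N => x hx; apply: vanishMl; apply: subst_continuous.
exact: subM_mono.
Qed.

Lemma substN f : sub (- f) = - sub f.
Proof. by apply/eqP; rewrite -subr_eq0 opprK -substD addNr subst0. Qed.
Lemma substB f g : sub (f - g) = sub f - sub g.
Proof. by rewrite substD substN. Qed.
Lemma subst_nat (k : nat) : sub k%:R = k%:R.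
Proof. by rewrite -!germ_constMn subst_const. Qed.
Lemma subst_sum (I : Type) (r : seq I) (P : pred I) (F : I -> germ C n) :
  sub (\sum_(i <- r | P i) F i) = \sum_(i <- r | P i) sub (F i).
Proof. by elim/big_rec2: _ => [|i y x _ <-]; rewrite ?subst0 ?substD. Qed.
Lemma subst_coef0 f : sub f 0%MM = f 0%MM.
Proof.
have := @subst_continuous 1 (f - germ_const n (f 0%MM)) (vanish_sub_const f).
move/vanish1_coef; rewrite substB subst_const gcoefB /= /ps_const eqxx => /eqP.
by rewrite subr_eq0 => /eqP.
Qed.
Lemma subst_unit f : f \is a GRing.unit -> sub f \is a GRing.unit.
Proof. by rewrite !germ_unitE subst_coef0. Qed.
Lemma substV f : f \is a GRing.unit -> sub f^-1 = (sub f)^-1.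
Proof.
move=> u; apply: (mulrI (subst_unit u)); rewrite -substM !divrr ?subst1 //.
exact: subst_unit.
Qed.

(** Both sides are derivations along f -> f(phi), continuous with a loss of one order, and they
    agree on constants and variables. *)
Lemma subst_der (j : 'I_p) f :
  germ_der j (sub f) = \sum_i germ_der j (phi i) * sub (germ_der i f).
Proof.
pose B (x : germ C n) := \sum_i germ_der j (phi i) * sub (germ_der i x).
have vder q (i : 'I_q) N (x : germ C q) : vanish predT N.+1 x -> vanish predT N (germ_der i x).
  move=> h m lm; rewrite gcoef_der h ?mul0rn //.
  by rewrite wdegD wdegU /= addn1.
have AM x y : germ_der j (sub (x * y)) = germ_der j (sub x) * sub y + sub x * germ_der j (sub y).
  by rewrite substM germ_derM.
have BM x y : B (x * y) = B x * sub y + sub x * B y.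
  rewrite /B mulr_suml mulr_sumr -big_split; apply: eq_bigr => i _ /=.
  by rewrite germ_derM substD !substM; ring.
have BC c : B (germ_const n c) = 0.
  by rewrite /B big1 // => i _; rewrite germ_der_const subst0 mulr0.
apply: (@germ_map_ext _ _ _ (fun x => germ_der j (sub x)) B) => [x y|x y|N|N|c a].
- by rewrite substD germ_derD.
- by rewrite /B -big_split; apply: eq_bigr => i _; rewrite germ_derD substD mulrDr.
- by exists N.+1 => x hx; apply: vder; apply: subst_continuous.
- exists N.+1 => x hx; apply: vanish_sum => i _; apply: vanishMl.
  by apply: subst_continuous; apply: vder.
rewrite AM BM subst_const germ_der_const BC; congr (_ + _ * _).
elim/mono_ind: (mono C a) => [|i x ih].
  by rewrite -[1 in RHS]germ_const1 BC subst1 germ_der_const.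
rewrite AM BM ih; congr (_ * _ + _); rewrite subst_var /B (bigD1 i) //=.
rewrite germ_der_var eqxx subst1 mulr1 big1 ?addr0 // => i' ne.
by rewrite germ_der_var (negbTE ne) subst0 mulr0.
Qed.

End SubstitutionMorphism.

Section Composition.
Variables (C : numFieldType) (n p q : nat).

Lemma subst_comp (phi : 'I_n -> germ C p) (psi : 'I_p -> germ C q) (chi : 'I_n -> germ C q) :
  (forall i, phi i 0%MM = 0) -> (forall i, psi i 0%MM = 0) ->
  (forall i, germ_subst psi (phi i) = chi i) ->
  forall f, germ_subst psi (germ_subst phi f) = germ_subst chi f.
Proof.
move=> h1 h2 e.
have h3 i : chi i 0%MM = 0 by rewrite -e subst_coef0.
apply: germ_map_ext => [x y|x y|N|N|c a].
- by rewrite !substD.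
- by rewrite substD.
- by exists N => x hx; apply/subst_continuous/subst_continuous.
- by exists N => x hx; apply/subst_continuous.
rewrite !substM // !subst_const //; congr (_ * _).
elim/mono_ind: (mono C a) => [|i x ih]; first by rewrite !subst1.
by rewrite !substM // ih !subst_var // e.
Qed.

Lemma subst_id (f : germ C n) : germ_subst (@germ_var C n) f = f.
Proof.
have h i : germ_var C i (0%MM : 'X_{1..n}) = 0.
  by rewrite gcoef_var; case: eqP => // /(congr1 (@mdeg n)); rewrite mdeg0 mdeg1.
apply: (@germ_map_ext _ _ _ (germ_subst (@germ_var C n)) id) => [x y|//|N|N|c a].
- by rewrite substD.
- by exists N => x hx; apply/subst_continuous.
- by exists N.
rewrite substM // subst_const //; congr (_ * _).
elim/mono_ind: (mono C a) => [|i x ih]; first by rewrite subst1.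
by rewrite substM // ih subst_var.
Qed.

End Composition.

(** * The equations of a quantum differential system *)

Section LinearAlgebra.
Variable R : comNzRingType.

Lemma mulmx_col_ext (m r : nat) (A B : 'M[R]_(m, r)) :
  (forall s : 'cV_r, A *m s = B *m s) -> A = B.
Proof.
move=> h; apply/matrixP => i j.
have := congr1 (fun X : 'cV_m => X i 0) (h (delta_mx j 0)).
by rewrite -!colE !mxE.
Qed.

Lemma bilinear_ext (m r : nat) (A B : 'M[R]_(m, r)) :
  (forall (s : 'cV_m) (t : 'cV_r), (s^T *m A *m t) 0 0 = (s^T *m B *m t) 0 0) -> A = B.
Proof.
move=> h; apply/matrixP => i j; have := h (delta_mx i 0) (delta_mx j 0).
by rewrite trmx_delta -!rowE -!colE !mxE.
Qed.

End LinearAlgebra.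

Section PolynomialSections.
Variables (C : numFieldType) (n k : nat).
Local Notation G := (germ C n).
Local Notation PG := {poly G}.
Implicit Types (m p q : nat) (i j : 'I_n).

Definition pD i m p : 'M[PG]_(m, p) -> 'M[PG]_(m, p) := map_mx (map_poly (logder k i)).
Definition pE m p : 'M[PG]_(m, p) -> 'M[PG]_(m, p) :=
  map_mx (fun f : PG => - ('X * f^`())).
Definition pS m p : 'M[PG]_(m, p) -> 'M[PG]_(m, p) := map_mx (@theta_opp C n).

Lemma coef_pder i (f : PG) (a : nat) : (map_poly (logder k i) f)`_a = logder k i f`_a.
Proof. by rewrite coef_map_id0 // logder0. Qed.
Lemma pderD i (f g : PG) :
  map_poly (logder k i) (f + g) = map_poly (logder k i) f + map_poly (logder k i) g.
Proof. by apply/polyP => j; rewrite coefD !coef_pder coefD logderD. Qed.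
Lemma pderM i (f g : PG) : map_poly (logder k i) (f * g) =
  map_poly (logder k i) f * g + f * map_poly (logder k i) g.
Proof.
apply/polyP => j; rewrite coefD coef_pder !coefM logder_sum -big_split /=.
by apply: eq_bigr => a _; rewrite !coef_pder logderM.
Qed.
Lemma pder0 i : map_poly (logder k i) (0 : PG) = 0.
Proof. by apply/polyP => j; rewrite coef_pder !coef0 logder0. Qed.
Lemma pder_sum i (I : Type) (r : seq I) (P : pred I) (F : I -> PG) :
  map_poly (logder k i) (\sum_(a <- r | P a) F a) = \sum_(a <- r | P a) map_poly (logder k i) (F a).
Proof. by elim/big_rec2: _ => [|a y x _ <-]; rewrite ?pder0 ?pderD. Qed.
Lemma pderX i : map_poly (logder k i) ('X : PG) = 0.
Proof.
by apply/polyP => j; rewrite coef_pder coefX coef0; case: eqP; rewrite ?logder1 ?logder0.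
Qed.
Lemma pderC i (c : G) : map_poly (logder k i) c%:P = (logder k i c)%:P.
Proof. by apply/polyP => j; rewrite coef_pder !coefC; case: eqP; rewrite ?logder0. Qed.
Lemma pder_comm i j (f : PG) :
  map_poly (logder k i) (map_poly (logder k j) f) = map_poly (logder k j) (map_poly (logder k i) f).
Proof. by apply/polyP => a; rewrite !coef_pder logder_comm. Qed.
Lemma pderN i (f : PG) : map_poly (logder k i) (- f) = - map_poly (logder k i) f.
Proof. by apply/eqP; rewrite -subr_eq0 opprK -pderD addNr pder0. Qed.
Lemma pder_deriv i (f : PG) : map_poly (logder k i) f^`() = (map_poly (logder k i) f)^`().
Proof. by apply/polyP => a; rewrite coef_pder !coef_deriv coef_pder logderMn. Qed.

Lemma theta_oppD (f g : PG) : theta_opp (f + g) = theta_opp f + theta_opp g.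
Proof. exact: comp_polyD. Qed.
Lemma theta_oppM (f g : PG) : theta_opp (f * g) = theta_opp f * theta_opp g.
Proof. exact: comp_polyM. Qed.
Lemma theta_oppC (c : G) : theta_opp c%:P = c%:P.
Proof. exact: comp_polyC. Qed.
Lemma theta_oppX : theta_opp ('X : PG) = - 'X.
Proof. exact: comp_polyX. Qed.
Lemma theta_oppN (f : PG) : theta_opp (- f) = - theta_opp f.
Proof. exact: raddfN. Qed.
Lemma theta_opp_sum (I : Type) (r : seq I) (P : pred I) (F : I -> PG) :
  theta_opp (\sum_(a <- r | P a) F a) = \sum_(a <- r | P a) theta_opp (F a).
Proof. exact: raddf_sum. Qed.
Lemma theta_oppK (f : PG) : theta_opp (theta_opp f) = f.
Proof.
by rewrite /theta_opp -comp_polyA (_ : (- 'X) \Po (- 'X) = 'X) ?comp_polyXr // raddfN /= comp_polyX opprK.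
Qed.
Lemma theta_opp_pder i (f : PG) :
  map_poly (logder k i) (theta_opp f) = theta_opp (map_poly (logder k i) f).
Proof.
elim/poly_ind: f => [|f c ih]; first by rewrite pder0 /theta_opp comp_poly0 pder0.
rewrite !(theta_oppD, theta_oppM, pderD, pderM, theta_oppC, theta_oppX, pderC, pderN, pderX) ih.
by rewrite oppr0 !mulr0 !addr0.
Qed.
Lemma theta_opp_euler (f : PG) :
  - ('X * (theta_opp f)^`()) = theta_opp (- ('X * f^`())).
Proof.
rewrite theta_oppN theta_oppM theta_oppX /theta_opp deriv_comp derivN derivX; ring.
Qed.

Lemma pDD i m p (A B : 'M_(m, p)) : pD i (A + B) = pD i A + pD i B.
Proof. by apply/matrixP => a b; rewrite !mxE pderD. Qed.
Lemma pDM i m p q (A : 'M_(m, p)) (B : 'M_(p, q)) : pD i (A *m B) = pD i A *m B + A *m pD i B.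
Proof.
apply/matrixP => a b; rewrite !mxE pder_sum -big_split /=.
by apply: eq_bigr => c _; rewrite !mxE pderM.
Qed.
Lemma pD_comm i j m p (A : 'M_(m, p)) : pD i (pD j A) = pD j (pD i A).
Proof. by apply/matrixP => a b; rewrite !mxE pder_comm. Qed.
Lemma pD_lift i m p (A : 'M_(m, p)) : pD i (lift_mx A) = lift_mx (mlogder k i A).
Proof. by apply/matrixP => a b; rewrite !mxE pderC. Qed.
Lemma pDZX i m p (A : 'M_(m, p)) : pD i ('X *: A) = 'X *: pD i A.
Proof. by apply/matrixP => a b; rewrite !mxE pderM pderX mul0r add0r. Qed.
Lemma pDT i m p (A : 'M_(m, p)) : pD i A^T = (pD i A)^T.
Proof. by apply/matrixP => a b; rewrite !mxE. Qed.

Lemma pEM m p q (A : 'M_(m, p)) (B : 'M_(p, q)) : pE (A *m B) = pE A *m B + A *m pE B.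
Proof.
apply/matrixP => a b; rewrite !mxE -big_split /= raddf_sum mulr_sumr -sumrN.
by apply: eq_bigr => c _; rewrite /= !mxE derivM; ring.
Qed.
Lemma pED m p (A B : 'M_(m, p)) : pE (A + B) = pE A + pE B.
Proof. by apply/matrixP => a b; rewrite !mxE derivD; ring. Qed.
Lemma pE_lift m p (A : 'M_(m, p)) : pE (lift_mx A) = 0.
Proof. by apply/matrixP => a b; rewrite !mxE derivC mulr0 oppr0. Qed.
Lemma pEZX m p (A : 'M_(m, p)) : pE ('X *: lift_mx A) = - ('X *: lift_mx A).
Proof. by apply/matrixP => a b; rewrite !mxE derivM derivX derivC; ring. Qed.
Lemma pD_pE i m p (A : 'M_(m, p)) : pD i (pE A) = pE (pD i A).
Proof. by apply/matrixP => a b; rewrite !mxE pderN pderM pderX pder_deriv; ring. Qed.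

Lemma pSD m p (A B : 'M_(m, p)) : pS (A + B) = pS A + pS B.
Proof. by apply/matrixP => a b; rewrite !mxE theta_oppD. Qed.
Lemma pSM m p q (A : 'M_(m, p)) (B : 'M_(p, q)) : pS (A *m B) = pS A *m pS B.
Proof.
apply/matrixP => a b; rewrite !mxE theta_opp_sum.
by apply: eq_bigr => c _; rewrite !mxE theta_oppM.
Qed.
Lemma pSK m p (A : 'M_(m, p)) : pS (pS A) = A.
Proof. by apply/matrixP => a b; rewrite !mxE theta_oppK. Qed.
Lemma pS_lift m p (A : 'M_(m, p)) : pS (lift_mx A) = lift_mx A.
Proof. by apply/matrixP => a b; rewrite !mxE theta_oppC. Qed.
Lemma pSZX m p (A : 'M_(m, p)) : pS ('X *: A) = - ('X *: pS A).
Proof. by apply/matrixP => a b; rewrite !mxE theta_oppM theta_oppX mulNr. Qed.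
Lemma pST m p (A : 'M_(m, p)) : pS A^T = (pS A)^T.
Proof. by apply/matrixP => a b; rewrite !mxE. Qed.
Lemma pD_pS i m p (A : 'M_(m, p)) : pD i (pS A) = pS (pD i A).
Proof. by apply/matrixP => a b; rewrite !mxE theta_opp_pder. Qed.
Lemma pE_pS m p (A : 'M_(m, p)) : pE (pS A) = pS (pE A).
Proof. by apply/matrixP => a b; rewrite !mxE theta_opp_euler. Qed.

Lemma liftM m p q (A : 'M_(m, p)) (B : 'M_(p, q)) : lift_mx (A *m B) = lift_mx A *m lift_mx B :> 'M[PG]_(m, q).
Proof. exact: map_mxM. Qed.
Lemma liftD m p (A B : 'M[G]_(m, p)) : lift_mx (A + B) = lift_mx A + lift_mx B.
Proof. exact: map_mxD. Qed.
Lemma liftN m p (A : 'M[G]_(m, p)) : lift_mx (- A) = - lift_mx A.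
Proof. exact: map_mxN. Qed.
Lemma lift1 m : lift_mx (1%:M : 'M[G]_m) = 1%:M.
Proof. exact: map_mx1. Qed.
Lemma lift0 m p : lift_mx (0 : 'M[G]_(m, p)) = 0.
Proof. exact: map_mx0. Qed.
Lemma liftT m p (A : 'M[G]_(m, p)) : lift_mx A^T = (lift_mx A)^T.
Proof. by apply/matrixP => a b; rewrite !mxE. Qed.

(** The variable is tau, and the equations of a quantum differential system have degree at most 2 in
    it. *)
Lemma lift_coefs m p (A0 A1 A2 B0 B1 B2 : 'M[G]_(m, p)) :
  lift_mx A0 + 'X *: lift_mx A1 + 'X *: ('X *: lift_mx A2) =
  lift_mx B0 + 'X *: lift_mx B1 + 'X *: ('X *: lift_mx B2) <->
  [/\ A0 = B0, A1 = B1 & A2 = B2].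
Proof.
split=> [/matrixP h|[-> -> ->]//].
have cf a b (X0 X1 X2 : 'M[G]_(m, p)) :
   [/\ ((lift_mx X0 + 'X *: lift_mx X1 + 'X *: ('X *: lift_mx X2)) a b)`_0 = X0 a b,
     ((lift_mx X0 + 'X *: lift_mx X1 + 'X *: ('X *: lift_mx X2)) a b)`_1 = X1 a b
   & ((lift_mx X0 + 'X *: lift_mx X1 + 'X *: ('X *: lift_mx X2)) a b)`_2 = X2 a b].
  by rewrite !mxE !coefD !coefXM /= !coefC /= !addr0 !add0r.
split; apply/matrixP => a b.
- by have [<- _ _] := cf a b A0 A1 A2; rewrite h; have [-> _ _] := cf a b B0 B1 B2.
- by have [_ <- _] := cf a b A0 A1 A2; rewrite h; have [_ -> _] := cf a b B0 B1 B2.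
- by have [_ _ <-] := cf a b A0 A1 A2; rewrite h; have [_ _ ->] := cf a b B0 B1 B2.
Qed.

End PolynomialSections.

Section QdsEquations.
Variables (C : numFieldType) (k n r : nat).
Local Notation G := (germ C n).
Local Notation PG := {poly G}.
Implicit Types (T : qds_data C n r) (s t : 'cV[PG]_r).

Definition qds_Om T (i : 'I_n) : 'M[PG]_r :=
  lift_mx (qds_conn T i) + 'X *: lift_mx (qds_higgs T i).
Definition qds_W T : 'M[PG]_r := 'X *: lift_mx (qds_V0 T) + lift_mx (qds_Vinf T).

Lemma qds_nablaE T i s : qds_nabla k T i s = pD k i s + qds_Om T i *m s.
Proof. by []. Qed.
Lemma qds_nabla_thetaE T s : qds_nabla_theta T s = pE s + qds_W T *m s.
Proof. by []. Qed.
Lemma qds_SE T s t : qds_S T s t = (s^T *m lift_mx (qds_pair T) *m pS t) 0 0.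
Proof. by []. Qed.

Lemma addmx_inj m p (A B X : 'M[PG]_(m, p)) : X + A = X + B -> A = B.
Proof. exact: addrI. Qed.

(** After expansion the terms containing derivatives of s agree on both sides; there remains a
    matrix identity applied to an arbitrary section. *)
Lemma qds_flatE T : qds_flat k T <->
  (forall i j, pD k i (qds_Om T j) + qds_Om T i *m qds_Om T j =
               pD k j (qds_Om T i) + qds_Om T j *m qds_Om T i) /\
  (forall i, pD k i (qds_W T) + qds_Om T i *m qds_W T =
             pE (qds_Om T i) + qds_W T *m qds_Om T i).
Proof.
have e1 i j s : qds_nabla k T i (qds_nabla k T j s) =
    (pD k i (pD k j s) + qds_Om T j *m pD k i s + qds_Om T i *m pD k j s) +
    (pD k i (qds_Om T j) + qds_Om T i *m qds_Om T j) *m s.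
  by rewrite !qds_nablaE pDD pDM mulmxDr (mulmxDl (pD k i _)) mulmxA; mx_group.
have e2 i s : qds_nabla k T i (qds_nabla_theta T s) =
    (pD k i (pE s) + qds_W T *m pD k i s + qds_Om T i *m pE s) +
    (pD k i (qds_W T) + qds_Om T i *m qds_W T) *m s.
  by rewrite qds_nablaE qds_nabla_thetaE pDD pDM mulmxDr (mulmxDl (pD k i _)) mulmxA; mx_group.
have e3 i s : qds_nabla_theta T (qds_nabla k T i s) =
    (pD k i (pE s) + qds_W T *m pD k i s + qds_Om T i *m pE s) +
    (pE (qds_Om T i) + qds_W T *m qds_Om T i) *m s.
  by rewrite qds_nablaE qds_nabla_thetaE pED pEM pD_pE mulmxDr (mulmxDl (pE _)) mulmxA; mx_group.
split=> -[h1 h2]; split.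
- move=> i j; apply: mulmx_col_ext => s; have := h1 i j s; rewrite !e1.
  rewrite (pD_comm _ j i) [_ + qds_Om T i *m pD k j s]addrAC; exact: addrI.
- by move=> i; apply: mulmx_col_ext => s; have := h2 i s; rewrite e2 e3; apply: addrI.
- by move=> i j s; rewrite !e1 h1 (pD_comm _ j i) [_ + qds_Om T i *m pD k j s]addrAC.
- by move=> i s; rewrite e2 e3 h2.
Qed.

Lemma qds_S_flatE T d : qds_S_flat k T d <->
  (forall i, pD k i (lift_mx (qds_pair T)) =
     (qds_Om T i)^T *m lift_mx (qds_pair T) + lift_mx (qds_pair T) *m pS (qds_Om T i)) /\
  (d%:~R *: lift_mx (qds_pair T) =
     (qds_W T)^T *m lift_mx (qds_pair T) + lift_mx (qds_pair T) *m pS (qds_W T)).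
Proof.
set g := lift_mx (qds_pair T).
have e1 (i : 'I_n) s t :
    qds_S T (qds_nabla k T i s) t + qds_S T s (qds_nabla k T i t) =
    ((pD k i s)^T *m g *m pS t + s^T *m g *m pD k i (pS t)) 0 0 +
    (s^T *m ((qds_Om T i)^T *m g + g *m pS (qds_Om T i)) *m pS t) 0 0.
  rewrite !qds_SE !qds_nablaE -/g; move: (qds_Om T i) (g) => Om h.
  rewrite pSD pSM pD_pS linearD /= trmx_mul.
  by rewrite !(mulmxDl, mulmxDr, mulmxA) !mxeD; ring.
have f1 i s t : map_poly (logder k i) (qds_S T s t) =
    ((pD k i s)^T *m g *m pS t + s^T *m g *m pD k i (pS t)) 0 0 +
    (s^T *m pD k i g *m pS t) 0 0.
  transitivity (pD k i (s^T *m g *m pS t) 0 0); first by rewrite [RHS]mxE.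
  by rewrite !pDM pDT !(mulmxDl, mulmxDr, mulmxA) !mxeD; ring.
have e2 s t :
    qds_S T (qds_nabla_theta T s) t + qds_S T s (qds_nabla_theta T t) =
    ((pE s)^T *m g *m pS t + s^T *m g *m pE (pS t)) 0 0 +
    (s^T *m ((qds_W T)^T *m g + g *m pS (qds_W T)) *m pS t) 0 0.
  rewrite !qds_SE !qds_nabla_thetaE -/g; move: (qds_W T) (g) => W h.
  rewrite pSD pSM pE_pS linearD /= trmx_mul.
  by rewrite !(mulmxDl, mulmxDr, mulmxA) !mxeD; ring.
have f2 s t : d%:~R * qds_S T s t - 'X * (qds_S T s t)^`() =
    ((pE s)^T *m g *m pS t + s^T *m g *m pE (pS t)) 0 0 +
    (s^T *m (d%:~R *: g) *m pS t) 0 0.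
  transitivity (d%:~R * (s^T *m g *m pS t) 0 0 + pE (s^T *m g *m pS t) 0 0).
    by rewrite [pE _ 0 0]mxE.
  rewrite !pEM pE_lift mulmx0 addr0 -scalemxAr -scalemxAl mxeZ !mxeD.
  have -> : pE s^T = (pE s)^T by apply/matrixP => a b; rewrite !mxE.
  by ring.
split=> -[h1 h2]; split.
- move=> i; apply: bilinear_ext => s t; rewrite -[t]pSK.
  by have := h1 i s (pS t); rewrite e1 f1 => /addrI.
- apply: bilinear_ext => s t; rewrite -[t]pSK.
  by have := h2 s (pS t); rewrite e2 f2 => /addrI.
- by move=> i s t; rewrite e1 f1 h1.
- by move=> s t; rewrite e2 f2 h2.
Qed.

Lemma qds_S_symmetricE T : qds_S_symmetric T <-> (qds_pair T)^T = qds_pair T.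
Proof.
have e s t : theta_opp (qds_S T t s) = (s^T *m lift_mx (qds_pair T)^T *m pS t) 0 0.
  transitivity (pS (t^T *m lift_mx (qds_pair T) *m pS s) 0 0); first by rewrite [RHS]mxE.
  rewrite !pSM pSK pS_lift pST; transitivity (((pS t)^T *m lift_mx (qds_pair T) *m s)^T 0 0).
    by rewrite [RHS]mxE.
  by rewrite !trmx_mul trmxK liftT mulmxA.
split=> h.
  have : lift_mx (qds_pair T)^T = lift_mx (qds_pair T).
    apply: bilinear_ext => s t; rewrite -[t]pSK.
    by have := h s (pS t); rewrite e => <-.
  by move=> /matrixP h'; apply/matrixP => i j; have := h' i j; rewrite !mxE => /polyC_inj.
by move=> s t; rewrite e h.
Qed.

(* The equations of a logarithmic quantum differential system in a frame which
   is flat for the connection on E. *)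
Record flat_qds T (d : int) : Prop := FlatQds {
  fq_conn : forall i, qds_conn T i = 0;
  fq_comm : forall i j, qds_higgs T i *m qds_higgs T j = qds_higgs T j *m qds_higgs T i;
  fq_closed : forall i j, mlogder k i (qds_higgs T j) = mlogder k j (qds_higgs T i);
  fq_commV : forall i, qds_higgs T i *m qds_V0 T = qds_V0 T *m qds_higgs T i;
  fq_V0 : forall i, mlogder k i (qds_V0 T) + qds_higgs T i *m qds_Vinf T =
    qds_Vinf T *m qds_higgs T i - qds_higgs T i;
  fq_Vinf : forall i, mlogder k i (qds_Vinf T) = 0;
  fq_pair : forall i, mlogder k i (qds_pair T) = 0;
  fq_pair_higgs : forall i, (qds_higgs T i)^T *m qds_pair T = qds_pair T *m qds_higgs T i;
  fq_pair_V0 : (qds_V0 T)^T *m qds_pair T = qds_pair T *m qds_V0 T;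
  fq_pair_Vinf : (qds_Vinf T)^T *m qds_pair T + qds_pair T *m qds_Vinf T = d%:~R *: qds_pair T;
  fq_sym : (qds_pair T)^T = qds_pair T;
  fq_unit : qds_pair T \in unitmx
}.

Lemma liftZint (d : int) m p (A : 'M[G]_(m, p)) : lift_mx (d%:~R *: A) = d%:~R *: lift_mx A.
Proof. by apply/matrixP => a b; rewrite !mxE polyCM rmorph_int. Qed.

(** Comparison of powers of tau. In the flatness, tau^2 gives the commutation relations, tau the
    closedness of Phi and the equation of V0, and the constant term the constancy of Vinf. In the
    equations of the pairing, the sign of j makes Phi and V0 self-adjoint. *)
Lemma flat_qdsP T d : (forall i, qds_conn T i = 0) -> log_qds k T d <-> flat_qds T d.
Proof.
move=> c0.
have eO i : qds_Om T i = 'X *: lift_mx (qds_higgs T i) by rewrite /qds_Om c0 lift0 add0r.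
have F1 i j : pD k i (qds_Om T j) + qds_Om T i *m qds_Om T j =
    lift_mx 0 + 'X *: lift_mx (mlogder k i (qds_higgs T j))
    + 'X *: ('X *: lift_mx (qds_higgs T i *m qds_higgs T j)).
  by rewrite !eO pDZX pD_lift lift0 add0r -scalemxAl -scalemxAr liftM.
have F2 i : pD k i (qds_W T) + qds_Om T i *m qds_W T =
    lift_mx (mlogder k i (qds_Vinf T))
    + 'X *: lift_mx (mlogder k i (qds_V0 T) + qds_higgs T i *m qds_Vinf T)
    + 'X *: ('X *: lift_mx (qds_higgs T i *m qds_V0 T)).
  rewrite eO /qds_W pDD pDZX !pD_lift mulmxDr -!scalemxAl -scalemxAr !liftD !liftM scalerDr.
  by mx_group.
have F3 i : pE (qds_Om T i) + qds_W T *m qds_Om T i =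
    lift_mx 0 + 'X *: lift_mx (qds_Vinf T *m qds_higgs T i - qds_higgs T i)
    + 'X *: ('X *: lift_mx (qds_V0 T *m qds_higgs T i)).
  rewrite eO /qds_W pEZX mulmxDl -!scalemxAl -!scalemxAr lift0 !liftD liftN !liftM scalerDr.
  by mx_group.
have F4 i : (qds_Om T i)^T *m lift_mx (qds_pair T) + lift_mx (qds_pair T) *m pS (qds_Om T i) =
    lift_mx 0 + 'X *: lift_mx ((qds_higgs T i)^T *m qds_pair T - qds_pair T *m qds_higgs T i)
    + 'X *: ('X *: lift_mx 0).
  rewrite eO pSZX pS_lift lift0 !scaler0 addr0 add0r liftD liftN !liftM liftT linearZ /=.
  by rewrite -scalemxAl mulmxN -scalemxAr -scalerBr.
have F5 : (qds_W T)^T *m lift_mx (qds_pair T) + lift_mx (qds_pair T) *m pS (qds_W T) =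
    lift_mx ((qds_Vinf T)^T *m qds_pair T + qds_pair T *m qds_Vinf T)
    + 'X *: lift_mx ((qds_V0 T)^T *m qds_pair T - qds_pair T *m qds_V0 T)
    + 'X *: ('X *: lift_mx 0).
  rewrite /qds_W pSD pSZX !pS_lift lift0 !scaler0 addr0 !liftD liftN !liftM !liftT linearD linearZ /=.
  by rewrite mulmxDl mulmxDr -scalemxAl mulmxN -scalemxAr scalerBr; mx_group.
have F6 (A : 'M[G]_r) : lift_mx A = lift_mx A + 'X *: lift_mx 0 + 'X *: ('X *: lift_mx 0).
  by rewrite lift0 !scaler0 !addr0.
split.
- case=> /qds_flatE[h1 h2] /qds_S_flatE[h3 h4] /qds_S_symmetricE h5 h6.
  have g1 i j : _ := (lift_coefs _ _ _ _ _ _).1 (etrans (esym (F1 i j)) (etrans (h1 i j) (F1 j i))).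
  have g2 i : _ := (lift_coefs _ _ _ _ _ _).1 (etrans (esym (F2 i)) (etrans (h2 i) (F3 i))).
  have g3 i : _ := (lift_coefs _ _ _ _ _ _).1
    (etrans (esym (F6 _)) (etrans (esym (pD_lift k i (qds_pair T))) (etrans (h3 i) (F4 i)))).
  have g4 : _ := (lift_coefs _ _ _ _ _ _).1
    (etrans (esym (F6 _)) (etrans (liftZint d (qds_pair T)) (etrans h4 F5))).
  split=> //.
  + by move=> i j; case: (g1 i j).
  + by move=> i j; case: (g1 i j).
  + by move=> i; case: (g2 i).
  + by move=> i; case: (g2 i).
  + by move=> i; case: (g2 i).
  + by move=> i; case: (g3 i).
  + by move=> i; case: (g3 i) => _ /esym/eqP; rewrite subr_eq0 => /eqP.
  + by case: g4 => _ /esym/eqP; rewrite subr_eq0 => /eqP.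
  + by case: g4.
case=> _ h1 h2 h3 h4 h5 h6 h7 h8 h9 h10 h11; split; last exact: h11.
- apply/qds_flatE; split=> [i j|i]; first by rewrite !F1 h1 h2.
  by rewrite F2 F3 h3 h4 h5.
- apply/qds_S_flatE; split=> [i|]; first by rewrite F4 pD_lift h6 h7 subrr -F6.
  by rewrite F5 h8 h9 subrr -F6 liftZint.
- exact/qds_S_symmetricE.
Qed.

(** This is the part of degree 0 in tau of the flatness of nabla. *)
Lemma log_qds_curvature T d : log_qds k T d -> forall i j,
  mlogder k i (qds_conn T j) + qds_conn T i *m qds_conn T j =
  mlogder k j (qds_conn T i) + qds_conn T j *m qds_conn T i.
Proof.
case=> /qds_flatE[h _] _ _ _ i j.
have F a b : pD k a (qds_Om T b) + qds_Om T a *m qds_Om T b =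
    lift_mx (mlogder k a (qds_conn T b) + qds_conn T a *m qds_conn T b)
    + 'X *: lift_mx (mlogder k a (qds_higgs T b) + qds_conn T a *m qds_higgs T b
                     + qds_higgs T a *m qds_conn T b)
    + 'X *: ('X *: lift_mx (qds_higgs T a *m qds_higgs T b)).
  rewrite /qds_Om pDD pDZX !pD_lift !(mulmxDl, mulmxDr) -!(scalemxAl, scalemxAr).
  by rewrite !(liftD, liftM) !scalerDr; mx_group.
have e := h i j.
by have [] := (lift_coefs _ _ _ _ _ _).1 (etrans (esym (F i j)) (etrans e (F j i))).
Qed.

Lemma qds_isoE T T' (P : 'M[G]_r) : qds_iso k T T' P <->
  [/\ P \in unitmx,
      forall i, P *m qds_conn T i = mlogder k i P + qds_conn T' i *m P,
      forall i, P *m qds_higgs T i = qds_higgs T' i *m P,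
      P *m qds_V0 T = qds_V0 T' *m P /\ P *m qds_Vinf T = qds_Vinf T' *m P
    & P^T *m qds_pair T' *m P = qds_pair T].
Proof.
have e1 i s : lift_mx P *m qds_nabla k T i s = lift_mx P *m pD k i s +
    (lift_mx (P *m qds_conn T i) + 'X *: lift_mx (P *m qds_higgs T i) + 'X *: ('X *: lift_mx 0)) *m s.
  rewrite qds_nablaE mulmxDr mulmxA; congr (_ + _ *m _).
  by rewrite /qds_Om lift0 !scaler0 addr0 !liftM mulmxDr scalemxAr.
have e2 i s : qds_nabla k T' i (lift_mx P *m s) = lift_mx P *m pD k i s +
    (lift_mx (mlogder k i P + qds_conn T' i *m P) + 'X *: lift_mx (qds_higgs T' i *m P)
     + 'X *: ('X *: lift_mx 0)) *m s.
  rewrite qds_nablaE pDM pD_lift lift0 !scaler0 addr0 liftD !liftM mulmxA.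
  by rewrite /qds_Om !mulmxDl -!scalemxAl; mx_group.
have e3 s : lift_mx P *m qds_nabla_theta T s = lift_mx P *m pE s +
    (lift_mx (P *m qds_Vinf T) + 'X *: lift_mx (P *m qds_V0 T) + 'X *: ('X *: lift_mx 0)) *m s.
  rewrite qds_nabla_thetaE mulmxDr mulmxA; congr (_ + _ *m _).
  by rewrite /qds_W lift0 !scaler0 addr0 !liftM mulmxDr scalemxAr addrC.
have e4 s : qds_nabla_theta T' (lift_mx P *m s) = lift_mx P *m pE s +
    (lift_mx (qds_Vinf T' *m P) + 'X *: lift_mx (qds_V0 T' *m P) + 'X *: ('X *: lift_mx 0)) *m s.
  rewrite qds_nabla_thetaE pEM pE_lift mul0mx lift0 !scaler0 addr0 add0r !liftM mulmxA.
  by rewrite /qds_W !mulmxDl -!scalemxAl; mx_group.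
have e5 s t : qds_S T' (lift_mx P *m s) (lift_mx P *m t) =
    (s^T *m lift_mx (P^T *m qds_pair T' *m P) *m pS t) 0 0.
  by rewrite qds_SE pSM pS_lift trmx_mul !liftM liftT !mulmxA.
split=> [[u h1 h2 h3]|[u h1 h2 [h3 h4] h5]].
  have g1 i : _ := (lift_coefs _ _ _ _ _ _).1 (mulmx_col_ext (fun s =>
     addmx_inj (etrans (esym (e1 i s)) (etrans (h1 i s) (e2 i s))))).
  have g2 : _ := (lift_coefs _ _ _ _ _ _).1 (mulmx_col_ext (fun s =>
     addmx_inj (etrans (esym (e3 s)) (etrans (h2 s) (e4 s))))).
  split=> //.
  - by move=> i; case: (g1 i).
  - by move=> i; case: (g1 i).
  - by case: g2.
  have : lift_mx (P^T *m qds_pair T' *m P) = lift_mx (qds_pair T).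
    apply: bilinear_ext => s t; rewrite -[t]pSK.
    by have := h3 s (pS t); rewrite e5 qds_SE.
  by move=> /matrixP h'; apply/matrixP => i j; have := h' i j; rewrite [LHS]mxE [RHS]mxE => /polyC_inj.
split=> //.
- by move=> i s; rewrite e1 e2 h1 h2.
- by move=> s; rewrite e3 e4 h3 h4.
- by move=> s t; rewrite e5 h5.
Qed.

Lemma log_qds_iso T T' d (P : 'M[G]_r) : qds_iso k T T' P -> log_qds k T d -> log_qds k T' d.
Proof.
move=> iso [[h1 h2] [h3 h4] h5 h6]; have [u _ _ _ eg] := (qds_isoE T T' P).1 iso.
case: iso => _ i1 i2 i3.
have inv (s : 'cV[PG]_r) : exists s', s = lift_mx P *m s'.
  exists (lift_mx (invmx P) *m s); by rewrite mulmxA -liftM mulmxV // lift1 mul1mx.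
split.
- split=> [i j s|i s]; have [s' ->] := inv s; first by rewrite -!i1 h1.
  by rewrite -i2 -!i1 -i2 h2.
- split=> [i s t|s t]; have [s' ->] := inv s; have [t' ->] := inv t.
    by rewrite -!i1 !i3 h3.
  by rewrite -!i2 !i3 h4.
- by move=> s t; have [s' ->] := inv s; have [t' ->] := inv t; rewrite !i3; exact: h5.
- move: h6; rewrite -eg !unitmx_mul => /andP[/andP[_ ->] _] //.
Qed.

End QdsEquations.

(** * Restriction to the base and extension along the parameters *)

Section MatrixSubstitution.
Variables (C : numFieldType) (n p : nat) (phi : 'I_n -> germ C p).
Hypothesis phi0 : forall i, phi i 0%MM = 0.

Definition msub m q (A : 'M[germ C n]_(m, q)) : 'M[germ C p]_(m, q) := map_mx (germ_subst phi) A.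

Lemma msubD m q (A B : 'M_(m, q)) : msub (A + B) = msub A + msub B.
Proof. by apply/matrixP => i j; rewrite !mxE substD. Qed.
Lemma msubN m q (A : 'M_(m, q)) : msub (- A) = - msub A.
Proof. by apply/matrixP => i j; rewrite !mxE substN. Qed.
Lemma msubB m q (A B : 'M_(m, q)) : msub (A - B) = msub A - msub B.
Proof. by rewrite msubD msubN. Qed.
Lemma msub0 m q : msub (0 : 'M_(m, q)) = 0.
Proof. by apply/matrixP => i j; rewrite !mxE subst0. Qed.
Lemma msub1 m : msub (1%:M : 'M_m) = 1%:M.
Proof. by apply/matrixP => i j; rewrite !mxE; case: eqP => _; rewrite ?subst1 ?subst0. Qed.
Lemma msubZ m q c (A : 'M_(m, q)) : msub (c *: A) = germ_subst phi c *: msub A.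
Proof. by apply/matrixP => i j; rewrite !mxE substM. Qed.
Lemma msubM m q s (A : 'M_(m, q)) (B : 'M_(q, s)) : msub (A *m B) = msub A *m msub B.
Proof.
apply/matrixP => i j; rewrite !mxE subst_sum //; apply: eq_bigr => a _.
by rewrite !mxE substM.
Qed.
Lemma msubT m q (A : 'M_(m, q)) : msub A^T = (msub A)^T.
Proof. by apply/matrixP => i j; rewrite !mxE. Qed.
Lemma msub_sum m q (I : Type) (r : seq I) (P : pred I) (F : I -> 'M_(m, q)) :
  msub (\sum_(i <- r | P i) F i) = \sum_(i <- r | P i) msub (F i).
Proof. by elim/big_rec2: _ => [|i y x _ <-]; rewrite ?msub0 ?msubD. Qed.

Lemma subst_logder k (J : 'M[germ C p]_(n, p)) :
  (forall a b, logder k b (phi a) = (if (a < k)%N then phi a else 1) * J a b) ->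
  forall b f, logder k b (germ_subst phi f) = \sum_a J a b * germ_subst phi (logder k a f).
Proof.
move=> hJ b f; rewrite {1}/logder subst_der // mulr_sumr; apply: eq_bigr => a _.
rewrite mulrA -/(logder k b (phi a)) hJ /logder substM // mulrCA mulrA.
by congr (_ * _ * _); case: ifP; rewrite ?subst_var ?subst1.
Qed.

Lemma msub_mlogder k (J : 'M[germ C p]_(n, p)) :
  (forall a b, logder k b (phi a) = (if (a < k)%N then phi a else 1) * J a b) ->
  forall b m q (A : 'M_(m, q)), mlogder k b (msub A) = \sum_a J a b *: msub (mlogder k a A).
Proof.
move=> hJ b m q A; apply/matrixP => i j; rewrite summxE !mxE (subst_logder hJ).
by apply: eq_bigr => a _; rewrite !mxE.
Qed.

End MatrixSubstitution.

Section Restriction.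
Variables (C : numFieldType) (n l : nat).
Local Notation G := (germ C (n + l)).
Local Notation zs := (zero_section C n l).
Implicit Types (f g : G) (h : germ C n).

(* The parameters of an unfolding of a germ with n coordinates. *)
Definition params := [pred a : 'I_(n + l) | (n <= a)%N].

Lemma params_lshift (i : 'I_n) : params (lshift l i) = false.
Proof. by rewrite /= leqNgt ltn_ord. Qed.
Lemma params_rshift (j : 'I_l) : params (rshift n j).
Proof. exact: leq_addr. Qed.
Lemma paramsP (a : 'I_(n + l)) : params a -> exists j, a = rshift n j.
Proof.
case: (split_ordP a) => [i ->|j -> _]; first by rewrite params_lshift.
by exists j.
Qed.

Lemma split_lshift m p (i : 'I_m) : split (lshift p i) = inl i.
Proof. exact: (unsplitK (inl _ i)). Qed.
Lemma split_rshift m p (i : 'I_p) : split (rshift m i) = inr i.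
Proof. exact: (unsplitK (inr _ i)). Qed.

Lemma zs_lshift i : zs (lshift l i) = germ_var C i.
Proof. by rewrite ffunE split_lshift. Qed.
Lemma zs_rshift j : zs (rshift n j) = 0.
Proof. by rewrite ffunE split_rshift. Qed.
Lemma gvar0 p (i : 'I_p) : germ_var C i 0%MM = 0.
Proof. by rewrite gcoef_var; case: eqP => // /(congr1 (@mdeg p)); rewrite mdeg0 mdeg1. Qed.
Lemma zs0 a : zs a 0%MM = 0.
Proof. by case: (split_ordP a) => i ->; rewrite ?zs_lshift ?gvar0 // zs_rshift gcoef0. Qed.

Definition restr f : germ C n := germ_subst zs f.
Definition ext h : G := germ_subst (fun i => germ_var C (lshift l i)) h.

Let ev0 (i : 'I_n) : germ_var C (lshift l i) 0%MM = 0. Proof. exact: gvar0. Qed.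

Lemma extK h : restr (ext h) = h.
Proof.
rewrite /restr /ext (subst_comp (chi := @germ_var C n)) ?subst_id //; first exact: zs0.
by move=> i; rewrite subst_var ?zs_lshift //; exact: zs0.
Qed.

Lemma restr_logder k (i : 'I_n) f : restr (logder k (lshift l i) f) = logder k i (restr f).
Proof.
rewrite /logder /restr substM ?subst_der; try exact: zs0.
rewrite (bigD1 (lshift l i)) //= big1 ?addr0 => [|a ne]; last first.
  have -> : germ_der i (zs a) = 0; last by rewrite mul0r.
  case: (split_ordP a) ne => j -> ne; last by rewrite zs_rshift germ_der_const.
  by rewrite zs_lshift germ_der_var eq_sym; rewrite (inj_eq (@lshift_inj _ _)) in ne; rewrite (negbTE ne).
rewrite zs_lshift germ_der_var eqxx mul1r; congr (_ * _).
by case: (i < k)%N; [rewrite subst_var ?zs_lshift //; exact: zs0 | rewrite subst1 //; exact: zs0].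
Qed.

Lemma ext_logder k (i : 'I_n) h : logder k (lshift l i) (ext h) = ext (logder k i h).
Proof.
rewrite /logder /ext substM ?subst_der; try exact: ev0.
rewrite (bigD1 i) //= big1 ?addr0 => [|a ne]; last first.
  by rewrite germ_der_var (inj_eq (@lshift_inj _ _)) eq_sym (negbTE ne) mul0r.
rewrite germ_der_var eqxx mul1r; congr (_ * _).
by case: (i < k)%N; [rewrite subst_var //; exact: ev0 | rewrite subst1 //; exact: ev0].
Qed.

Lemma ext_theta_params (a : 'I_(n + l)) h : params a -> theta a (ext h) = 0.
Proof.
move=> /paramsP[j ->]; rewrite /theta /ext subst_der; last exact: ev0.
rewrite big1 ?mulr0 // => i _; rewrite germ_der_var.
by case: eqP => [/eqP|]; rewrite ?mul0r // eq_rlshift.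
Qed.

(** The map e = ext o restr is a continuous ring endomorphism fixing the base variables and killing
    the parameters, so f - e f is in the ideal of the parameters when f is a monomial. For a given
    coefficient, f may be replaced by a truncation. *)
Lemma ext_restr_vanish f : vanish params 1 (f - ext (restr f)).
Proof.
pose e x := ext (restr x).
have eD x y : e (x + y) = e x + e y by rewrite /e /ext /restr !substD.
have eM x y : e (x * y) = e x * e y by rewrite /e /ext /restr !substM //; try exact: ev0; exact: zs0.
have eC c : e (germ_const _ c) = germ_const _ c.
  by rewrite /e /ext /restr !subst_const //; try exact: ev0; exact: zs0.
have ec N x : vanish predT N x -> vanish predT N (e x).
  by move=> h; apply/subst_continuous/subst_continuous.
have hm a : vanish params 1 (mono C a - e (mono C a)).
  elim/mono_ind: (mono C a) => [|i x ih].
    have -> : e 1 = 1 by exact: (eC 1).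
    by rewrite subrr; exact: vanish0.
  rewrite eM.
  have -> : germ_var C i * x - e (germ_var C i) * e x =
    germ_var C i * (x - e x) + (germ_var C i - e (germ_var C i)) * e x by ring.
  apply: vanishD; [exact: vanishMl | apply: vanishMr].
  rewrite /e /restr subst_var; last exact: zs0.
  case: (split_ordP i) => j ->.
    rewrite zs_lshift /ext subst_var; last exact: ev0.
    by rewrite subrr; exact: vanish0.
  rewrite zs_rshift /ext subst0; last exact: ev0.
  rewrite subr0; apply: vanish_var.
  exact: params_rshift.
move=> m lm.
have h1 := @vanish_mono_sum _ _ f (mdeg m).+1.
pose s : G := \sum_(a : bmultinom (n + l) (mdeg m).+1) germ_const (n + l) (f a) * mono C a.
have hs : vanish params 1 (s - e s).
  rewrite /s; elim/big_rec: _ => [|a x _ ih].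
    have -> : e 0 = 0 by exact: (eC 0).
    by rewrite subrr; exact: vanish0.
  rewrite eD eM eC.
  have -> : germ_const (n + l) (f a) * mono C a + x -
     (germ_const (n + l) (f a) * e (mono C a) + e x) =
     germ_const (n + l) (f a) * (mono C a - e (mono C a)) + (x - e x) by ring.
  by apply: vanishD => //; apply: vanishMl.
have -> : f - ext (restr f) = ((f - s) - e (f - s)) + (s - e s).
  have ef : e f = e (f - s) + e s by rewrite -eD subrK.
  by rewrite -/(e f) ef; ring.
rewrite gcoefD (hs m lm) addr0 (vanishB h1 (ec _ _ h1)) // wdegT.
by rewrite ltnS.
Qed.

Lemma restr_vanish f : vanish params 1 f <-> restr f = 0.
Proof.
split=> [h|h]; last by have := ext_restr_vanish f; rewrite h /ext subst0 ?subr0 //; exact: ev0.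
apply: germP => m; rewrite gcoef0 gcoef_subst big1 // => a _.
have [w0|] := posnP (wdeg params a); first by rewrite h ?w0 ?mul0r.
case: (pickP [pred i | params i && (a i != 0)]%N) => [i /andP[Si mi] _|ne]; last first.
  rewrite /wdeg big1 // => i Si; apply/eqP; have := ne i.
  by rewrite inE Si; case: eqP.
have [j e] := paramsP Si; have z0 : zs i ^+ a i = 0.
  by rewrite e zs_rshift -e expr0n (negbTE mi).
have -> : \prod_i zs i ^+ a i = 0 :> germ C n.
  by rewrite (bigD1 i) //= z0 mul0r.
by rewrite gcoef0 mulr0.
Qed.

Local Notation "A ^|" := (restr_mx A) (at level 2, format "A ^|").

Lemma restr_mxE m p (A : 'M[G]_(m, p)) : restr_mx A = msub zs A. Proof. by []. Qed.

Definition mext m p (A : 'M[germ C n]_(m, p)) : 'M[G]_(m, p) :=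
  msub (fun i => germ_var C (lshift l i)) A.

Lemma mextK m p (A : 'M[germ C n]_(m, p)) : restr_mx (mext A) = A.
Proof. by apply/matrixP => i j; rewrite !mxE; exact: extK. Qed.
Lemma restr_mlogder k (i : 'I_n) m p (A : 'M[G]_(m, p)) :
  restr_mx (mlogder k (lshift l i) A) = mlogder k i (restr_mx A).
Proof. by apply/matrixP => a b; rewrite !mxE; exact: restr_logder. Qed.
Lemma mext_mlogder k (i : 'I_n) m p (A : 'M[germ C n]_(m, p)) :
  mlogder k (lshift l i) (mext A) = mext (mlogder k i A).
Proof. by apply/matrixP => a b; rewrite !mxE; exact: ext_logder. Qed.
Lemma mext_mtheta_params a m p (A : 'M[germ C n]_(m, p)) : params a -> mtheta a (mext A) = 0.
Proof. by move=> h; apply/matrixP => i j; rewrite !mxE; exact: ext_theta_params. Qed.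
Lemma restr_mx_vanish m p (A : 'M[G]_(m, p)) : mvanish params 1 A <-> restr_mx A = 0.
Proof.
split=> [h|/matrixP h i j]; first by apply/matrixP => i j; rewrite !mxE; apply/restr_vanish.
by apply/restr_vanish; have := h i j; rewrite !mxE.
Qed.
Lemma restr_mx_eq m p (A B : 'M[G]_(m, p)) : mvanish params 1 (A - B) <-> restr_mx A = restr_mx B.
Proof.
have eB : restr_mx (A - B) = restr_mx A - restr_mx B by exact: (msubB zs0).
split=> [/restr_mx_vanish|e].
  by rewrite eB => /eqP; rewrite subr_eq0 => /eqP.
by apply/restr_mx_vanish; rewrite eB e subrr.
Qed.
Lemma restr_mx_unit m (A : 'M[G]_m) : (restr_mx A \in unitmx) = (A \in unitmx).
Proof.
rewrite [RHS]unitmx_at0 unitmx_at0; congr (_ \in unitmx).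
by apply/matrixP => i j; rewrite !mxE; exact: (subst_coef0 zs0).
Qed.

Lemma restr_mxM m p q (A : 'M[G]_(m, p)) (B : 'M[G]_(p, q)) :
  restr_mx (A *m B) = restr_mx A *m restr_mx B.
Proof. exact: (msubM zs0). Qed.
Lemma restr_mx1 m : restr_mx (1%:M : 'M[G]_m) = 1%:M.
Proof. exact: (msub1 zs0). Qed.
Lemma restr_mxV m (A : 'M[G]_m) : A \in unitmx -> restr_mx (invmx A) = invmx (restr_mx A).
Proof.
move=> u; have u' : restr_mx A \in unitmx by rewrite restr_mx_unit.
by apply: (can_inj (mulKmx u')); rewrite -restr_mxM !mulmxV // restr_mx1.
Qed.

(* Parallel transport along the parameters of an unfolding: its connection on E
   has a flat frame as soon as this holds on the base. *)
Lemma extend_flat_frame (m r : nat) (Gam : 'I_(n + l) -> 'M[G]_r) (P0 : 'M[germ C n]_(m, r)) :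
  (forall a b, mlogder n a (Gam b) + Gam a *m Gam b = mlogder n b (Gam a) + Gam b *m Gam a) ->
  (forall i : 'I_n, mlogder n i P0 = P0 *m restr_mx (Gam (lshift l i))) ->
  exists2 P, restr_mx P = P0 & forall a, mlogder n a P = P *m Gam a.
Proof.
move=> hflat h0.
have [a|a|P /restr_mx_eq eP hP] := flat_trivialisation (P0 := mext P0) hflat.
- exact: mext_mtheta_params.
- case: (split_ordP a) => [i ->|j ->]; last by have := params_rshift j; rewrite /= => ->.
  move=> _; apply/restr_mx_vanish.
  rewrite mext_mlogder h0 restr_mxE (msubB zs0) -!restr_mxE restr_mxM !mextK.
  by rewrite subrr.
by exists P => //; rewrite eP mextK.
Qed.

Lemma flat_frame_unique (m r : nat) (Gam : 'I_(n + l) -> 'M[G]_r) (P P' : 'M[G]_(m, r)) :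
  restr_mx P = restr_mx P' ->
  (forall a, mlogder n a P = P *m Gam a) ->
  (forall a, mlogder n a P' = P' *m Gam a) -> P = P'.
Proof.
move=> /restr_mx_eq h hP hP'.
by apply: (flat_section_unique (k := n) (Gam := Gam)) => // a _.
Qed.

End Restriction.

(** * The Frobenius structure of a flat system *)

Lemma subr_cancel (V : zmodType) (x y z x' y' z' : V) :
  x - z = x' - z' -> x + y - z - y = x' + y' - z' - y'.
Proof. by move=> e; rewrite (addrAC x) addrK (addrAC x') addrK. Qed.

(** P' and Q' stand for derivatives along the Euler field. The operation P -> P' - [P, V] is a
    derivation, and its shift by - P leaves the term P Q: this is Lie_E(o) = o in terms of
    multiplication operators. *)
Lemma twisted_leibniz (R : comNzRingType) (n : nat) (P Q P' Q' V : 'M[R]_n) :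
  P' *m Q + P *m Q' - P *m Q *m V + V *m (P *m Q) - P *m Q
  + - ((P' - P *m V + V *m P - P) *m Q) + - (P *m (Q' - Q *m V + V *m Q - Q)) = P *m Q.
Proof.
rewrite !(mulmxBl, mulmxBr, mulmxDl, mulmxDr) !mulmxA; mx_group.
Qed.

(** The analogue for Lie_E(g); x' and y' stand for derivatives along the Euler field of the
    coordinates in the flat frame. *)
Lemma twisted_metric (R : comNzRingType) (n : nat) (x y x' y' : 'cV[R]_n) (V g : 'M[R]_n) :
  (x'^T *m g *m y + x^T *m g *m y') 0 0 - ((x' + V *m x - x)^T *m g *m y) 0 0
    - (x^T *m g *m (y' + V *m y - y)) 0 0 =
  2 * (x^T *m g *m y) 0 0 - (x^T *m (V^T *m g + g *m V) *m y) 0 0.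
Proof.
have tD (u v : 'cV[R]_n) : (u + v)^T = u^T + v^T by apply/matrixP => a b; rewrite !mxE.
have tN (u : 'cV[R]_n) : (- u)^T = - u^T by apply/matrixP => a b; rewrite !mxE.
rewrite !tD tN trmx_mul !(mulmxDl, mulmxDr, mulNmx, mulmxN) !mulmxA !(mxeD, mxeN).
ring.
Qed.

Section LogFrobenius.
Variables (C : numFieldType) (k n : nat) (d : int).
Local Notation G := (germ C n).
Variables (T : qds_data C n n) (w : 'cV[G]_n).
Hypothesis hT : flat_qds k T d.
Hypothesis w_flat : forall i, mlogder k i w = 0.
Hypothesis Vinf_w : qds_Vinf T *m w = 0.

Local Notation vf := 'cV[G]_n.
Implicit Types X Y Z : vf.

(* The operators and the Frobenius data enter as variables tied to their definitions
   by equations, which keeps unification from unfolding them. *)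
Variables (A : 'I_n -> 'M[G]_n) (M : 'M[G]_n) (AX : vf -> 'M[G]_n).
Hypothesis higgsE : forall i, qds_higgs T i = - A i.
Hypothesis ME : forall i a, M a i = (A i *m w) a 0.
Hypothesis M_unit : M \in unitmx.
Hypothesis AXE : forall X, AX X = \sum_i X i 0 *: A i.
Variables (F : frob_data C n) (pr : vf -> vf -> vf) (Gam : 'I_n -> 'M[G]_n) (nb : vf -> vf -> vf).
Hypothesis FprE : forall X Y, fm_prod F X Y = pr X Y.
Hypothesis FmulE : forall i, fm_mul F i = invmx M *m A i *m M.
Hypothesis FmetricE : fm_metric F = M^T *m qds_pair T *m M.
Hypothesis FunitE : M *m fm_unit F = w.
Hypothesis FeulerE : M *m fm_euler F = qds_V0 T *m w.
Hypothesis GamE : forall i, Gam i = invmx M *m mlogder k i M.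
Hypothesis GnbE : forall X Y, vf_nabla k Gam X Y = nb X Y.

Definition mapp m p X (B : 'M[G]_(m, p)) := \sum_i X i 0 *: mlogder k i B.

Lemma mappE m p X (B : 'M[G]_(m, p)) a b : mapp X B a b = vf_app k X (B a b).
Proof. by rewrite summxE; apply: eq_bigr => i _; rewrite !mxE. Qed.
Lemma mappM m p q X (B : 'M[G]_(m, p)) (D : 'M[G]_(p, q)) :
  mapp X (B *m D) = mapp X B *m D + B *m mapp X D.
Proof.
rewrite /mapp mulmx_suml mulmx_sumr -big_split; apply: eq_bigr => i _ /=.
by rewrite mlogderM scalerDr scalemxAl scalemxAr.
Qed.
Lemma mapp_const m p X (B : 'M[G]_(m, p)) : (forall i, mlogder k i B = 0) -> mapp X B = 0.
Proof. by move=> h; rewrite /mapp big1 // => i _; rewrite h scaler0. Qed.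
Lemma mappT m p X (B : 'M[G]_(m, p)) : mapp X B^T = (mapp X B)^T.
Proof. by apply/matrixP => a b; rewrite mappE mxE [RHS]mxE mappE. Qed.

Lemma vf_app_bracket X Y f :
  vf_app k X (vf_app k Y f) - vf_app k Y (vf_app k X f) = vf_app k (vf_bracket k X Y) f.
Proof.
have e X' Y' : vf_app k X' (vf_app k Y' f) =
    \sum_j vf_app k X' (Y' j 0) * logder k j f
    + \sum_i \sum_j X' i 0 * Y' j 0 * logder k i (logder k j f).
  rewrite exchange_big -big_split /vf_app /=.
  under eq_bigr do rewrite logder_sum mulr_sumr.
  rewrite exchange_big; apply: eq_bigr => j _ /=.
  rewrite mulr_suml -big_split; apply: eq_bigr => i _ /=.
  by rewrite logderM; ring.
rewrite !e {1}/vf_app /vf_bracket.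
have -> : \sum_i \sum_j Y i 0 * X j 0 * logder k i (logder k j f) =
    \sum_i \sum_j X i 0 * Y j 0 * logder k i (logder k j f).
  rewrite exchange_big; apply: eq_bigr => i _; apply: eq_bigr => j _.
  by rewrite logder_comm [Y j 0 * _]mulrC.
rewrite opprD addrACA subrr addr0 -sumrB.
by apply: eq_bigr => j _; rewrite [in RHS]mxE mulrBl.
Qed.

Lemma mapp_bracket m p X Y (B : 'M[G]_(m, p)) :
  mapp X (mapp Y B) - mapp Y (mapp X B) = mapp (vf_bracket k X Y) B.
Proof. by apply/matrixP => a b; rewrite mxeD mxeN !mappE vf_app_bracket. Qed.

Let AXD X Y : AX (X + Y) = AX X + AX Y.
Proof. by rewrite !AXE -big_split; apply: eq_bigr => i _; rewrite mxE scalerDl. Qed.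
Let AXN X : AX (- X) = - AX X.
Proof. by rewrite !AXE -sumrN; apply: eq_bigr => i _; rewrite mxE scaleNr. Qed.

Let AX_w X : AX X *m w = M *m X.
Proof.
apply/matrixP => a b; rewrite (ord1 b) AXE mulmx_suml summxE [RHS]mxE.
by apply: eq_bigr => i _; rewrite -scalemxAl mxeZ ME mulrC.
Qed.

Let A_comm i j : A i *m A j = A j *m A i.
Proof.
by have := fq_comm hT i j; rewrite !higgsE !mulmxN !mulNmx !opprK.
Qed.

Let AX_A X j : AX X *m A j = A j *m AX X.
Proof.
rewrite AXE mulmx_suml mulmx_sumr; apply: eq_bigr => i _.
by rewrite -scalemxAl -scalemxAr A_comm.
Qed.

Let comm_AX B X : (forall i, B *m A i = A i *m B) -> B *m AX X = AX X *m B.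
Proof.
move=> h; rewrite AXE mulmx_suml mulmx_sumr; apply: eq_bigr => i _.
by rewrite -scalemxAl -scalemxAr h.
Qed.

Let AX_comm X Y : AX X *m AX Y = AX Y *m AX X.
Proof. by apply: comm_AX => i; rewrite AX_A. Qed.

(* w generates E under the operators A i, so that an operator commuting with
   them is determined by its value on w. *)
Let cyclic B D : (forall i, B *m A i = A i *m B) -> (forall i, D *m A i = A i *m D) ->
  B *m w = D *m w -> B = D.
Proof.
move=> hB hD e; apply: mulmx_col_ext => u.
rewrite -(mulKVmx M_unit u) -AX_w !mulmxA (comm_AX _ hB) (comm_AX _ hD) -!mulmxA.
by rewrite e.
Qed.

Let AX_inj X Y : AX X = AX Y -> X = Y.
Proof. by move=> e; apply: (can_inj (mulKmx M_unit)); rewrite -!AX_w e. Qed.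

Let V0_comm i : qds_V0 T *m A i = A i *m qds_V0 T.
Proof.
by have := fq_commV hT i; rewrite higgsE mulNmx mulmxN => /oppr_inj.
Qed.

Let period_mapE X : period_map T w X = M *m X.
Proof.
rewrite -AX_w /period_map /qds_Phi AXE -mulNmx -sumrN.
by congr (_ *m _); apply: eq_bigr => i _; rewrite higgsE scalerN opprK.
Qed.

Let PhiE X : qds_Phi T X = - AX X.
Proof. by rewrite /qds_Phi AXE -sumrN; apply: eq_bigr => i _; rewrite higgsE scalerN. Qed.

Let prodE X Y : M *m pr X Y = AX X *m (M *m Y).
Proof.
rewrite -FprE /fm_prod mulmx_sumr AXE mulmx_suml; apply: eq_bigr => i _.
by rewrite FmulE -scalemxAr !mulmxA mulmxV // mul1mx -!scalemxAl ?mulmxA.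
Qed.

Let AX_prod X Y : AX (pr X Y) = AX X *m AX Y.
Proof.
apply: cyclic => [i|i|]; first exact: AX_A.
  by rewrite -mulmxA AX_A !mulmxA AX_A.
by rewrite AX_w prodE -mulmxA AX_w.
Qed.

Let AX_unit : AX (fm_unit F) = 1%:M.
Proof.
apply: cyclic => [i|i|]; [exact: AX_A | by rewrite mul1mx mulmx1 |].
by rewrite AX_w FunitE mul1mx.
Qed.

Let AX_euler : AX (fm_euler F) = qds_V0 T.
Proof.
apply: cyclic => [i|i|]; [exact: AX_A | exact: V0_comm |].
by rewrite AX_w FeulerE.
Qed.

Let gE X Y : fm_g F X Y = ((M *m X)^T *m qds_pair T *m (M *m Y)) 0 0.
Proof. by rewrite /fm_g FmetricE trmx_mul !mulmxA. Qed.

Let AX_pair X : (AX X)^T *m qds_pair T = qds_pair T *m AX X.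
Proof.
rewrite AXE linear_sum mulmx_suml mulmx_sumr; apply: eq_bigr => i _ /=.
rewrite linearZ /= -scalemxAl -scalemxAr; congr (_ *: _).
by have := fq_pair_higgs hT i; rewrite higgsE linearN /= mulNmx mulmxN => /oppr_inj.
Qed.

Let nbE X Y : M *m nb X Y = mapp X (M *m Y).
Proof.
rewrite -GnbE /vf_nabla mulmxDr mappM addrC; congr (_ + _).
  rewrite /mapp mulmx_sumr mulmx_suml; apply: eq_bigr => i _.
  by rewrite GamE -scalemxAr mulmxA mulKVmx // scalemxAl.
by congr (_ *m _); apply/matrixP => a b; rewrite mxE mappE (ord1 b).
Qed.

Let Minj : injective (mulmx M : vf -> vf). Proof. exact: can_inj (mulKmx M_unit). Qed.

(** The derivatives of the A i cancel because Phi is closed, and only those of the coefficients of X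
    and Y remain. Evaluated on the flat section w, this says that the connection transported by the
    period map has no torsion. *)
Let AX_bracket X Y : mapp X (AX Y) - mapp Y (AX X) = AX (vf_bracket k X Y).
Proof.
have e X' Y' : mapp X' (AX Y') = \sum_i vf_app k X' (Y' i 0) *: A i
    + \sum_i \sum_j (X' i 0 * Y' j 0) *: mlogder k i (A j).
  rewrite exchange_big -big_split /mapp AXE /=.
  under eq_bigr do rewrite mlogder_sum scaler_sumr.
  rewrite exchange_big; apply: eq_bigr => j _ /=.
  rewrite /vf_app scaler_suml -big_split; apply: eq_bigr => i _ /=.
  by rewrite mlogderZ scalerDr !scalerA.
have cl i j : mlogder k i (A j) = mlogder k j (A i).
  by have := fq_closed hT i j; rewrite !higgsE !mlogderN => /oppr_inj.
rewrite !e.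
have -> : \sum_i \sum_j (Y i 0 * X j 0) *: mlogder k i (A j) =
    \sum_i \sum_j (X i 0 * Y j 0) *: mlogder k i (A j).
  rewrite exchange_big; apply: eq_bigr => i _; apply: eq_bigr => j _.
  by rewrite cl [Y j 0 * _]mulrC.
rewrite opprD addrACA subrr addr0 -sumrB AXE.
by apply: eq_bigr => j _; rewrite [in RHS]mxE scalerBl.
Qed.

Let v_bracket X Y : M *m vf_bracket k X Y = mapp X (M *m Y) - mapp Y (M *m X).
Proof.
rewrite -!AX_w -AX_bracket !mappM (mapp_const _ w_flat) !mulmx0 !addr0.
by rewrite (mapp_const _ w_flat) mulmx0 addr0 mulmxBl.
Qed.

Let mapp_V0 X : mapp X (qds_V0 T) = AX X *m qds_Vinf T - qds_Vinf T *m AX X + AX X.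
Proof.
rewrite /mapp AXE mulmx_suml mulmx_sumr -sumrB -big_split; apply: eq_bigr => i _ /=.
rewrite -scalemxAl -scalemxAr -scalerBr -scalerDr; congr (_ *: _).
have := fq_V0 hT i; rewrite higgsE !mulNmx !mulmxN => /(congr1 (fun B : 'M_n => B + A i *m qds_Vinf T)).
by rewrite subrK => ->; mx_group.
Qed.

Let E := fm_euler F.

Let AX_euler_bracket X : AX (vf_bracket k E X) =
  mapp E (AX X) - AX X *m qds_Vinf T + qds_Vinf T *m AX X - AX X.
Proof. by rewrite -AX_bracket AX_euler mapp_V0; mx_group. Qed.

Let v_euler_bracket X : M *m vf_bracket k E X =
  mapp E (M *m X) + qds_Vinf T *m (M *m X) - M *m X.
Proof.
rewrite -!AX_w AX_euler_bracket !(mulmxBl, mulmxDl, mulNmx) -!mulmxA Vinf_w mulmx0 subr0.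
by rewrite mappM (mapp_const _ w_flat) mulmx0 addr0 mulmxA.
Qed.

Lemma flat_qds_log_frobenius_aux : defines_log_frobenius k T w.
Proof.
have pair_mapp X : mapp X (qds_pair T) = 0 by apply: mapp_const; exact: (fq_pair hT).
have g_mapp X Y Z : vf_app k X (fm_g F Y Z) =
    ((mapp X (M *m Y))^T *m qds_pair T *m (M *m Z)
     + (M *m Y)^T *m qds_pair T *m mapp X (M *m Z)) 0 0.
  by rewrite gE -mappE (mappM X (_ *m qds_pair T)) (mappM X _ (qds_pair T)) pair_mapp mulmx0 addr0 mappT.
split.
- by move=> i; rewrite (fq_conn hT) mul0mx addr0; exact: w_flat.
- exists (mulmx (invmx M)) => X; first by rewrite period_mapE mulKmx.
  by rewrite period_mapE mulKVmx.
exists F; split; last by rewrite period_mapE FeulerE.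
- split.
  + split.
    * by move=> X Y; apply: AX_inj; rewrite !FprE !AX_prod AX_comm.
    * by move=> X Y Z; apply: AX_inj; rewrite !FprE !AX_prod mulmxA.
    * by move=> X; apply: AX_inj; rewrite FprE AX_prod AX_unit mul1mx.
  + split.
    * move=> X Y; rewrite !gE.
      transitivity (((M *m Y)^T *m qds_pair T *m (M *m X))^T 0 0); last by rewrite mxE.
      by rewrite !trmx_mul !trmxK (fq_sym hT) !mulmxA.
    * by rewrite FmetricE !unitmx_mul unitmx_tr M_unit (fq_unit hT).
    * move=> X Y Z; rewrite !gE !FprE; congr (fun_of_matrix _ 0 0).
      have -> : pr X Y = pr Y X by apply: AX_inj; rewrite !AX_prod AX_comm.
      by rewrite !prodE trmx_mul -!mulmxA; congr (_ *m _); rewrite !mulmxA AX_pair.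
  + exists Gam; split.
    * split=> [X Y|X Y Z]; first by apply: Minj; rewrite !GnbE mulmxBr !nbE v_bracket.
      by rewrite g_mapp !gE !GnbE !nbE mxeD.
    * by move=> X Y Z; apply: Minj; rewrite !GnbE mulmxBr !nbE mapp_bracket.
    * split=> [X Y Z|X].
        (* Potentiality: the terms with the derivative of Z cancel, and there remains the symmetry
           of mapp X (AX Y) - AX (nb X Y) in X and Y, which combines [AX_bracket] with the absence
           of torsion. *)
        apply: Minj; rewrite !GnbE !FprE !mulmxBr !nbE !prodE !nbE !(mappM _ (AX _)).
        refine (@subr_cancel _ _ _ _ _ _ _ _).
        rewrite -!mulmxBl.
        apply: (congr1 (mulmx^~ _)).
        apply/eqP; rewrite -subr_eq0 opprB addrACA -opprB.
        have -> : nb X Y = nb Y X + vf_bracket k X Y.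
          by apply: Minj; rewrite nbE [RHS]mulmxDr !nbE v_bracket; mx_group.
        by rewrite AXD -AX_bracket; apply/eqP; mx_group.
      by apply: Minj; rewrite GnbE nbE FunitE (mapp_const _ w_flat) mulmx0.
  + split=> [X Y|].
      apply: AX_inj; rewrite !FprE !(AXD, AXN, AX_prod) !AX_euler_bracket !AX_prod mappM.
      exact: twisted_leibniz.
    (* Each argument of g contributes 1 through the shift in [v_euler_bracket], and Vinf contributes
       - d through its skewness relation. *)
    exists (2 - d%:~R) => X Y; rewrite g_mapp !gE -/E !v_euler_bracket.
    have hd : (M *m X)^T *m ((qds_Vinf T)^T *m qds_pair T + qds_pair T *m qds_Vinf T) *m (M *m Y)
       = d%:~R *: ((M *m X)^T *m qds_pair T *m (M *m Y)).
      by rewrite (fq_pair_Vinf hT) -scalemxAr -scalemxAl.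
    have -> : germ_const n (2 - d%:~R : C) = 2 - d%:~R.
      by rewrite germ_constD germ_constN germ_constMn germ_const_int.
    by move: hd => /matrixP/(_ 0 0); rewrite mxeZ mulrBl => <-; exact: twisted_metric.
- by move=> X Y; rewrite !PhiE FprE AX_prod mulmxN mulNmx opprK.
- by move=> X Y; rewrite gE !period_mapE.
Qed.
End LogFrobenius.

(** The matrix which is required to be invertible is that of the period map. In the flat frame of E
    the Levi-Civita connection is componentwise derivation, so its matrices on vector fields are
    M^-1 d M. *)
Lemma flat_qds_log_frobenius (C : numFieldType) (k n : nat) (d : int)
    (T : qds_data C n n) (w : 'cV[germ C n]_n) :
  flat_qds k T d -> (forall i, mlogder k i w = 0) -> qds_Vinf T *m w = 0 ->
  (\matrix_(a, i) (- qds_higgs T i *m w) a 0) \in unitmx ->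
  defines_log_frobenius k T w.
Proof.
set M := \matrix_(a, i) _ => hT hw hV uM.
pose A i := - qds_higgs T i.
apply: (@flat_qds_log_frobenius_aux C k n d T w hT hw hV A M (fun X => \sum_i X i 0 *: A i)
  _ _ uM _ (FrobData (fun i => invmx M *m A i *m M) (M^T *m qds_pair T *m M)
  (invmx M *m w) (invmx M *m (qds_V0 T *m w))) _ (fun i => invmx M *m mlogder k i M)) => //=.
- by move=> i; rewrite opprK.
- by move=> i a; rewrite mxE.
- exact: mulKVmx.
- exact: mulKVmx.
Qed.

(** * The Cauchy problem for the products *)

Lemma bin_leq_exp n k : ('C(n, k) <= 2 ^ n)%N.
Proof.
elim: n k => [|n ih] [|k] //; first by rewrite bin0 expn_gt0.
by rewrite binS expnS mul2n -addnn leq_add.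
Qed.

(** A single term of Vandermonde's sum. The binomial is the denominator of [ck_weight], which is
    thereby submultiplicative. *)
Lemma leq_mul_bin n k n' k' : ('C(n, k) * 'C(n', k') <= 'C(n + n', k + k'))%N.
Proof.
rewrite -binomial.Vandermonde.
have lt : (k < (k + k').+1)%N by rewrite ltnS leq_addr.
by rewrite (bigD1 (Ordinal lt)) //= addKn leq_addr.
Qed.

Section CauchyKovalevskayaWeight.
Variables (C : numFieldType) (n : nat) (t : 'I_n).
Variables rho sigma : C.
Hypotheses (rho0 : 0 < rho) (sigma0 : 0 < sigma) (sigma1 : sigma <= 1).

(* The binomial makes t-integration after a derivation x_i d/dx_i bounded, with
   norm of order rho sigma: the loss of derivative in the Cauchy-Kovalevskaya
   theorem is absorbed by the norm. *)
Definition ck_weight (m : 'X_{1..n}) : C :=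
  rho ^+ mdeg m * sigma ^+ m t / 'C(mdeg m, m t)%:R.

Lemma leq_mdeg (m : 'X_{1..n}) i : (m i <= mdeg m)%N.
Proof. by rewrite mdegE (bigD1 i) //= leq_addr. Qed.

Let binm_gt0 (m : 'X_{1..n}) : 0 < 'C(mdeg m, m t)%:R :> C.
Proof. by rewrite ltr0n bin_gt0 leq_mdeg. Qed.

Let rho_ge0 : 0 <= rho. Proof. exact: ltW. Qed.
Let sigma_ge0 : 0 <= sigma. Proof. exact: ltW. Qed.

Lemma ck_weightP : weight ck_weight.
Proof.
split=> [m||m1 m2|].
- by rewrite divr_gt0 // mulr_gt0 // exprn_gt0.
- by rewrite /ck_weight mdeg0 mnm0E bin0 !expr0 mul1r divr1.
- rewrite /ck_weight !mdegD mnmDE !exprD.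
  set b1 := 'C(mdeg m1, _)%:R; set b2 := 'C(mdeg m2, _)%:R.
  have -> : rho ^+ mdeg m1 * sigma ^+ m1 t / b1 * (rho ^+ mdeg m2 * sigma ^+ m2 t / b2) =
      rho ^+ mdeg m1 * rho ^+ mdeg m2 * (sigma ^+ m1 t * sigma ^+ m2 t) / (b1 * b2).
    by rewrite invfM; ring.
  rewrite ler_wpM2l ?(mulr_ge0, exprn_ge0) //.
  rewrite lef_pV2 ?posrE ?mulr_gt0 ?binm_gt0 //; first by rewrite /b1 /b2 -natrM ler_nat leq_mul_bin.
  by rewrite -mdegD -mnmDE binm_gt0.
exists (rho * sigma / 2); first by rewrite !mulr_gt0 ?invr_gt0.
move=> m; rewrite !exprMn /ck_weight.
apply: ler_pM; rewrite ?(mulr_ge0, exprn_ge0, invr_ge0) ?ler0n //.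
  rewrite ler_wpM2l ?exprn_ge0 //.
  rewrite -(subnK (leq_mdeg m t)) exprD ler_piMl ?exprn_ge0 ?exprn_ile1 //.
rewrite exprVn lef_pV2 ?posrE ?exprn_gt0 ?binm_gt0 //.
by rewrite -natrX ler_nat bin_leq_exp.
Qed.

Lemma ck_weight_le m : ck_weight m <= rho ^+ mdeg m.
Proof.
rewrite /ck_weight -mulrA ler_piMr ?exprn_ge0 //.
rewrite ler_pdivrMr ?binm_gt0 // mul1r.
apply: (@le_trans _ _ 1); first by rewrite exprn_ile1 // ltW.
by rewrite ler1n bin_gt0 leq_mdeg.
Qed.

(** The primitive with respect to t of [theta i f] which vanishes at t = 0: multiplication by x_t
    and division by the exponent of x_t. *)
Definition ck_int (i : 'I_n) (f : germ C n) : germ C n :=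
  germ_int (pred1 t) (germ_var C t * theta i f).

(** With D the degree of m and k its exponent in t, passing from m to m + U_(t) multiplies the
    weight by rho sigma (k + 1) / (D + 1). The factor k + 1 cancels the division by the integration,
    and m i <= D + 1 absorbs the derivation. *)
Lemma ck_step (m : 'X_{1..n}) i : i != t ->
  (m i)%:R / (m t).+1%:R * ck_weight (m + U_(t))%MM <= rho * sigma * ck_weight m.
Proof.
move=> it; rewrite /ck_weight mdegD mdeg1 mnmDE mnm1E eqxx !addn1 !exprS.
have e : ((m t).+1 * 'C((mdeg m).+1, (m t).+1) = (mdeg m).+1 * 'C(mdeg m, m t))%N.
  by rewrite -mul_bin_diag.
have b1 : 0 < 'C((mdeg m).+1, (m t).+1)%:R :> C by rewrite ltr0n bin_gt0 ltnS leq_mdeg.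
have b0 := binm_gt0 m.
have -> : (m i)%:R / (m t).+1%:R * (rho * rho ^+ mdeg m * (sigma * sigma ^+ m t)
    / 'C((mdeg m).+1, (m t).+1)%:R) =
  rho * sigma * (rho ^+ mdeg m * sigma ^+ m t / 'C(mdeg m, m t)%:R) *
   ((m i)%:R / (mdeg m).+1%:R).
  have -> : (m i)%:R / (m t).+1%:R * (rho * rho ^+ mdeg m * (sigma * sigma ^+ m t)
      / 'C((mdeg m).+1, (m t).+1)%:R) =
      (m i)%:R * rho * rho ^+ mdeg m * sigma * sigma ^+ m t *
      ((m t).+1%:R * 'C((mdeg m).+1, (m t).+1)%:R)^-1 by rewrite invfM; ring.
  rewrite -natrM e natrM invfM; ring.
rewrite ler_piMr ?(mulr_ge0, exprn_ge0, invr_ge0) ?ler0n //.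
by rewrite ler_pdivrMr ?ltr0n // mul1r ler_nat leqW // leq_mdeg.
Qed.

(** The monomials divisible by x_t are reindexed by the injection m -> m - U_(t), and [ck_step]
    bounds each term. *)
Lemma bounded_ck_int K i (f : germ C n) : i != t -> bounded ck_weight K f ->
  bounded ck_weight (rho * sigma * K) (ck_int i f).
Proof.
move=> it hf N; have hw := ck_weightP.
have w0 m : 0 <= ck_weight m by exact/ltW/(weight_gt0 hw).
apply: (@le_trans _ _ (rho * sigma * \sum_(m : 'X_{1..n < N}) `|f m| * ck_weight m)); last first.
  by rewrite ler_wpM2l // ltW // mulr_gt0.
have -> : \sum_(m : 'X_{1..n < N}) `|ck_int i f m| * ck_weight m =
    \sum_(m : 'X_{1..n < N} | (0 < m t)%N) `|ck_int i f m| * ck_weight m.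
  rewrite [RHS]big_mkcond; apply: eq_bigr => m _; case: posnP => // mt.
  have -> : ck_int i f m = 0 by apply: vanish1_int; rewrite /wdeg big_pred1_eq mt.
  by rewrite normr0 mul0r.
rewrite mulr_sumr.
have subU (m : 'X_{1..n}) : (0 < m t)%N -> m = ((m - U_(t)) + U_(t))%MM.
  move=> mt; apply/mnmP => j; rewrite mnmDE mnmBE mnm1E; case: eqP => [<-|_]; first by rewrite subnK.
  by rewrite subn0 addn0.
have lt_sub (m : 'X_{1..n < N}) : (mdeg (m - U_(t))%MM < N)%N.
  apply: leq_ltn_trans (bmdeg m); rewrite !mdegE; apply: leq_sum => j _.
  by rewrite mnmBE leq_subr.
pose h (m : 'X_{1..n < N}) : 'X_{1..n < N} := BMultinom (lt_sub m).
pose F (m : 'X_{1..n}) : C := rho * sigma * (`|f m| * ck_weight m).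
have F0 m : 0 <= F m by apply: mulr_ge0; apply: mulr_ge0.
apply: (@le_trans _ _ (\sum_(m : 'X_{1..n < N} | (0 < m t)%N) F (h m))).
  apply: ler_sum => m mt; rewrite [in X in X <= _](subU m mt).
  set m' := (m - U_(t))%MM; have -> : F (h m) = rho * sigma * (`|f m'| * ck_weight m') by [].
  have -> : ck_int i f (m' + U_(t))%MM = f m' * ((m' i)%:R / (m' t).+1%:R).
    rewrite /ck_int gcoef_int gcoef_varM gcoef_theta /wdeg big_pred1_eq mnmDE mnm1E eqxx addn1.
    by rewrite -[f m' *+ _]mulr_natr mulrA.
  have q0 : 0 <= (m' i)%:R / (m' t).+1%:R :> C by rewrite divr_ge0 ?ler0n.
  have -> : `|f m' * ((m' i)%:R / (m' t).+1%:R)| = `|f m'| * ((m' i)%:R / (m' t).+1%:R).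
    by rewrite normrM (ger0_norm q0).
  move: (ck_step m' it) q0; move: (_ / _) (`|f m'|) (normr_ge0 (f m')) => q c c0 hq _.
  have -> : rho * sigma * (c * ck_weight m') = c * (rho * sigma * ck_weight m') by ring.
  by rewrite -mulrA; apply: ler_wpM2l.
have inj : {in [pred m : 'X_{1..n < N} | (0 < m t)%N] &, injective h}.
  move=> m1 m2; rewrite !inE => h1 h2 e; apply: val_inj => /=.
  by rewrite (subU m1 h1) (subU m2 h2); congr (_ + _)%MM; exact: (congr1 val e).
rewrite -(big_imset (fun m : 'X_{1..n < N} => F m) inj) /=.
rewrite [X in _ <= X](bigID (mem [set h m | m in [pred m : 'X_{1..n < N} | (0 < m t)%N]])) /=.
by rewrite lerDl; apply: sumr_ge0 => m _; exact: F0.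
Qed.

End CauchyKovalevskayaWeight.

(** * Operators generated by two matrices and a cyclic vector *)

Section CyclicFrame.
Variables (R : comUnitRingType) (r : nat).
Variables (a b : 'M[R]_r.+1).

(* The columns of [word_frame] are e_0, a e_0, b e_0, a b e_0; both definitions are
   meant for r = 3. *)
Definition word (j : 'I_r.+1) : 'M[R]_r.+1 := nth 0 [:: 1%:M; a; b; a *m b] j.

Definition word_frame : 'M[R]_r.+1 := \matrix_(i, j) word j i ord0.

(* The combination of 1, a, b, a b which maps e_0 to x. *)
Definition word_op (x : 'cV[R]_r.+1) : 'M[R]_r.+1 :=
  \sum_j (invmx word_frame *m x) j 0 *: word j.

Lemma mulmx_delta0 (X : 'M[R]_r.+1) i : (X *m delta_mx ord0 (0 : 'I_1)) i 0 = X i ord0.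
Proof. by rewrite -colE mxE. Qed.

Lemma word_op_cyclic x : word_frame \in unitmx -> word_op x *m delta_mx ord0 (0 : 'I_1) = x.
Proof.
move=> u; rewrite /word_op -[RHS](mulKVmx u); move: (invmx _ *m x) => c.
apply/matrixP => i j; rewrite (ord1 j) mulmx_suml summxE mxE.
apply: eq_bigr => k _; rewrite -scalemxAl mxeZ mulmx_delta0 [word_frame _ _]mxE.
by rewrite mulrC.
Qed.

End CyclicFrame.

Lemma map_word (R S : comUnitRingType) (f : {rmorphism R -> S}) (r : nat) (a b : 'M[R]_r.+1) j :
  word (map_mx f a) (map_mx f b) j = map_mx f (word a b j).
Proof.
rewrite /word; case: j => -[|[|[|[|j]]]] //= _; rewrite ?map_mx1 ?map_mxM //.
by rewrite nth_nil -[0 in LHS](map_mx0 f) nth_nil.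
Qed.

Lemma map_word_frame (R S : comUnitRingType) (f : {rmorphism R -> S}) (r : nat) (a b : 'M[R]_r.+1) :
  word_frame (map_mx f a) (map_mx f b) = map_mx f (word_frame a b).
Proof. by apply/matrixP => i j; rewrite mxE map_word !mxE. Qed.

Lemma invmx_subE (R : comUnitRingType) (r : nat) (B B' : 'M[R]_r) (x : 'cV[R]_r) :
  B \in unitmx -> B' \in unitmx ->
  invmx B *m x - invmx B' *m x = - (invmx B *m ((B - B') *m (invmx B' *m x))).
Proof. by move=> u u'; rewrite mulmxBl mulmxBr mulKVmx // mulKmx // opprB. Qed.

Lemma scale_subE (R : pzRingType) (V : lmodType R) (c c' : R) (u u' : V) :
  c *: u - c' *: u' = (c - c') *: u + c' *: (u - u').
Proof. by rewrite scalerBl scalerBr addrA subrK. Qed.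

Section CauchyKovalevskaya.
Variables (C : numFieldType) (n : nat) (t i1 i2 : 'I_n).
Hypotheses (t1 : i1 != t) (t2 : i2 != t).
Local Notation G := (germ C n).
Variables (a0 b0 : 'M[G]_4) (p : 'I_4 -> C).
Hypotheses (a0t : mtheta t a0 = 0) (b0t : mtheta t b0 = 0).
Hypotheses (a0_le1 : forall i j, `|a0 i j 0%MM| <= 1) (b0_le1 : forall i j, `|b0 i j 0%MM| <= 1).
Hypothesis p_le1 : \sum_i `|p i| <= 1.
Hypothesis frame0 : map_mx (@germ_at0 C n) (word_frame a0 b0) = 1%:M.

Let pt : 'cV[G]_4 := \col_i germ_const n (p i).

Let agree0 (a b : 'M[G]_4) := mvanish predT 1 (a - a0) /\ mvanish predT 1 (b - b0).

Lemma mvanish_mulB S N (a a' b b' : 'M[G]_4) :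
  mvanish S N (a - a') -> mvanish S N (b - b') -> mvanish S N (a *m b - a' *m b').
Proof.
move=> ha hb; have -> : a *m b - a' *m b' = (a - a') *m b + a' *m (b - b').
  by rewrite mulmxBl mulmxBr; mx_group.
by apply: mvanishD; [apply: mvanishMr | apply: mvanishMl].
Qed.

Lemma word_vanish S N (a a' b b' : 'M[G]_4) j :
  mvanish S N (a - a') -> mvanish S N (b - b') -> mvanish S N (word a b j - word a' b' j).
Proof.
move=> ha hb; rewrite /word; case: j => -[|[|[|[|j]]]] //= _; first by rewrite subrr; exact: mvanish0.
exact: mvanish_mulB.
Qed.

Lemma frame_vanish S N (a a' b b' : 'M[G]_4) :
  mvanish S N (a - a') -> mvanish S N (b - b') ->
  mvanish S N (word_frame a b - word_frame a' b').
Proof.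
move=> ha hb i j; rewrite mxeD mxeN !mxE.
by have := word_vanish j ha hb i ord0; rewrite mxeD mxeN.
Qed.

Lemma frame_unit a b : agree0 a b -> word_frame a b \in unitmx.
Proof.
case=> ha hb; rewrite unitmx_at0; have -> : map_mx (@germ_at0 C n) (word_frame a b) = 1%:M.
  rewrite -frame0; apply/matrixP => i j; rewrite [LHS]mxE [RHS]mxE.
  have /vanish1_coef := frame_vanish ha hb i j.
  by rewrite mxeD mxeN gcoefB => /eqP; rewrite subr_eq0 => /eqP.
exact: unitmx1.
Qed.

Lemma word_op_vanish N a b a' b' x : agree0 a b -> agree0 a' b' ->
  mvanish predT N (a - a') -> mvanish predT N (b - b') ->
  mvanish predT N (word_op a b x - word_op a' b' x).
Proof.
move=> /frame_unit u /frame_unit u' ha hb.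
set B := word_frame a b in u *; set B' := word_frame a' b' in u' *.
have hc : mvanish predT N (invmx B *m x - invmx B' *m x).
  rewrite (invmx_subE x u u').
  by apply/mvanishN/mvanishMl/mvanishMr; apply: frame_vanish.
rewrite /word_op -sumrB -/B -/B'; apply: mvanish_sum => j _.
rewrite scale_subE.
apply: mvanishD; last by apply: mvanishZ; apply: word_vanish.
by move=> i k; rewrite mxeZ; apply: vanishMr; have := hc j 0; rewrite mxeD mxeN.
Qed.

Section Bounds.
Variables (w : 'X_{1..n} -> C) (e : C).
Hypothesis hw : weight w.
Hypotheses (e0 : 0 <= e) (e_small : e <= 128^-1).

Definition mbounded K (A : 'M[G]_4) := forall i j, bounded w K (A i j).

Let mboundedM K L A B : mbounded K A -> mbounded L B -> mbounded (4 * (K * L)) (A *m B).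
Proof.
move=> hA hB i j; rewrite mxE.
have := @bounded_sum _ _ _ hw _ (index_enum _) xpredT _ _ (fun k _ => boundedM hw (hA i k) (hB k j)).
by rewrite sumr_const card_ord -[_ *+ 4]mulr_natl.
Qed.

Variables a b : 'M[G]_4.
Let ca := map_mx (@germ_cst C n) (map_mx (@germ_at0 C n) a0).
Let cb := map_mx (@germ_cst C n) (map_mx (@germ_at0 C n) b0).
Hypotheses (hab : agree0 a b) (ha : mbounded e (a - ca)) (hb : mbounded e (b - cb)).

Let e1 : e <= 1.
Proof. by apply: le_trans e_small _; rewrite invf_le1 ?ler1n ?ltr0n. Qed.

Let bound_a : mbounded 2 a.
Proof.
move=> i j; rewrite -[a i j](subrK (ca i j)).
apply: (@boundedW _ _ _ (e + 1)); first by rewrite -[2]/(1 + 1) lerD2r.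
apply: boundedD => //; first by have := ha i j; rewrite mxeD mxeN.
by rewrite !mxE; apply: boundedW (bounded_const hw _); exact: a0_le1.
Qed.

Let bound_b : mbounded 2 b.
Proof.
move=> i j; rewrite -[b i j](subrK (cb i j)).
apply: (@boundedW _ _ _ (e + 1)); first by rewrite -[2]/(1 + 1) lerD2r.
apply: boundedD => //; first by have := hb i j; rewrite mxeD mxeN.
by rewrite !mxE; apply: boundedW (bounded_const hw _); exact: b0_le1.
Qed.

Let bound_cb : mbounded 1 cb.
Proof. by move=> i j; rewrite !mxE; apply: boundedW (bounded_const hw _); exact: b0_le1. Qed.
Let bound_ca : mbounded 1 ca.
Proof. by move=> i j; rewrite !mxE; apply: boundedW (bounded_const hw _); exact: a0_le1. Qed.

Let frame_c : word_frame ca cb = 1%:M.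
Proof. by rewrite !map_word_frame frame0 map_mx1. Qed.

Let mboundedD K L A B : mbounded K A -> mbounded L B -> mbounded (K + L) (A + B).
Proof. by move=> hA hB i j; rewrite mxeD; apply: boundedD. Qed.

Let mboundedW K L A : K <= L -> mbounded K A -> mbounded L A.
Proof. by move=> le h i j; apply: boundedW (h i j). Qed.

Let e4_ge : e <= 4 * (e * 2) + 4 * (1 * e).
Proof.
have -> : 4 * (e * 2) + 4 * (1 * e) = e + 11 * e by ring.
by rewrite lerDl mulr_ge0.
Qed.

(** Each word is within 12 e <= 16 / 128 of its value at 0, where the frame is the identity. The
    value 1/8 is chosen for the next step: with 4 columns, frame - 1 has operator norm at most 4 / 8
    < 1. *)
Let bound_frame : mbounded 8^-1 (word_frame a b - 1%:M).
Proof.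
have h (j : 'I_4) : mbounded (4 * (e * 2) + 4 * (1 * e)) (word a b j - word ca cb j).
  rewrite /word; case: j => -[|[|[|[|j]]]] //= _.
  - move=> i j; rewrite subrr mxe0; apply: boundedW (bounded0 hw).
    by apply: le_trans e4_ge.
  - by apply: mboundedW e4_ge _.
  - by apply: mboundedW e4_ge _.
  have -> : a *m b - ca *m cb = (a - ca) *m b + ca *m (b - cb).
    by rewrite mulmxBl mulmxBr; mx_group.
  by apply: mboundedD; apply: mboundedM.
move=> i j; rewrite -frame_c mxeD mxeN !mxE -mxeN -mxeD.
apply: boundedW (h j i ord0).
have -> : 4 * (e * 2) + 4 * (1 * e) = 12 * e by ring.
apply: (@le_trans _ _ (16 * e)); first by rewrite ler_wpM2r // ler_nat.
rewrite -ler_pdivlMl ?ltr0n //; apply: le_trans e_small _.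
by rewrite -invfM -natrM.
Qed.

Let x := invmx (word_frame a b) *m pt.

(** In place of a Neumann series: x = pt - (frame - 1) x bounds the sum of the truncated norms of
    its entries by 1 plus half of that same sum. Truncated norms are finite, so the half can be
    absorbed. *)
Let bound_x i : bounded w 2 (x i 0).
Proof.
have u := frame_unit hab; set B := word_frame a b in u *.
have xE : x = pt - (B - 1%:M) *m x by rewrite mulmxBl mul1mx mulKVmx // opprB addrC subrK.
move=> N; pose nx j := wnorm w N (x j 0).
have nx0 j : 0 <= nx j by exact: wnorm_ge0.
have hx j : nx j <= `|p j| + 8^-1 * \sum_k nx k.
  rewrite /nx {1}xE mxeD mxeN [pt _ _]mxE.
  apply: le_trans (wnormB hw _ _ _) _; apply: lerD; first exact: (bounded_const hw).
  rewrite mxE mulr_sumr; apply: le_trans (wnorm_sum hw _ _ _ _) _; apply: ler_sum => k _.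
  apply: le_trans (wnormM hw _ _ _) _; apply: ler_wpM2r; first exact: nx0.
  exact: bound_frame.
have hs : \sum_k nx k <= 2.
  have : \sum_k nx k <= \sum_j (`|p j| + 8^-1 * \sum_k nx k) by apply: ler_sum => j _.
  rewrite big_split sumr_const card_ord /= -[_ *+ 4]mulr_natl => hle.
  have {}hle : \sum_k nx k <= 1 + 2^-1 * \sum_k nx k.
    apply: le_trans hle _; apply: lerD => //; rewrite mulrA.
    by rewrite (_ : 4 * 8^-1 = 2^-1 :> C) //; field.
  move: hle; rewrite -lerBlDr -{1}[\sum_k nx k]mul1r -mulrBl.
  rewrite (_ : 1 - 2^-1 = 2^-1 :> C); last by field.
  by rewrite ler_pdivrMl ?ltr0n // mulr1.
by apply: le_trans hs; rewrite (bigD1 i) //= lerDl sumr_ge0.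
Qed.

(** Four terms, each with a coefficient bounded by 2 and a word bounded by 16. *)
Lemma bounded_word_op : mbounded 128 (word_op a b pt).
Proof.
have hword j : mbounded 16 (word a b j).
  rewrite /word; case: j => -[|[|[|[|j]]]] //= _.
  - move=> i j; rewrite mxE; case: (i == j).
      by apply: boundedW (bounded1 hw); rewrite ler1n.
    by apply: boundedW (bounded0 hw); rewrite ler0n.
  - by apply: mboundedW bound_a; rewrite ler_nat.
  - by apply: mboundedW bound_b; rewrite ler_nat.
  by apply: mboundedW (mboundedM bound_a bound_b); rewrite -!natrM ler_nat.
move=> i j; rewrite /word_op summxE.
have hk k : bounded w (2 * 16) ((x k 0 *: word a b k) i j).
  by rewrite mxeZ; exact: (boundedM hw (bound_x k) (hword k i j)).
have := @bounded_sum _ _ _ hw _ (index_enum _) xpredT _ _ (fun k _ => hk k).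
by rewrite sumr_const card_ord -[_ *+ 4]mulr_natl -!natrM.
Qed.

End Bounds.

Definition mck_int i m q (A : 'M[G]_(m, q)) : 'M[G]_(m, q) := map_mx (ck_int t i) A.

Lemma mck_intE i m q (A : 'M[G]_(m, q)) k l : mck_int i A k l = ck_int t i (A k l).
Proof. by rewrite mxE. Qed.

Lemma mtheta_mck_int i m q (A : 'M[G]_(m, q)) : mtheta t (mck_int i A) = germ_var C t *: mtheta i A.
Proof.
apply/matrixP => k l; rewrite !mxE theta_int1 //.
by apply: vanishMr; apply: vanish_var => /=.
Qed.

Lemma mvanish1_mck_int (S : pred 'I_n) i m q (A : 'M[G]_(m, q)) : S t -> mvanish S 1 (mck_int i A).
Proof.
move=> St k l; rewrite mxE; apply: vanish_int; apply: vanishMr; exact: vanish_var.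
Qed.

Lemma mck_int_contract i N m q (A B : 'M[G]_(m, q)) :
  mvanish predT N (A - B) -> mvanish predT N.+1 (mck_int i A - mck_int i B).
Proof.
move=> h k l; rewrite mxeD mxeN !mck_intE /ck_int -germ_intB; apply: vanish_int.
rewrite -mulrBr -thetaB -add1n; apply: vanishM; first exact: vanish_var.
by apply: vanish_theta; have := h k l; rewrite mxeD mxeN.
Qed.

(** The unknowns are the entries of a = A_1 and b = A_2 - A_1. An iteration adds to the initial
    values t-primitives of derivatives of Z; a primitive gains one degree and has norm of order rho
    sigma, so that the ball of radius K is preserved. *)
Lemma cauchy_kovalevskaya : exists a b : 'M[G]_4,
  [/\ word_frame a b \in unitmx, mvanish (pred1 t) 1 (a - a0), mvanish (pred1 t) 1 (b - b0),
     mtheta t a = germ_var C t *: mtheta i1 (word_op a b pt)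
   & mtheta t b = germ_var C t *: (mtheta i2 (word_op a b pt) - mtheta i1 (word_op a b pt))].
Proof.
(* A matrix of the ball differs from its value at 0 by at most K + K = 1/128, one K for the initial
   value and one for the ball; 1/128 is the bound assumed in [bounded_word_op]. *)
pose K : C := 256^-1.
have K0 : 0 < K by rewrite invr_gt0 ltr0n.
have KK : K + K = 128^-1 by rewrite /K; field.
pose c0 (q : bool * ('I_4 * 'I_4)) : G := (if q.1 then b0 else a0) q.2.1 q.2.2.
pose F q := c0 q - germ_const n (c0 q 0%MM).
have hF q : vanish predT 1 (F q) by exact: vanish_sub_const.
have [r0 r0_gt0 hr] := germ_small K0 hF.
(* A positive number below both r0 and 1. *)
pose rho := r0 / (1 + r0).
have d0 : 0 < 1 + r0 by rewrite addr_gt0.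
have rho0 : 0 < rho by rewrite divr_gt0.
have rho_r : rho <= r0 by rewrite ler_pdivrMr // ler_peMr ?lerDl // ltW.
have rho1 : rho <= 1 by rewrite ler_pdivrMr // mul1r lerDr.
(* The entries of Z have norm at most 128, so two primitives together have norm at most 256 rho
   sigma = rho K <= K. *)
pose sigma : C := K * K.
have sigma0 : 0 < sigma by rewrite mulr_gt0.
have K1 : K <= 1 by rewrite invf_le1 ?ler1n ?ltr0n.
have sigma1 : sigma <= 1 by rewrite mulr_ile1 ?(ltW K0).
have hw := ck_weightP t rho0 sigma0 sigma1; set w := ck_weight _ _ _ in hw.
have hc0 q : bounded w K (F q).
  apply: (hr rho) => // m; first exact/ltW/(weight_gt0 hw).
  exact: ck_weight_le.
pose ma (x : bool * ('I_4 * 'I_4) -> G) : 'M[G]_4 := \matrix_(i, j) x (false, (i, j)).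
pose mb (x : bool * ('I_4 * 'I_4) -> G) : 'M[G]_4 := \matrix_(i, j) x (true, (i, j)).
pose Z x := word_op (ma x) (mb x) pt.
pose Psi x q := if q.1 then b0 q.2.1 q.2.2 + (mck_int i2 (Z x) - mck_int i1 (Z x)) q.2.1 q.2.2
  else a0 q.2.1 q.2.2 + mck_int i1 (Z x) q.2.1 q.2.2.
pose ok x := forall q, vanish predT 1 (x q - c0 q) /\ bounded w K (x q - c0 q).
have hagree x : ok x -> agree0 (ma x) (mb x).
  move=> hx; split=> i j; rewrite mxeD mxeN mxE.
    by case: (hx (false, (i, j))).
  by case: (hx (true, (i, j))).
have hZ x : ok x -> mbounded w 128 (Z x).
  move=> hx; apply: (@bounded_word_op w 128^-1 hw) => //.
  - by rewrite invr_ge0 ler0n.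
  - exact: hagree.
  - move=> i j; rewrite mxeD mxeN !mxE.
    have -> : x (false, (i, j)) - germ_cst n (germ_at0 (a0 i j)) =
      (x (false, (i, j)) - a0 i j) + (a0 i j - germ_cst n (germ_at0 (a0 i j))) by ring.
    apply: (@boundedW _ _ _ (K + K)); first by rewrite KK.
    exact: (boundedD hw (hx (false, (i, j))).2 (hc0 (false, (i, j)))).
  move=> i j; rewrite mxeD mxeN !mxE.
  have -> : x (true, (i, j)) - germ_cst n (germ_at0 (b0 i j)) =
    (x (true, (i, j)) - b0 i j) + (b0 i j - germ_cst n (germ_at0 (b0 i j))) by ring.
  apply: (@boundedW _ _ _ (K + K)); first by rewrite KK.
  exact: (boundedD hw (hx (true, (i, j))).2 (hc0 (true, (i, j)))).
have hI x i k l : ok x -> i != t -> bounded w (rho * sigma * 128) (mck_int i (Z x) k l).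
  by move=> hx it; rewrite mck_intE; apply: bounded_ck_int => //; apply: hZ.
have rs0 : 0 <= rho * sigma * 128 by rewrite mulr_ge0 ?ler0n // ltW // mulr_gt0.
have rs : rho * sigma * 128 + rho * sigma * 128 <= K.
  have -> : rho * sigma * 128 + rho * sigma * 128 = rho * (K * (256 * K)) by rewrite /sigma; ring.
  by rewrite /K divff ?pnatr_eq0 // mulr1 ler_piMl // invr_ge0 ler0n.
have v1 i k l x : vanish predT 1 (mck_int i (Z x) k l) by exact: mvanish1_mck_int.
have [] := @germ_fixpoint C n w hw _ c0 K Psi.
- exact: ltW.
- move=> x hx [[] [i j]].
    have -> : Psi x (true, (i, j)) - c0 (true, (i, j)) = mck_int i2 (Z x) i j - mck_int i1 (Z x) i j.
      by rewrite /Psi /c0 /= addrC addKr mxeD mxeN.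
    split; first exact: vanishB.
    exact: (boundedW rs (boundedB hw (hI _ _ _ _ hx t2) (hI _ _ _ _ hx t1))).
  have -> : Psi x (false, (i, j)) - c0 (false, (i, j)) = mck_int i1 (Z x) i j.
    by rewrite /Psi /c0 /= addrC addKr.
  split=> //; apply: boundedW (hI _ _ _ _ hx t1); apply: le_trans rs.
  by rewrite lerDl.
- move=> x y N hx hy hxy.
  have hZ' : mvanish predT N.+1 (Z x - Z y).
    apply: word_op_vanish; try exact: hagree.
      by move=> i j; rewrite mxeD mxeN !mxE.
    by move=> i j; rewrite mxeD mxeN !mxE.
  have dif (c : G) (X Y : 'M[G]_4) i j : c + X i j - (c + Y i j) = (X - Y) i j.
    by rewrite mxeD mxeN; ring.
  have swap (X1 X2 Y1 Y2 : 'M[G]_4) : X2 - X1 - (Y2 - Y1) = (X2 - Y2) - (X1 - Y1) by mx_group.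
  have h1 := mck_int_contract i1 hZ'; have h2 := mck_int_contract i2 hZ'.
  move=> [[] [i j]]; rewrite /Psi; cbv beta iota delta [fst snd]; rewrite dif; last exact: h1.
  by rewrite swap; exact: mvanishB.
move=> x hx ex; exists (ma x), (mb x).
have ea : ma x = a0 + mck_int i1 (Z x).
  by apply/matrixP => i j; rewrite mxeD [LHS]mxE -ex.
have eb : mb x = b0 + (mck_int i2 (Z x) - mck_int i1 (Z x)).
  by apply/matrixP => i j; rewrite mxeD [LHS]mxE -ex.
split.
- exact/frame_unit/hagree.
- have -> : ma x - a0 = mck_int i1 (Z x) by rewrite ea addrC addKr.
  by apply: mvanish1_mck_int; rewrite /= eqxx.
- have -> : mb x - b0 = mck_int i2 (Z x) - mck_int i1 (Z x) by rewrite eb addrC addKr.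
  by apply: mvanishB; apply: mvanish1_mck_int; rewrite /= eqxx.
- have : mtheta t (a0 + mck_int i1 (Z x)) = germ_var C t *: mtheta i1 (Z x).
    by rewrite mthetaD a0t add0r mtheta_mck_int.
  by rewrite -ea.
have : mtheta t (b0 + (mck_int i2 (Z x) - mck_int i1 (Z x))) =
    germ_var C t *: (mtheta i2 (Z x) - mtheta i1 (Z x)).
  by rewrite mthetaD b0t add0r mthetaB !mtheta_mck_int -scalerBr.
by rewrite -eb.
Qed.

End CauchyKovalevskaya.

(** * Propagation of the constraints *)

Section Bracket.
Variables (R : comNzRingType) (r : nat).
Implicit Types X Y Z V : 'M[R]_r.

Definition mx_bracket X Y : 'M[R]_r := X *m Y - Y *m X.

Lemma mx_bracketMr X Y Z : mx_bracket X (Y *m Z) = mx_bracket X Y *m Z + Y *m mx_bracket X Z.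
Proof. by rewrite /mx_bracket mulmxBr mulmxBl !mulmxA; mx_group. Qed.
Lemma mx_bracketC X Y : mx_bracket Y X = - mx_bracket X Y.
Proof. by rewrite /mx_bracket opprB. Qed.
Lemma mx_bracketBl X Y Z : mx_bracket (X - Y) Z = mx_bracket X Z - mx_bracket Y Z.
Proof. by rewrite /mx_bracket mulmxBl mulmxBr; mx_group. Qed.
Lemma mx_bracketBr X Y Z : mx_bracket X (Y - Z) = mx_bracket X Y - mx_bracket X Z.
Proof. by rewrite /mx_bracket mulmxBl mulmxBr; mx_group. Qed.
Lemma mx_bracket1 X : mx_bracket X 1%:M = 0.
Proof. by rewrite /mx_bracket mulmx1 mul1mx subrr. Qed.
Lemma mx_bracketv X : mx_bracket X X = 0. Proof. exact: subrr. Qed.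
Lemma mx_bracket_eq0 X Y : mx_bracket X Y = 0 <-> X *m Y = Y *m X.
Proof. by split=> [/eqP|e]; [rewrite subr_eq0 => /eqP | rewrite /mx_bracket e subrr]. Qed.
Lemma mulmx_bracket X Y : X *m Y = Y *m X + mx_bracket X Y.
Proof. by rewrite /mx_bracket [RHS]addrC subrK. Qed.
Lemma mx_bracket_sum (I : finType) (c : I -> R) (F : I -> 'M[R]_r) X :
  mx_bracket X (\sum_i c i *: F i) = \sum_i c i *: mx_bracket X (F i).
Proof.
rewrite /mx_bracket mulmx_sumr mulmx_suml -sumrB; apply: eq_bigr => i _.
by rewrite -scalemxAr -scalemxAl -scalerBr.
Qed.

(* X2 and Xt stand for the images of X under theta_i2 and theta_t, so that these are
   properties of [euler_op] below, proved over an abstract ring. *)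
Lemma euler_leibniz X Y X2 Y2 Xt Yt V :
  (X2 *m Y + X *m Y2) *+ 2 - (Xt *m Y + X *m Yt) - (X *m Y *m V - V *m (X *m Y)) =
  (X2 *+ 2 - Xt - (X *m V - V *m X)) *m Y + X *m (Y2 *+ 2 - Yt - (Y *m V - V *m Y)).
Proof.
rewrite !mulr2n !(mulmxDl, mulmxDr, mulNmx, mulmxN) !mulmxA; mx_group.
Qed.

Lemma euler_bracket A Z EA EZ : Z *m A = A *m Z -> EZ *m A + Z *m EA = EA *m Z + A *m EZ ->
  mx_bracket (EZ - Z *+ 2) A = mx_bracket (EA - A) Z.
Proof.
move=> e e'; have {}e' : EZ *m A = EA *m Z + A *m EZ - Z *m EA by rewrite -e' addrK.
rewrite /mx_bracket !mulr2n !(mulmxDl, mulmxDr, mulNmx, mulmxN) e'.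
by rewrite e; mx_group.
Qed.

Lemma euler_cyclic (u : 'cV[R]_r) Z Z2 Zt V :
  (Z2 *+ 2 - Zt - (Z *m V - V *m Z) - Z *+ 2) *m u =
  (Z2 *m u) *+ 2 - Zt *m u + (V *m (Z *m u) - (Z *m u) *+ 2) - Z *m (V *m u).
Proof. by rewrite !mulr2n !(mulmxDl, mulmxDr, mulNmx, mulmxN) !mulmxA; mx_group. Qed.

Lemma euler_init A A0 A2 A02 Zt V : A02 *+ 2 = A0 + mx_bracket A0 V ->
  A2 *+ 2 - Zt - (A *m V - V *m A) - A =
  (A2 - A02) *+ 2 - Zt - ((A - A0) *m V - V *m (A - A0)) - (A - A0).
Proof. by move=> e; rewrite mulrnBl e /mx_bracket mulmxBl mulmxBr; mx_group. Qed.

Lemma euler_step (x : R) P2 Pt Z1 V :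
  (x *: P2) *+ 2 - (x *: Z1 + x *: Pt) - ((x *: Z1) *m V - V *m (x *: Z1)) - x *: Z1 =
  x *: (P2 *+ 2 - Pt - (Z1 *m V - V *m Z1) - Z1 *+ 2).
Proof. by rewrite !mulr2n -scalemxAl -scalemxAr; mx_group. Qed.

Lemma self_adjointM (g X Y : 'M[R]_r) : X *m Y = Y *m X ->
  (X *m Y)^T *m g - g *m (X *m Y) = Y^T *m (X^T *m g - g *m X) + (Y^T *m g - g *m Y) *m X.
Proof. by move=> e; rewrite trmx_mul e mulmxBl mulmxBr !mulmxA; mx_group. Qed.

End Bracket.

Lemma word_ind (R : comUnitRingType) (a b : 'M[R]_4) (P : 'M[R]_4 -> Prop) :
  P 1%:M -> P a -> P b -> P (a *m b) -> forall j, P (word a b j).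
Proof. by move=> ? ? ? ?; rewrite /word; case => -[|[|[|[|j]]]]. Qed.

Lemma mulmx_word_frame (R : comUnitRingType) (a b X : 'M[R]_4) i j :
  (X *m word_frame a b) i j = (X *m word a b j *m (delta_mx ord0 0 : 'cV_4)) i 0.
Proof. by rewrite mulmx_delta0 !mxE; apply: eq_bigr => k _; rewrite mxE. Qed.

Section ConstantMatrices.
Variables (C : numFieldType) (n : nat).
Local Notation G := (germ C n).

Definition cmx m p (B : 'M[C]_(m, p)) : 'M[G]_(m, p) := map_mx (@germ_cst C n) B.

Lemma theta_const i (c : C) : theta i (germ_const n c) = 0.
Proof. by rewrite /theta germ_der_const mulr0. Qed.
Lemma mtheta_cmx i m p (B : 'M_(m, p)) : mtheta i (cmx B) = 0.
Proof. by apply/matrixP => a b; rewrite !mxE theta_const. Qed.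
Lemma mlogder_cmx k i m p (B : 'M_(m, p)) : mlogder k i (cmx B) = 0.
Proof. by apply/matrixP => a b; rewrite !mxE logder_const. Qed.
Lemma cmx1 m : cmx (1%:M : 'M_m) = 1%:M.
Proof. exact: map_mx1. Qed.
Lemma cmx_delta m p i j : cmx (delta_mx i j : 'M_(m, p)) = delta_mx i j.
Proof. exact: map_delta_mx. Qed.
Lemma cmxM m p q (A : 'M_(m, p)) (B : 'M_(p, q)) : cmx (A *m B) = cmx A *m cmx B.
Proof. exact: map_mxM. Qed.

End ConstantMatrices.

Section Propagation.
Variables (C : numFieldType) (n : nat) (t i1 i2 : 'I_n).
Hypotheses (t1 : i1 != t) (t2 : i2 != t).
Local Notation G := (germ C n).
Local Notation W := (mvanish (pred1 t)).
Local Notation x_t := (germ_var C t).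

Lemma theta_var_ne (i : 'I_n) : i != t -> theta i x_t = 0.
Proof. by move=> it; rewrite /theta germ_der_var (negbTE it) mulr0. Qed.

Lemma theta_var_eq : theta t x_t = x_t.
Proof. by rewrite /theta germ_der_var eqxx mulr1. Qed.

Lemma mtheta_scale_ne (i : 'I_n) m p (X : 'M[G]_(m, p)) :
  i != t -> mtheta i (x_t *: X) = x_t *: mtheta i X.
Proof. by move=> it; rewrite mthetaZ theta_var_ne // scale0r add0r. Qed.

(* Applied to the defects of the constraints, which vanish at t = 0 and whose
   t-derivatives are again combinations of defects. *)
Lemma evolve2_eq0 m p q r (R1 X1 : 'M[G]_(m, p)) (R2 X2 : 'M[G]_(q, r)) :
  W 1 R1 -> W 1 R2 -> mtheta t R1 = x_t *: X1 -> mtheta t R2 = x_t *: X2 ->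
  (forall w, W w R1 -> W w R2 -> W w X1 /\ W w X2) -> R1 = 0 /\ R2 = 0.
Proof.
move=> h1 h2 e1 e2 h.
have hw w : W w R1 /\ W w R2.
  elim: w => [|w [ih1 ih2]]; first by split; exact: mvanish_0.
  have [hx1 hx2] := h w ih1 ih2.
  split; apply: mvanishS => // i /eqP ->; rewrite ?e1 ?e2; apply: mvanishZS => //=.
by split; apply: (@mvanish_eq0 _ _ (pred1 t)) => w; case: (hw w).
Qed.

Lemma evolve_eq0 m p (R X : 'M[G]_(m, p)) :
  W 1 R -> mtheta t R = x_t *: X -> (forall w, W w R -> W w X) -> R = 0.
Proof. by move=> h e hx; case: (evolve2_eq0 h h e e) => // w hw _; split; apply: hx. Qed.

Variables (A1 A2 A10 A20 : 'M[G]_4) (p : 'I_4 -> C).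
Local Notation B := (A2 - A1).
Local Notation w0 := (delta_mx ord0 0 : 'cV[G]_4).
Let pt : 'cV[G]_4 := \col_i germ_const n (p i).
Variable Z : 'M[G]_4.
Hypothesis Zdef : Z = word_op A1 B pt.
Hypothesis uB : word_frame A1 B \in unitmx.
Hypotheses (h1 : W 1 (A1 - A10)) (h2 : W 1 (A2 - A20)).
Hypotheses (e1 : mtheta t A1 = x_t *: mtheta i1 Z) (e2 : mtheta t A2 = x_t *: mtheta i2 Z).
Hypotheses (comm0 : A10 *m A20 = A20 *m A10) (closed0 : mtheta i1 A20 = mtheta i2 A10).

Local Notation cm := mx_bracket.

Let W_mod m q w (X Y : 'M[G]_(m, q)) : W w (X - Y) -> W w Y -> W w X.
Proof. by move=> hd hy; rewrite -(subrK Y X); apply: mvanishD. Qed.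

Let closed : mtheta i1 A2 = mtheta i2 A1.
Proof.
apply/eqP; rewrite -subr_eq0; apply/eqP.
apply: (@evolve_eq0 _ _ _ 0) => [||w _]; last exact: mvanish0.
  apply: (W_mod (Y := mtheta i1 A20 - mtheta i2 A10)).
    have -> : mtheta i1 A2 - mtheta i2 A1 - (mtheta i1 A20 - mtheta i2 A10) =
      mtheta i1 (A2 - A20) - mtheta i2 (A1 - A10) by rewrite !mthetaB; mx_group.
    by apply: mvanishB; apply: mvanish_mtheta.
  by rewrite closed0 subrr; exact: mvanish0.
rewrite mthetaB (mtheta_comm t) (mtheta_comm t) e1 e2 !mtheta_scale_ne //.
by rewrite (mtheta_comm i2) subrr scaler0.
Qed.

Let Z_w : Z *m w0 = pt.
Proof. by rewrite Zdef word_op_cyclic. Qed.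

Let cm_word w X : W w (cm X A1) -> W w (cm X A2) -> forall j, W w (cm X (word A1 B j)).
Proof.
move=> hx1 hx2 j.
have hb : W w (cm X B) by rewrite mx_bracketBr; apply: mvanishB.
apply: (@word_ind _ A1 B (fun Y => W w (cm X Y))); [|exact: hx1|exact: hb|].
  by rewrite mx_bracket1; exact: mvanish0.
by rewrite mx_bracketMr; apply: mvanishD; [apply: mvanishMr | apply: mvanishMl].
Qed.

Let cm_Z w X : W w (cm X A1) -> W w (cm X A2) -> W w (cm X Z).
Proof.
move=> hx1 hx2; rewrite Zdef /word_op mx_bracket_sum.
apply: mvanish_sum => j _; apply: mvanishZ.
exact: cm_word.
Qed.

(** By closedness the t-derivative of [A1, A2] is x_t times theta_1 [Z, A2] - theta_2 [Z, A1]. Since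
    Z is a combination of words in A1 and A2, its commutators lie in the same power of x_t as
    [A1, A2], and theta_1, theta_2 preserve this power. *)
Let comm : A1 *m A2 = A2 *m A1.
Proof.
apply/mx_bracket_eq0; apply: (@evolve_eq0 _ _ _ (mtheta i1 (cm Z A2) - mtheta i2 (cm Z A1))) => [||w hw].
- apply: (W_mod (Y := cm A10 A20)); last by rewrite (mx_bracket_eq0 _ _).2 //; exact: mvanish0.
  have -> : cm A1 A2 - cm A10 A20 = cm (A1 - A10) A2 + cm A10 (A2 - A20).
    by rewrite mx_bracketBl mx_bracketBr addrA subrK.
  apply: mvanishD; apply: mvanishB; by [apply: mvanishMr | apply: mvanishMl].
- rewrite /mx_bracket !mthetaB !mthetaM e1 e2 closed -!scalemxAl -!scalemxAr; mx_group.
apply: mvanishB; apply: mvanish_mtheta; rewrite mx_bracketC; apply: mvanishN; apply: cm_Z.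
- by rewrite mx_bracketC; apply: mvanishN.
- by rewrite mx_bracketv; exact: mvanish0.
- by rewrite mx_bracketv; exact: mvanish0.
by [].
Qed.

Let comm_Z1 : Z *m A1 = A1 *m Z.
Proof.
apply/mx_bracket_eq0; apply: (@mvanish_eq0 _ _ (pred1 t)) => w; rewrite mx_bracketC; apply: mvanishN; apply: cm_Z.
  by rewrite mx_bracketv; exact: mvanish0.
by rewrite (mx_bracket_eq0 _ _).2 //; exact: mvanish0.
Qed.

Let comm_Z2 : Z *m A2 = A2 *m Z.
Proof.
apply/mx_bracket_eq0; apply: (@mvanish_eq0 _ _ (pred1 t)) => w; rewrite mx_bracketC; apply: mvanishN; apply: cm_Z.
  by rewrite (mx_bracket_eq0 _ _).2 //; exact: mvanish0.
by rewrite mx_bracketv; exact: mvanish0.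
Qed.

(** The cyclic vector argument modulo a power of x_t: X is recovered from its values on the words
    applied to w0, and up to commutators these are words applied to X w0. *)
Let cyclicW w X : W w (X *m w0) -> W w (cm X A1) -> W w (cm X A2) -> W w X.
Proof.
move=> hx hx1 hx2; rewrite -[X](mulmxK uB); apply: mvanishMr.
move=> i j; rewrite mulmx_word_frame mulmx_bracket mulmxDl -mulmxA; apply: mvanishD.
  exact: mvanishMl.
by apply: mvanishMr; apply: cm_word.
Qed.

Lemma propagate_comm : [/\ A1 *m A2 = A2 *m A1, Z *m A1 = A1 *m Z, Z *m A2 = A2 *m Z,
  mtheta i1 A2 = mtheta i2 A1 & Z *m w0 = pt].
Proof. by []. Qed.

Let pt_theta i : mtheta i pt = 0.
Proof. by apply/matrixP => a b; rewrite !mxE theta_const. Qed.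
Let w0_theta i : mtheta i w0 = 0.
Proof. by rewrite -cmx_delta mtheta_cmx. Qed.

(** As Z w0 is constant, theta_s Z kills w0; differentiating the commutation relations bounds its
    commutators with A1 and A2 by the theta_s A_i. *)
Lemma propagate_indep s : s != t -> mtheta s A10 = 0 -> mtheta s A20 = 0 ->
  [/\ mtheta s A1 = 0, mtheta s A2 = 0 & mtheta s Z = 0].
Proof.
move=> st s1 s2.
have hZ w : W w (mtheta s A1) -> W w (mtheta s A2) -> W w (mtheta s Z).
  move=> hw1 hw2; apply: cyclicW.
  - have := congr1 (@mtheta C n s 4 1) Z_w; rewrite mthetaM w0_theta mulmx0 addr0 pt_theta => ->.
    exact: mvanish0.
  - have := congr1 (@mtheta C n s 4 4) comm_Z1; rewrite !mthetaM => e.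
    have -> : cm (mtheta s Z) A1 = cm (mtheta s A1) Z.
      by rewrite /mx_bracket; apply/eqP; rewrite subr_eq addrAC -subr_eq opprK e addrC; apply/eqP.
    by apply: mvanishB; [apply: mvanishMr | apply: mvanishMl].
  have := congr1 (@mtheta C n s 4 4) comm_Z2; rewrite !mthetaM => e.
  have -> : cm (mtheta s Z) A2 = cm (mtheta s A2) Z.
    by rewrite /mx_bracket; apply/eqP; rewrite subr_eq addrAC -subr_eq opprK e addrC; apply/eqP.
  by apply: mvanishB; [apply: mvanishMr | apply: mvanishMl].
have [r1 r2] : mtheta s A1 = 0 /\ mtheta s A2 = 0.
  apply: (@evolve2_eq0 _ _ _ _ _ (mtheta i1 (mtheta s Z)) _ (mtheta i2 (mtheta s Z))) => [||||w hw1 hw2].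
  - by rewrite -[mtheta s A1]subr0 -s1 -mthetaB; apply: mvanish_mtheta.
  - by rewrite -[mtheta s A2]subr0 -s2 -mthetaB; apply: mvanish_mtheta.
  - by rewrite mtheta_comm e1 mtheta_scale_ne // (mtheta_comm s).
  - by rewrite mtheta_comm e2 mtheta_scale_ne // (mtheta_comm s).
  by split; apply: mvanish_mtheta; apply: hZ.
split=> //; apply: (@mvanish_eq0 _ _ (pred1 t)) => w.
by apply: hZ; rewrite ?r1 ?r2; exact: mvanish0.
Qed.

Section Homogeneity.
Variable V : 'M[G]_4.
Hypotheses (V_theta : forall i, mtheta i V = 0) (V_w : V *m w0 = 0) (V_pt : V *m pt = pt *+ 2).
Hypotheses (hom1 : mtheta i2 A10 *+ 2 = A10 + cm A10 V) (hom2 : mtheta i2 A20 *+ 2 = A20 + cm A20 V).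

(* The Euler field acts by 2 q_2 d/dq_2 - t d/dt on operators, twisted by V_inf. *)
Definition euler_op (X : 'M[G]_4) := mtheta i2 X *+ 2 - mtheta t X - (X *m V - V *m X).

Let eulerM X Y : euler_op (X *m Y) = euler_op X *m Y + X *m euler_op Y.
Proof. by rewrite /euler_op !mthetaM euler_leibniz. Qed.

(** The weights fit together: Z has weight 2 because V pt = 2 pt, and the factor x_t of weight - 1
    in the evolution equations lowers it to the weight 1 of A1 and A2. *)
Lemma propagate_hom :
  [/\ euler_op A1 = A1, euler_op A2 = A2 & euler_op Z = Z *+ 2].
Proof.
have hZ w : W w (euler_op A1 - A1) -> W w (euler_op A2 - A2) -> W w (euler_op Z - Z *+ 2).
  have cmE A : Z *m A = A *m Z -> cm (euler_op Z - Z *+ 2) A = cm (euler_op A - A) Z.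
    move=> e; apply: (euler_bracket e); have := congr1 euler_op e.
    by rewrite eulerM eulerM.
  move=> hw1 hw2; apply: cyclicW.
  - have z2 : mtheta i2 Z *m w0 = 0.
      by have := congr1 (@mtheta C n i2 4 1) Z_w; rewrite mthetaM w0_theta mulmx0 addr0 pt_theta.
    have zt : mtheta t Z *m w0 = 0.
      by have := congr1 (@mtheta C n t 4 1) Z_w; rewrite mthetaM w0_theta mulmx0 addr0 pt_theta.
    rewrite /euler_op euler_cyclic z2 zt Z_w V_pt V_w mulmx0 mul0rn !subr0 add0r subrr.
    exact: mvanish0.
  - by rewrite (cmE _ comm_Z1); apply: mvanishB; [apply: mvanishMr | apply: mvanishMl].
  by rewrite (cmE _ comm_Z2); apply: mvanishB; [apply: mvanishMr | apply: mvanishMl].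
have init A A0 i : W 1 (A - A0) -> mtheta t A = x_t *: mtheta i Z ->
    mtheta i2 A0 *+ 2 = A0 + cm A0 V -> W 1 (euler_op A - A).
  move=> hA eA hA0.
  rewrite /euler_op eA (euler_init _ _ _ hA0) -mthetaB.
  rewrite mulr2n; apply: mvanishB => //; apply: mvanishB.
    apply: mvanishB; first by apply: mvanishD; apply: mvanish_mtheta.
    by apply: mvanishZS; [rewrite /= eqxx | exact: mvanish_0].
  by apply: mvanishB; [apply: mvanishMr | apply: mvanishMl].
have step A i : i != t -> mtheta t A = x_t *: mtheta i Z ->
    mtheta t (euler_op A - A) = x_t *: mtheta i (euler_op Z - Z *+ 2).
  move=> it eA.
  have hV : mtheta t (A *m V - V *m A) = mtheta t A *m V - V *m mtheta t A.
    by rewrite mthetaB !mthetaM V_theta mulmx0 mul0mx addr0 add0r.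
  have hV' : mtheta i (Z *m V - V *m Z) = mtheta i Z *m V - V *m mtheta i Z.
    by rewrite mthetaB !mthetaM V_theta mulmx0 mul0mx addr0 add0r.
  have t4 j (X1 X2 X3 X4 : 'M[G]_4) :
      mtheta j (X1 *+ 2 - X2 - X3 - X4) = mtheta j X1 *+ 2 - mtheta j X2 - mtheta j X3 - mtheta j X4.
    by rewrite mthetaB mthetaB mthetaB mulr2n mthetaD.
  have t2n j (X : 'M[G]_4) : mtheta j (X *+ 2) = mtheta j X *+ 2 by rewrite !mulr2n mthetaD.
  rewrite /euler_op !t4 t2n hV hV' (mtheta_comm t i2) eA mtheta_scale_ne //.
  rewrite mthetaZ theta_var_eq (mtheta_comm i2 i) (mtheta_comm t i).
  exact: euler_step.
have [r1 r2] : euler_op A1 - A1 = 0 /\ euler_op A2 - A2 = 0.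
  apply: (evolve2_eq0 (init _ _ _ h1 e1 hom1) (init _ _ _ h2 e2 hom2) (step _ _ t1 e1) (step _ _ t2 e2)).
  by move=> w hw1 hw2; split; apply: mvanish_mtheta; apply: hZ.
have r3 : euler_op Z - Z *+ 2 = 0.
  apply: (@mvanish_eq0 _ _ (pred1 t)) => w.
  by apply: hZ; rewrite ?r1 ?r2; exact: mvanish0.
by split; apply/eqP; rewrite -subr_eq0; apply/eqP.
Qed.

End Homogeneity.

(** A product of commuting self-adjoint operators is self-adjoint, and [comm] is already known, so
    the defect of Z is a combination of those of A1 and A2. *)
Lemma propagate_sym (g : 'M[G]_4) : (forall i, mtheta i g = 0) ->
  A10^T *m g = g *m A10 -> A20^T *m g = g *m A20 ->
  [/\ A1^T *m g = g *m A1, A2^T *m g = g *m A2 & Z^T *m g = g *m Z].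
Proof.
move=> hg s1 s2; pose sy X := X^T *m g - g *m X.
have syB X Y : sy (X - Y) = sy X - sy Y.
  have tB : (X - Y)^T = X^T - Y^T by apply/matrixP => a b; rewrite !mxE.
  by rewrite /sy tB mulmxBl mulmxBr; mx_group.
have hZ w : W w (sy A1) -> W w (sy A2) -> W w (sy Z).
  move=> hw1 hw2; have hb : W w (sy B) by rewrite syB; apply: mvanishB.
  have cB : A1 *m B = B *m A1 by rewrite mulmxBr mulmxBl comm.
  have hword j : W w (sy (word A1 B j)).
    apply: (@word_ind _ A1 B (fun Y => W w (sy Y))); [|exact: hw1|exact: hb|].
      by rewrite /sy trmx1 mul1mx mulmx1 subrr; exact: mvanish0.
    have -> : sy (A1 *m B) = B^T *m sy A1 + sy B *m A1.
      exact: self_adjointM.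
    by apply: mvanishD; [apply: mvanishMl | apply: mvanishMr].
  have -> : sy Z = \sum_j (invmx (word_frame A1 B) *m pt) j 0 *: sy (word A1 B j).
    rewrite /sy Zdef /word_op linear_sum mulmx_suml mulmx_sumr -sumrB; apply: eq_bigr => j _.
    by rewrite linearZ /= -scalemxAl -scalemxAr scalerBr.
  by apply: mvanish_sum => j _; apply: mvanishZ.
have init A A0 : W 1 (A - A0) -> A0^T *m g = g *m A0 -> W 1 (sy A).
  move=> hA sA; apply: (W_mod (Y := sy A0)); last by rewrite /sy sA subrr; exact: mvanish0.
  rewrite -syB; apply: mvanishB; last exact: mvanishMl.
  by apply: mvanishMr; apply: mvanishT.
have thT i (X : 'M[G]_4) : mtheta i X^T = (mtheta i X)^T by apply/matrixP => a b; rewrite !mxE.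
have step A i : mtheta t A = x_t *: mtheta i Z -> mtheta t (sy A) = x_t *: mtheta i (sy Z).
  have trZ (X : 'M[G]_4) : (x_t *: X)^T = x_t *: X^T by apply/matrixP => a b; rewrite !mxE.
  have sth j X : mtheta j (sy X) = sy (mtheta j X).
    by rewrite /sy mthetaB !mthetaM hg thT mulmx0 mul0mx addr0 add0r.
  by move=> eA; rewrite !sth eA /sy trZ -scalemxAl -scalemxAr scalerBr.
have [r1 r2] : sy A1 = 0 /\ sy A2 = 0.
  apply: (evolve2_eq0 (init _ _ h1 s1) (init _ _ h2 s2) (step _ _ e1) (step _ _ e2)).
  by move=> w hw1 hw2; split; apply: mvanish_mtheta; apply: hZ.
have r3 : sy Z = 0.
  apply: (@mvanish_eq0 _ _ (pred1 t)) => w.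
  by apply: hZ; rewrite ?r1 ?r2; exact: mvanish0.
by split; apply/eqP; rewrite -subr_eq0; apply/eqP.
Qed.

(** The t-derivative of A_i w0 is x_t theta_i (Z w0), and Z w0 is constant. *)
Lemma propagate_cyclic : mtheta t A10 = 0 -> mtheta t A20 = 0 ->
  A1 *m w0 = A10 *m w0 /\ A2 *m w0 = A20 *m w0.
Proof.
have key A A0 i : W 1 (A - A0) -> mtheta t A = x_t *: mtheta i Z -> mtheta t A0 = 0 ->
    A *m w0 = A0 *m w0.
  move=> hA eA hA0; apply/eqP; rewrite -subr_eq0 -mulmxBl; apply/eqP.
  apply: (@evolve_eq0 _ _ _ 0) => [||w _]; last exact: mvanish0.
    exact: mvanishMr.
  rewrite mthetaM w0_theta mulmx0 addr0 mthetaB hA0 subr0 eA -scalemxAl.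
  have := congr1 (@mtheta C n i 4 1) Z_w; rewrite mthetaM w0_theta mulmx0 addr0 pt_theta => ->.
  by [].
by move=> k1 k2; split; [exact: key h1 e1 k1 | exact: key h2 e2 k2].
Qed.

End Propagation.

(** * The system of F2 in flat coordinates *)

Section RationalIdentities.
Variable R : comNzRingType.

Definition rows4 (s : seq (seq R)) : 'M[R]_4 := \matrix_(a, b) nth 0 (nth [::] s a) b.

Variables Q u v x : R.

(* In the coordinates q_A = Q q_B, q_B = q_2 / (1 + Q) with q_1 = Q / (1 + Q)^2
   the quantum product becomes that of P^1 x P^1: in the flat frame 1, h_A, h_B, pt
   one has h_A * h_A = q_A, h_B * h_B = q_B and h_A * h_B = pt.  The vector field
   q_1 d/dq_1 corresponds to (h_A - Q h_B) / (1 - Q) and q_2 d/dq_2 to h_A + h_B.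
   Here u = 1 / (1 - Q), v = 1 / (1 + Q) and x = q_2. *)
Definition flat_A1 := let k := u * Q * (x * v) in rows4
  [:: [:: 0; k; - k; 0]; [:: u; 0; 0; - k]; [:: - (u * Q); 0; 0; k]; [:: 0; - (u * Q); u; 0]].
Definition flat_A2 := let qB := x * v in let qA := Q * qB in rows4
  [:: [:: 0; qA; qB; 0]; [:: 1; 0; 0; qB]; [:: 1; 0; 0; qA]; [:: 0; 1; 1; 0]].
Definition flat_V := rows4
  [:: [:: 0; 0; 0; 0]; [:: 0; 1; 0; 0]; [:: 0; 0; 1; 0]; [:: 0; 0; 0; 2]].
Definition flat_g := rows4
  [:: [:: 0; 0; 0; 1]; [:: 0; 0; 1; 0]; [:: 0; 1; 0; 0]; [:: 1; 0; 0; 0]].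
(** The flat frame 1, h_A, h_B, pt expressed in the basis omega. The inverse below shows that
    omega_0 = 1, omega_1 = h_A + h_B, omega_2 = pt and omega_3 = (h_A - Q h_B) / (1 - Q). *)
Definition flat_P := rows4
  [:: [:: 1; 0; 0; 0]; [:: 0; Q * v; v; 0]; [:: 0; 0; 0; 1]; [:: 0; (1 - Q) * v; - ((1 - Q) * v); 0]].
Definition flat_Pinv := rows4
  [:: [:: 1; 0; 0; 0]; [:: 0; 1; 0; u]; [:: 0; 1; 0; - (Q * u)]; [:: 0; 0; 1; 0]].

Ltac entries4 := apply/matrixP => -[[|[|[|[|//]]]] ?] -[[|[|[|[|//]]]] ?];
  rewrite !mxE ?big_ord_recl ?big_ord0 ?mxE /= ?big_ord_recl ?big_ord0 ?mxE /=.

Lemma flat_A_comm : flat_A1 *m flat_A2 = flat_A2 *m flat_A1.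
Proof. by entries4; ring. Qed.
Lemma flat_A1_sym : flat_A1^T *m flat_g = flat_g *m flat_A1.
Proof. by entries4; ring. Qed.
Lemma flat_A2_sym : flat_A2^T *m flat_g = flat_g *m flat_A2.
Proof. by entries4; ring. Qed.
(** dA is q_2 d/dq_2 applied to [flat_A1]; it is doubled because q_2 has degree 2. *)
Lemma flat_A1_hom : let k := u * Q * (x * v) in
  let dA := rows4 [:: [:: 0; k; - k; 0]; [:: 0; 0; 0; - k]; [:: 0; 0; 0; k]; [:: 0; 0; 0; 0]] in
  dA + dA = flat_A1 + mx_bracket flat_A1 flat_V.
Proof. by rewrite /mx_bracket; entries4; ring. Qed.
Lemma flat_A2_hom : let qB := x * v in let qA := Q * qB in
  let dA := rows4 [:: [:: 0; qA; qB; 0]; [:: 0; 0; 0; qB]; [:: 0; 0; 0; qA]; [:: 0; 0; 0; 0]] in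
  dA + dA = flat_A2 + mx_bracket flat_A2 flat_V.
Proof. by rewrite /mx_bracket; entries4; ring. Qed.
Lemma flat_V_pair : flat_V^T *m flat_g + flat_g *m flat_V = 2 *: flat_g.
Proof. by entries4; ring. Qed.
Lemma flat_g_sym : flat_g^T = flat_g.
Proof. by entries4. Qed.
Lemma flat_g_invol : flat_g *m flat_g = 1%:M.
Proof. by entries4; ring. Qed.

Hypotheses (hv : (1 + Q) * v = 1) (hu : (1 - Q) * u = 1).

(* c1 and c2 certify that a - b lies in the ideal generated by the two relations. *)
Lemma combine (a b c1 c2 : R) :
  a - b = c1 * ((1 + Q) * v - 1) + c2 * ((1 - Q) * u - 1) -> a = b.
Proof. by rewrite hv hu !subrr !mulr0 addr0 => /eqP; rewrite subr_eq0 => /eqP. Qed.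

Ltac solve_by c1 c2 := apply: (@combine _ _ c1 c2); ring.

Lemma flat_PPinv : flat_P *m flat_Pinv = 1%:M.
Proof.
entries4; try ring.
- solve_by (1 : R) (0 : R).
- solve_by (- Q * u + u : R) (1 : R).
Qed.

Definition F2_A2 := let q1 := Q * v ^+ 2 in rows4
  [:: [:: 0; x; 0; 0]; [:: 1; 0; 2 * q1 * x; 0]; [:: 0; 2; 0; 1]; [:: 0; 0; x * (1 - 4 * q1); 0]].
Definition F2_A1 := let q1 := Q * v ^+ 2 in rows4
  [:: [:: 0; 0; 0; Q * u ^+ 2 * x]; [:: 0; 0; q1 * x; 0]; [:: 0; 1; 0; - (2 * (Q * u ^+ 2))];
      [:: 1; 0; - (2 * q1 * x); 0]].
Definition F2_g := rows4
  [:: [:: 0; 0; 1; 0]; [:: 0; 2; 0; 1]; [:: 1; 0; 0; 0]; [:: 0; 1; 0; - (2 * (Q * u ^+ 2))]].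
Definition F2_conn := - (Q * u ^+ 2) *: rows4
  [:: [:: 0; 0; 0; 0]; [:: 0; 0; 0; 1]; [:: 0; 0; 0; 0]; [:: 0; 0; 0; - 2]].
Definition F2_V := rows4
  [:: [:: 0; 0; 0; 0]; [:: 0; 1; 0; 0]; [:: 0; 0; 2; 0]; [:: 0; 0; 0; 1]].

Lemma flat_P_A2 : flat_P *m flat_A2 = F2_A2 *m flat_P.
Proof.
symmetry; entries4; try ring.
- solve_by (- 1 : R) (0 : R).
- solve_by (1 : R) (0 : R).
- solve_by (1 : R) (0 : R).
- solve_by (- Q * v * x - v * x - x : R) (0 : R).
Qed.
Lemma flat_P_A1 : flat_P *m flat_A1 = F2_A1 *m flat_P.
Proof.
symmetry; entries4; try ring.
- solve_by (- Q * u ^+ 2 * x + u ^+ 2 * x - u * x : R) (- u * v * x + u * x : R).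
- solve_by (Q * u ^+ 2 * x - u ^+ 2 * x + u * x : R) (u * v * x - u * x : R).
- solve_by (Q * u * v * x - u * v * x + v * x : R) (v ^+ 2 * x - v * x : R).
- solve_by (2 * Q * u ^+ 2 - 2 * u ^+ 2 + u + 1 : R) (2 * u * v - 2 * u + v - 1 : R).
- solve_by (- 2 * Q * u ^+ 2 + 2 * u ^+ 2 - u : R) (- 2 * u * v + 2 * u - v : R).
- solve_by (Q * u - u : R) (- 1 : R).
- solve_by (- 2 * Q * u * v * x + 2 * u * v * x - 2 * v * x : R) (- 2 * v ^+ 2 * x + 2 * v * x : R).
Qed.
Lemma flat_P_g : flat_P^T *m F2_g *m flat_P = flat_g.
Proof.
entries4; try ring.
- solve_by (- 2 * Q ^+ 2 * u ^+ 2 * v + 6 * Q * u ^+ 2 * v - 2 * Q * u ^+ 2 - 4 * u ^+ 2 * v + 2 * u ^+ 2 + 2 * u * v - 2 * u + 2 * v : R) (4 * u * v ^+ 2 - 6 * u * v + 2 * u + 2 * v ^+ 2 - 2 * v : R).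
- solve_by (2 * Q ^+ 2 * u ^+ 2 * v - 6 * Q * u ^+ 2 * v + 2 * Q * u ^+ 2 + Q * v + 4 * u ^+ 2 * v - 2 * u ^+ 2 - 2 * u * v + 2 * u - v + 1 : R) (- 4 * u * v ^+ 2 + 6 * u * v - 2 * u - 2 * v ^+ 2 + 2 * v : R).
- solve_by (2 * Q ^+ 2 * u ^+ 2 * v - 6 * Q * u ^+ 2 * v + 2 * Q * u ^+ 2 + Q * v + 4 * u ^+ 2 * v - 2 * u ^+ 2 - 2 * u * v + 2 * u - v + 1 : R) (- 4 * u * v ^+ 2 + 6 * u * v - 2 * u - 2 * v ^+ 2 + 2 * v : R).
- solve_by (- 2 * Q ^+ 2 * u ^+ 2 * v + 6 * Q * u ^+ 2 * v - 2 * Q * u ^+ 2 - 4 * u ^+ 2 * v + 2 * u ^+ 2 + 2 * u * v - 2 * u + 2 * v : R) (4 * u * v ^+ 2 - 6 * u * v + 2 * u + 2 * v ^+ 2 - 2 * v : R).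
Qed.
Lemma flat_P_V : flat_P *m flat_V = F2_V *m flat_P.
Proof. by entries4; ring. Qed.
(** The explicit matrix is q_1 d/dq_1 applied to [flat_P]: the flat frame is parallel for the given
    connection on E. *)
Lemma flat_P_conn : let a := Q * u * v in 0 = rows4
  [:: [:: 0; 0; 0; 0]; [:: 0; a; - a; 0]; [:: 0; 0; 0; 0]; [:: 0; - (a *+ 2); a *+ 2; 0]] + F2_conn *m flat_P.
Proof.
cbv zeta; symmetry; entries4; try ring.
- solve_by (0 : R) (- (Q * u * v)).
- solve_by (0 : R) (Q * u * v).
- solve_by (0 : R) (2 * (Q * u * v)).
- solve_by (0 : R) (- (2 * (Q * u * v))).
Qed.
(** With q_1 = Q / (1 + Q)^2 the discriminant 1 - 4 q_1 is the square of (1 - Q) / (1 + Q), so that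
    its inverse is a polynomial in Q and u. *)
Lemma F2_discriminant : (1 - 4 * (Q * v ^+ 2)) * ((1 + Q) ^+ 2 * u ^+ 2) = 1.
Proof. by solve_by (- 4 * Q ^+ 2 * u ^+ 2 * v - 4 * Q * u ^+ 2 * v - 4 * Q * u ^+ 2 : R) (- Q * u + u + 1 : R). Qed.

End RationalIdentities.

Lemma map_rows4 (R S : comNzRingType) (f : {rmorphism R -> S}) (s : seq (seq R)) :
  map_mx f (rows4 s) = rows4 [seq [seq f y | y <- r] | r <- s].
Proof.
apply/matrixP => a b; rewrite !mxE; have [lt|ge] := ltnP a (size s).
  rewrite (nth_map [::]) //; have [lt'|ge'] := ltnP b (size (nth [::] s a)).
    by rewrite (nth_map 0).
  by rewrite (nth_default 0 ge') rmorph0 nth_default ?size_map.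
by rewrite (nth_default [::] ge) (nth_default [::]) ?size_map // !nth_nil rmorph0.
Qed.

Lemma map_flat_A1 (R S : comNzRingType) (f : {rmorphism R -> S}) Q u v x :
  map_mx f (flat_A1 Q u v x) = flat_A1 (f Q) (f u) (f v) (f x).
Proof. by rewrite map_rows4 /flat_A1; cbv zeta; cbn [map]; rewrite !(rmorphN, rmorphM) ?rmorph0. Qed.
Lemma map_flat_A2 (R S : comNzRingType) (f : {rmorphism R -> S}) Q v x :
  map_mx f (flat_A2 Q v x) = flat_A2 (f Q) (f v) (f x).
Proof. by rewrite map_rows4 /flat_A2; cbv zeta; cbn [map]; rewrite !rmorphM rmorph0 rmorph1. Qed.
Lemma map_flat_V (R S : comNzRingType) (f : {rmorphism R -> S}) :
  map_mx f (flat_V R) = flat_V S.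
Proof. by rewrite map_rows4; cbn [map]; rewrite rmorph0 rmorph1 rmorph_nat. Qed.
Lemma map_flat_g (R S : comNzRingType) (f : {rmorphism R -> S}) :
  map_mx f (flat_g R) = flat_g S.
Proof. by rewrite map_rows4; cbn [map]; rewrite rmorph0 rmorph1. Qed.

Lemma flat_frame0 (R : comUnitRingType) :
  word_frame (flat_A1 0 1 1 0 : 'M[R]_4) (flat_A2 0 1 0 - flat_A1 0 1 1 0) = 1%:M.
Proof.
apply/matrixP => i [[|[|[|[|//]]]] lt]; rewrite /word_frame /word mxE /=; case: i => -[|[|[|[|//]]]] ?;
  rewrite !mxE ?big_ord_recl ?big_ord0 ?mxE /= ?big_ord_recl ?big_ord0 ?mxE /=; ring.
Qed.

Lemma flat_V_cyclic (R : comNzRingType) : flat_V R *m delta_mx ord0 (0 : 'I_1) = 0.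
Proof.
apply/matrixP => i j; rewrite -colE !mxE; case: i => -[|[|[|[|//]]]] ?; by rewrite /=.
Qed.

(** * The coordinate Q with q_1 = Q / (1 + Q)^2 *)

Section MirrorMap.
Variables (C : numFieldType) (n : nat).
Local Notation G := (germ C n).

(** On the ball of radius 1 the norm of f (1 + x)^2 is at most 4 times that of f, whence the choice
    of a radius with f of norm at most 1/4. *)
Lemma mirror_exists (f : G) : f 0%MM = 0 -> exists2 Q : G, Q 0%MM = 0 & Q = f * (1 + Q) ^+ 2.
Proof.
move=> f0; have vf : vanish predT 1 f by apply/vanish1_coef.
have e0 : 0 < 4^-1 :> C by rewrite invr_gt0 ltr0n.
have [r r0 /(_ r r0 (lexx _) (fun m => r ^+ mdeg m))] := @germ_small C n unit (fun _ => f) _ e0 (fun _ => vf).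
move=> /(_ (fun m => exprn_ge0 _ (ltW r0)) (fun m => lexx _) tt) hb.
have hw := weight_geom n r0; set w := fun m : 'X_{1..n} => _ in hw hb.
have [] := @germ_fixpoint C n w hw unit (fun _ => 0) 1 (fun x _ => f * (1 + x tt) ^+ 2) => //.
- move=> x /(_ tt) [v b] _; cbv beta; rewrite subr0; split; first exact: vanishMr.
  rewrite subr0 in b.
  have b1 := boundedD hw (bounded1 hw) b.
  apply: (@boundedW _ _ _ (4^-1 * ((1 + 1) * (1 + 1)))); last first.
    by rewrite expr2; exact: (boundedM hw hb (boundedM hw b1 b1)).
  by rewrite -[1 + 1]/(2%:R) -natrM mulVf ?pnatr_eq0.
- move=> x y N _ _ hxy i; cbv beta.
  have -> : f * (1 + x tt) ^+ 2 - f * (1 + y tt) ^+ 2 = f * ((x tt - y tt) * (2 + x tt + y tt)) by ring.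
  by apply: (@vanishM _ _ _ 1 N.+1) => //; apply: vanishMr.
move=> x /(_ tt) [v _] /(_ tt) e; exists (x tt); last exact: esym.
by apply/vanish1_coef; rewrite -[x tt]subr0.
Qed.

Lemma mirror_unique (f Q Q' : G) : f 0%MM = 0 ->
  Q = f * (1 + Q) ^+ 2 -> Q' = f * (1 + Q') ^+ 2 -> Q = Q'.
Proof.
move=> /vanish1_coef f0 e e'; apply/eqP; rewrite -subr_eq0; apply/eqP.
apply: (@vanish_eq0 _ _ predT); elim=> [|N ih]; first exact: vanish_0.
have -> : Q - Q' = f * ((Q - Q') * (2 + Q + Q')) by rewrite {1}e {1}e'; ring.
by apply: (vanishM (w1 := 1)) => //; apply: vanishMr.
Qed.

Lemma mirror_der k i (f Q : G) : Q = f * (1 + Q) ^+ 2 ->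
  (1 - Q) * logder k i Q = logder k i f * (1 + Q) ^+ 3.
Proof.
move=> e; have := congr1 (logder k i) e; rewrite expr2 !logderM logderD logder1 add0r => e'.
have e2 : (1 + Q) * logder k i Q =
    logder k i f * (1 + Q) ^+ 3 + 2 * (f * (1 + Q) ^+ 2) * logder k i Q by rewrite {1}e'; ring.
have -> : (1 - Q) * logder k i Q = (1 + Q) * logder k i Q - 2 * Q * logder k i Q by ring.
by rewrite e2 -e; ring.
Qed.

Lemma logderV k i (f : G) : f \is a GRing.unit ->
  logder k i f^-1 = - (logder k i f * f^-1 ^+ 2).
Proof.
move=> uf; have := congr1 (logder k i) (divrr uf); rewrite logderM logder1.
move=> /eqP; rewrite addrC addr_eq0 => /eqP e; apply: (mulrI uf); rewrite e.
rewrite mulrN; congr (- _); move: (divrr uf); move: (f^-1) (logder k i f) => g h fg.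
by transitivity (h * g * (f * g)); [rewrite fg mulr1 | ring].
Qed.

Section Inverses.
Variable Q : G.
Hypothesis Q0 : Q 0%MM = 0.
Let germ1 : (1 : G) 0%MM = 1. Proof. by rewrite gcoef1 eqxx. Qed.

Lemma mirror_u_unit : 1 - Q \is a GRing.unit.
Proof. by rewrite germ_unitE gcoefB germ1 Q0 subr0 oner_neq0. Qed.
Lemma mirror_v_unit : 1 + Q \is a GRing.unit.
Proof. by rewrite germ_unitE gcoefD germ1 Q0 addr0 oner_neq0. Qed.
Lemma mirror_hu : (1 - Q) * (1 - Q)^-1 = 1. Proof. exact: divrr mirror_u_unit. Qed.
Lemma mirror_hv : (1 + Q) * (1 + Q)^-1 = 1. Proof. exact: divrr mirror_v_unit. Qed.

Lemma mirror_inv f : Q = f * (1 + Q) ^+ 2 -> f = Q * (1 + Q)^-1 ^+ 2.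
Proof. by move=> e; rewrite {1}e -mulrA -exprMn mirror_hv expr1n mulr1. Qed.

Lemma logder_v k i : logder k i (1 + Q)^-1 = - (logder k i Q * (1 + Q)^-1 ^+ 2).
Proof. by rewrite (logderV _ _ mirror_v_unit) logderD logder1 add0r. Qed.
Lemma logder_u k i : logder k i (1 - Q)^-1 = logder k i Q * (1 - Q)^-1 ^+ 2.
Proof. by rewrite (logderV _ _ mirror_u_unit) logderB logder1 sub0r mulNr opprK. Qed.

End Inverses.

End MirrorMap.

Section F2Frame.
Variable C : numFieldType.
Local Notation G := (germ C 2).
Local Notation i0 := (ord0 : 'I_2).
Local Notation i1 := (ord_max : 'I_2).
Local Notation q1 := (germ_var C i0).
Local Notation q2 := (germ_var C i1).
Variable Q : G.
Hypotheses (Q0 : Q 0%MM = 0) (hQ : Q = q1 * (1 + Q) ^+ 2).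
Local Notation u := ((1 - Q)^-1).
Local Notation v := ((1 + Q)^-1).

Let u_unit := mirror_u_unit Q0.
Let hu := mirror_hu Q0.
Let hv := mirror_hv Q0.
Let mirror_q1 : q1 = Q * v ^+ 2 := mirror_inv Q0 hQ.

Definition F2_flat : qds_data C 2 4 := QdsData (fun _ => 0)
  (fun i => if i == i0 then - flat_A1 Q u v q2 else - flat_A2 Q v q2)
  (2 *: flat_A2 Q v q2) (flat_V _) (flat_g _).

Let disc_inv : (1 - 4 * q1)^-1 = (1 + Q) ^+ 2 * u ^+ 2.
Proof.
have e := F2_discriminant hv hu; rewrite -mirror_q1 in e.
have un : 1 - 4 * q1 \is a GRing.unit by apply/unitrP; eexists; split; [rewrite mulrC|]; exact: e.
by apply: (mulrI un); rewrite divrr ?e.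
Qed.

Let disc_inv' : (4 * q1 - 1)^-1 = - ((1 + Q) ^+ 2 * u ^+ 2).
Proof. by rewrite -opprB invrN disc_inv. Qed.

Let frac1 : q1 * (1 - 4 * q1)^-1 = Q * u ^+ 2.
Proof. by rewrite disc_inv mulrA -hQ. Qed.
Let frac2 : q1 * (4 * q1 - 1)^-1 = - (Q * u ^+ 2).
Proof. by rewrite disc_inv' mulrN -disc_inv frac1. Qed.

Lemma F2_A1E : F2_q1 C = F2_A1 Q u v q2.
Proof.
rewrite /F2_q1 /F2_A1 /mx_of_rows /rows4.
have -> : q1 * q2 / (1 - 4 * q1) = Q * u ^+ 2 * q2 by rewrite mulrAC frac1.
have -> : 2 * q1 / (4 * q1 - 1) = - (2 * (Q * u ^+ 2)) by rewrite -mulrA frac2 mulrN.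
by rewrite {1 2}mirror_q1.
Qed.
Lemma F2_A2E : F2_q2 C = F2_A2 Q v q2.
Proof. by rewrite /F2_q2 /F2_A2 /mx_of_rows /rows4 {1 2}mirror_q1. Qed.
Lemma F2_tauE : F2_tau C = 2 *: F2_A2 Q v q2.
Proof.
rewrite -F2_A2E; apply/matrixP => -[[|[|[|[|//]]]] ?] -[[|[|[|[|//]]]] ?]; rewrite !mxE [nth]lock /= -lock; cbn [nth nat_of_ord]; ring.
Qed.
Lemma F2_gE : F2_pair C = F2_g Q u.
Proof.
rewrite /F2_pair /F2_g /mx_of_rows /rows4.
by have -> : 2 * q1 / (4 * q1 - 1) = - (2 * (Q * u ^+ 2)) by rewrite -mulrA frac2 mulrN.
Qed.
Lemma F2_connE : F2_q1_conn C = F2_conn Q u.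
Proof. by rewrite /F2_q1_conn frac2. Qed.

Lemma logder_mirror : logder 2 i0 Q = Q * (1 + Q) * u.
Proof.
apply: (mulrI u_unit); rewrite (mirror_der _ _ hQ) logder_var eqxx mul1r /=.
transitivity (q1 * (1 + Q) ^+ 2 * (1 + Q) * ((1 - Q) * u)); last by rewrite -hQ; ring.
by rewrite hu; ring.
Qed.
Lemma logder_mirror1 : logder 2 i1 Q = 0.
Proof.
by apply: (mulrI u_unit); rewrite (mirror_der _ _ hQ) logder_var mulr0 !mul0r.
Qed.

Let dQ := logder_mirror.
Let dQ1 := logder_mirror1.
Let dq2 : logder 2 i0 q2 = 0.
Proof. by rewrite logder_var mul0r. Qed.
Let dq22 : logder 2 i1 q2 = q2.
Proof. by rewrite logder_var eqxx mul1r. Qed.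

Lemma I2_cases (P : 'I_2 -> Prop) : P i0 -> P i1 -> forall i, P i.
Proof.
move=> p0 p1 [[|[|//]] lt]; [move: p0 | move: p1]; congr P; exact: val_inj.
Qed.

Let dmxE i (s : seq (seq G)) : mlogder 2 i (rows4 s) = rows4 [seq [seq logder 2 i y | y <- r] | r <- s].
Proof.
apply/matrixP => a b; rewrite !mxE; have [lt|ge] := ltnP a (size s).
  rewrite (nth_map [::]) //; have [lt'|ge'] := ltnP b (size (nth [::] s a)).
    by rewrite (nth_map 0).
  by rewrite (nth_default 0 ge') logder0 nth_default ?size_map.
by rewrite (nth_default [::] ge) (nth_default [::]) ?size_map // nth_nil logder0.
Qed.

Let d0v : logder 2 i0 v = - (u * Q * v).
Proof.
rewrite logder_v // dQ; congr (- _); transitivity (u * Q * v * ((1 + Q) * v)); last by rewrite hv mulr1.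
by ring.
Qed.
Let d1v : logder 2 i1 v = 0. Proof. by rewrite logder_v // dQ1 mul0r oppr0. Qed.
Let d1u : logder 2 i1 u = 0. Proof. by rewrite logder_u // dQ1 mul0r. Qed.

Local Notation qB := (q2 * v).
Local Notation kk := (u * Q * (q2 * v)).

Let d0qB : logder 2 i0 qB = - kk.
Proof. by rewrite logderM dq2 d0v; ring. Qed.
Let d1qB : logder 2 i1 qB = qB.
Proof. by rewrite logderM dq22 d1v mulr0 addr0. Qed.
Let d0qA : logder 2 i0 (Q * qB) = kk.
Proof. by rewrite logderM d0qB dQ; ring. Qed.
Let d1qA : logder 2 i1 (Q * qB) = Q * qB.
Proof. by rewrite logderM d1qB dQ1 mul0r add0r. Qed.
Let d1k : logder 2 i1 kk = kk.
Proof. by rewrite logderM d1qB logderM d1u dQ1 mulr0 mul0r addr0 mul0r add0r. Qed.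
Let d1uQ : logder 2 i1 (u * Q) = 0.
Proof. by rewrite logderM d1u dQ1 mulr0 mul0r addr0. Qed.

Lemma F2_flat_closed : mlogder 2 i0 (flat_A2 Q v q2) = mlogder 2 i1 (flat_A1 Q u v q2).
Proof.
rewrite !dmxE; cbn [map].
by rewrite !logderN d0qA d0qB d1k d1uQ d1u !logder0 !logder1 oppr0.
Qed.

Lemma F2_flat_hom1 : mlogder 2 i1 (flat_A1 Q u v q2) *+ 2 =
  flat_A1 Q u v q2 + mx_bracket (flat_A1 Q u v q2) (flat_V G).
Proof.
rewrite -flat_A1_hom mulr2n dmxE; cbn [map].
by rewrite !logderN d1k d1uQ d1u !logder0 oppr0.
Qed.

Lemma F2_flat_hom2 : mlogder 2 i1 (flat_A2 Q v q2) *+ 2 =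
  flat_A2 Q v q2 + mx_bracket (flat_A2 Q v q2) (flat_V G).
Proof.
rewrite -flat_A2_hom mulr2n dmxE; cbn [map].
by rewrite d1qA d1qB !logder0 !logder1.
Qed.

Let d0Qv : logder 2 i0 (Q * v) = Q * u * v.
Proof.
rewrite logderM d0v dQ; transitivity (Q * u * (v + (Q * v - Q * v))); last by rewrite subrr addr0.
by ring.
Qed.
Let d0s : logder 2 i0 ((1 - Q) * v) = - (Q * u * v *+ 2).
Proof.
rewrite mulrBl mul1r logderB d0v d0Qv; ring.
Qed.
Let d1s : logder 2 i1 ((1 - Q) * v) = 0.
Proof. by rewrite logderM d1v logderB logder1 dQ1 subrr mul0r mulr0 addr0. Qed.
Let d1Qv : logder 2 i1 (Q * v) = 0.
Proof. by rewrite logderM d1v dQ1 mul0r mulr0 addr0. Qed.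

Lemma F2_flat_P_unit : flat_P Q v \in unitmx.
Proof. exact: (proj1 (mulmx1_unit (flat_PPinv hv hu))). Qed.

Lemma F2_flat_iso : qds_iso 2 F2_flat (F2_qds C) (flat_P Q v).
Proof.
apply/qds_isoE; split.
- exact: F2_flat_P_unit.
- apply: I2_cases; rewrite /= mulmx0.
    rewrite F2_connE dmxE; cbn [map].
    rewrite logderN d0Qv d0v d0s !logder0 !logder1 (mulrC u Q) opprK.
    exact: flat_P_conn.
  rewrite mul0mx addr0 dmxE; cbn [map].
  rewrite logderN d1Qv d1v d1s !logder0 !logder1 oppr0.
  by apply/matrixP => a b; rewrite !mxE; case: a b => [[|[|[|[|//]]]] ?] [[|[|[|[|//]]]] ?].
- apply: I2_cases; rewrite /= mulmxN mulNmx; congr (- _).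
    by rewrite F2_A1E; exact: (flat_P_A1 _ hv hu).
  by rewrite F2_A2E; exact: (flat_P_A2 _ hv hu).
- split; last exact: flat_P_V.
  by rewrite /= F2_tauE -scalemxAr -scalemxAl (flat_P_A2 _ hv hu).
by rewrite /= F2_gE; exact: (flat_P_g hv hu).
Qed.

End F2Frame.

(** * The unfolding *)

Section SubstitutionOfConstants.
Variables (C : numFieldType) (n : nat).

Lemma msub_cmx p (phi : 'I_n -> germ C p) (phi0 : forall i, phi i 0%MM = 0) m q (B : 'M[C]_(m, q)) :
  msub phi (cmx n B) = cmx p B.
Proof. by apply/matrixP => a b; rewrite !mxE; exact: subst_const. Qed.

Lemma cmxT m q (B : 'M[C]_(m, q)) : cmx n B^T = (cmx n B)^T.
Proof. by apply/matrixP => a b; rewrite !mxE. Qed.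

End SubstitutionOfConstants.

Section ExtensionMorphism.
Variables (C : numFieldType) (n l : nat).

Let ev0 (i : 'I_n) : germ_var C (lshift l i) 0%MM = 0. Proof. exact: gvar0. Qed.

Lemma mextM m p q (A : 'M_(m, p)) (B : 'M_(p, q)) : @mext C n l m q (A *m B) = mext l A *m mext l B.
Proof. exact: msubM. Qed.
Lemma mextD m p (A B : 'M_(m, p)) : @mext C n l m p (A + B) = mext l A + mext l B.
Proof. exact: msubD. Qed.
Lemma mextB m p (A B : 'M_(m, p)) : @mext C n l m p (A - B) = mext l A - mext l B.
Proof. exact: msubB. Qed.
Lemma mextT m p (A : 'M_(m, p)) : @mext C n l p m A^T = (mext l A)^T.
Proof. exact: msubT. Qed.
Lemma mext_cmx m p (B : 'M[C]_(m, p)) : mext l (cmx n B) = cmx (n + l) B.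
Proof. exact: msub_cmx. Qed.

Lemma at0_mext m p (A : 'M[germ C n]_(m, p)) :
  map_mx (@germ_at0 C (n + l)) (mext l A) = map_mx (@germ_at0 C n) A.
Proof. by apply/matrixP => a b; rewrite !mxE /germ_at0; exact: subst_coef0. Qed.

End ExtensionMorphism.

Lemma flat_V_point (R : comNzRingType) :
  flat_V R *m delta_mx ord_max (0 : 'I_1) = delta_mx ord_max 0 *+ 2.
Proof.
by rewrite mulr2n; apply/matrixP => i j; rewrite -colE !mxE (ord1 j); case: i => -[|[|[|[|//]]]] ? /=; ring.
Qed.

Lemma self_adjoint_comb (R : comNzRingType) r (g X Y : 'M[R]_r) a b c :
  X^T *m g = g *m X -> Y^T *m g = g *m Y ->
  (a *: X + b *: 1%:M - c *: Y)^T *m g = g *m (a *: X + b *: 1%:M - c *: Y).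
Proof.
move=> hX hY; have -> : (a *: X + b *: 1%:M - c *: Y)^T = a *: X^T + b *: 1%:M - c *: Y^T.
  by apply/matrixP => i j; rewrite !mxE eq_sym.
rewrite !(mulmxDl, mulNmx) -!scalemxAl hX hY mul1mx.
by rewrite !(mulmxDr, mulmxN) -!scalemxAr mulmx1.
Qed.

Lemma I22_cases (P : 'I_(2 + 2) -> Prop) :
  P (lshift 2 ord0) -> P (lshift 2 ord_max) -> P (rshift 2 ord0) -> P (rshift 2 ord_max) -> forall a, P a.
Proof.
by move=> h1 h2 hs ht a; case: (split_ordP a) => i ->; move: i; apply: I2_cases.
Qed.

Section PotentialData.
Variable C : numFieldType.
Local Notation G := (germ C (2 + 2)).
Local Notation p1 := (lshift 2 ord0 : 'I_(2 + 2)).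
Local Notation p2 := (lshift 2 ord_max : 'I_(2 + 2)).
Local Notation ps := (rshift 2 ord0 : 'I_(2 + 2)).
Local Notation pt := (rshift 2 ord_max : 'I_(2 + 2)).
Local Notation d := (mlogder 2).
Variables (A1 A2 Z : 'M[G]_4) (V0 g0 : 'M[C]_4).
Local Notation V := (cmx (2 + 2) V0).
Local Notation g := (cmx (2 + 2) g0).

(* A1, A2, 1 and Z are the products with q_1 d/dq_1, q_2 d/dq_2, d/ds and d/dt, where
   s, t are the parameters; V0 is the product with the Euler field
   2 q_2 d/dq_2 + s d/ds - t d/dt. *)
Definition unfolded_qds : qds_data C (2 + 2) 4 := QdsData (fun _ => 0)
  (fun a => - nth 0 [:: A1; A2; 1%:M; Z] a)
  (2 *: A2 + germ_var C ps *: 1%:M - germ_var C pt *: Z) V g.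

Hypotheses (c12 : A1 *m A2 = A2 *m A1) (c1 : Z *m A1 = A1 *m Z) (c2 : Z *m A2 = A2 *m Z).
Hypotheses (cl : mtheta p1 A2 = mtheta p2 A1).
Hypotheses (e1 : mtheta pt A1 = germ_var C pt *: mtheta p1 Z)
  (e2 : mtheta pt A2 = germ_var C pt *: mtheta p2 Z).
Hypotheses (s1 : mtheta ps A1 = 0) (s2 : mtheta ps A2 = 0) (s3 : mtheta ps Z = 0).
Hypotheses (h1 : euler_op pt p2 V A1 = A1) (h2 : euler_op pt p2 V A2 = A2)
  (h3 : euler_op pt p2 V Z = Z *+ 2).
Hypotheses (y1 : A1^T *m g = g *m A1) (y2 : A2^T *m g = g *m A2) (y3 : Z^T *m g = g *m Z).
Hypotheses (Vg : V0^T *m g0 + g0 *m V0 = 2 *: g0) (gT : g0^T = g0) (gg : g0 *m g0 = 1%:M).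

Let dp i m q (A : 'M[G]_(m, q)) : d (lshift 2 i) A = mtheta (lshift 2 i) A.
Proof.
have h : (lshift 2 i < 2)%N by exact: ltn_ord i.
by rewrite (@mtheta_mlogder _ _ 2) h scale1r.
Qed.
Let dr i m q (A : 'M[G]_(m, q)) : germ_var C (rshift 2 i) *: d (rshift 2 i) A = mtheta (rshift 2 i) A.
Proof. by rewrite (@mtheta_mlogder _ _ 2). Qed.

Let ds0 m q (A : 'M[G]_(m, q)) : mtheta ps A = 0 -> d ps A = 0.
Proof. by move=> h; apply: (@map_mx_scaleI _ _ ps); rewrite dr h scaler0. Qed.
Let dt1 : d pt A1 = mtheta p1 Z. Proof. by apply: (@map_mx_scaleI _ _ pt); rewrite dr. Qed.
Let dt2 : d pt A2 = mtheta p2 Z. Proof. by apply: (@map_mx_scaleI _ _ pt); rewrite dr. Qed.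
Let ds1 := ds0 s1.
Let ds2 := ds0 s2.
Let dsZ := ds0 s3.
Let d1 a : d a (1%:M : 'M[G]_4) = 0. Proof. by rewrite -cmx1 mlogder_cmx. Qed.
Let dvs a : logder 2 a (germ_var C ps) = (a == ps)%:R.
Proof.
rewrite logder_var; case: eqP => [->|_]; last exact: mul0r.
by rewrite mul1r.
Qed.
Let dvt a : logder 2 a (germ_var C pt) = (a == pt)%:R.
Proof.
rewrite logder_var; case: eqP => [->|_]; last exact: mul0r.
by rewrite mul1r.
Qed.

Let euler_opE (X : 'M[G]_4) : mtheta p2 X *+ 2 - mtheta pt X = euler_op pt p2 V X + mx_bracket X V.
Proof. by rewrite /euler_op /mx_bracket subrK. Qed.

(** Closedness and the evolution equations turn every derivative of V0 into 2 theta_2 - theta_t of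
    the corresponding product, to which homogeneity applies. Differentiating the coefficient s
    contributes the product with the unit; differentiating - t lowers the weight of Z from 2 to
    1. *)
Let dV0 a : d a (qds_V0 unfolded_qds) = nth 0 [:: A1; A2; 1%:M; Z] a +
  mx_bracket (nth 0 [:: A1; A2; 1%:M; Z] a) V.
Proof.
cbn [qds_V0 unfolded_qds]; rewrite mlogderB mlogderD !mlogderZ d1 scaler0 addr0 dvs dvt logder_nat scale0r add0r.
have two (X : 'M[G]_4) : 2 *: X = X *+ 2 by rewrite scaler_nat.
move: a; apply: I22_cases.
- rewrite (_ : (p1 == ps) = false) // (_ : (p1 == pt) = false) // !scale0r addr0 add0r two !dp cl -e1 euler_opE.
  by rewrite h1.
- rewrite (_ : (p2 == ps) = false) // (_ : (p2 == pt) = false) // !scale0r addr0 add0r two !dp -e2 euler_opE.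
  by rewrite h2.
- rewrite eqxx (_ : (ps == pt) = false) // ds2 dsZ !scaler0 scale0r !add0r subr0 scale1r /=.
  by rewrite mx_bracketC mx_bracket1 oppr0 addr0.
rewrite eqxx (_ : (pt == ps) = false) // scale0r addr0 scale1r dt2 dr two.
rewrite opprD addrCA addrC euler_opE h3 mulr2n -/Z /=.
by rewrite addrAC addrK.
Qed.

Lemma unfolded_qds_flat : flat_qds 2 unfolded_qds 2.
Proof.
split.
- by [].
- by apply: I22_cases; apply: I22_cases; rewrite /= !(mulNmx, mulmxN) ?mul1mx ?mulmx1 ?c12 ?c1 ?c2.
- apply: I22_cases; apply: I22_cases; cbn [qds_higgs unfolded_qds];
  by rewrite !mlogderN /= ?d1 ?ds1 ?ds2 ?dsZ ?dt1 ?dt2 ?dp ?cl.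
- apply: I22_cases; rewrite /= !(mulNmx, mulmxN); congr (- _);
  by rewrite !(mulmxDl, mulmxDr, mulNmx, mulmxN) -!scalemxAl -!scalemxAr ?mulmx1 ?mul1mx ?c12 ?c1 ?c2.
- move=> a; cbn [qds_higgs qds_V0 qds_Vinf unfolded_qds]; rewrite dV0 /mx_bracket mulNmx mulmxN.
  by move: (nth _ _ _) (_ *m _) (_ *m _) => W X Y; mx_group.
- by move=> i; exact: mlogder_cmx.
- by move=> i; exact: mlogder_cmx.
- by apply: I22_cases; rewrite /= linearN /= mulNmx mulmxN ?trmx1 ?mul1mx ?mulmx1 ?y1 ?y2 ?y3.
- exact: self_adjoint_comb.
- rewrite /= -cmxT -!cmxM -map_mxD Vg; apply/matrixP => a b.
  rewrite !mxE; transitivity (germ_const (2 + 2) (2 : C) * germ_const (2 + 2) (g0 a b)).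
    exact: germ_constM.
  by rewrite germ_constMn.
- by rewrite /= -cmxT gT.
by apply: (proj1 (mulmx1_unit (B := g) _)); rewrite -cmxM gg cmx1.
Qed.

End PotentialData.

Section Unfolding.
Variable C : numFieldType.
Local Notation i0 := (ord0 : 'I_2).
Local Notation i1 := (ord_max : 'I_2).
Local Notation G := (germ C (2 + 2)).
Local Notation p1 := (lshift 2 i0 : 'I_(2 + 2)).
Local Notation p2 := (lshift 2 i1 : 'I_(2 + 2)).
Local Notation ps := (rshift 2 i0 : 'I_(2 + 2)).
Local Notation pt := (rshift 2 i1 : 'I_(2 + 2)).
Local Notation q2 := (germ_var C i1).
Variable Q : germ C 2.
Hypotheses (Q0 : Q 0%MM = 0) (hQ : Q = germ_var C i0 * (1 + Q) ^+ 2).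
Local Notation u := ((1 - Q)^-1).
Local Notation v := ((1 + Q)^-1).
Local Notation fA1 := (flat_A1 Q u v q2).
Local Notation fA2 := (flat_A2 Q v q2).
Local Notation w0 := (delta_mx ord0 0 : 'cV[G]_4).
Local Notation wp := (delta_mx ord_max 0 : 'cV[G]_4).

Lemma F2_flat_data_at0 : [/\ germ_at0 Q = 0, germ_at0 u = 1, germ_at0 v = 1 & germ_at0 q2 = 0].
Proof.
have e1 : (1 : germ C 2) 0%MM = 1 by rewrite gcoef1 eqxx.
split; [exact: Q0 | | | exact: gvar0].
  have := congr1 (fun f : germ C 2 => f 0%MM) (mirror_hu Q0).
  by rewrite gcoefM0 gcoefB !e1 Q0 subr0 mul1r.
have := congr1 (fun f : germ C 2 => f 0%MM) (mirror_hv Q0).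
by rewrite gcoefM0 gcoefD !e1 Q0 addr0 mul1r.
Qed.

Lemma flat_A1_at0 : map_mx (@germ_at0 C 2) fA1 = flat_A1 0 1 1 0.
Proof. by rewrite map_flat_A1; have [eQ eu ev eq] := F2_flat_data_at0; congr flat_A1. Qed.
Lemma flat_A2_at0 : map_mx (@germ_at0 C 2) fA2 = flat_A2 0 1 0.
Proof. by rewrite map_flat_A2; have [eQ eu ev eq] := F2_flat_data_at0; congr flat_A2. Qed.

Lemma flat_entries_le1 : forall i j : 'I_4,
  `|(flat_A1 0 1 1 0 : 'M[C]_4) i j| <= 1 /\ `|(flat_A2 0 1 0 - flat_A1 0 1 1 0 : 'M[C]_4) i j| <= 1.
Proof.
move=> [[|[|[|[|//]]]] ?] [[|[|[|[|//]]]] ?]; rewrite !mxE /= ?(mulr0, mul0r, oppr0, subr0, subrr);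
  by rewrite ?normr0 ?normr1 ?ler01 ?lexx.
Qed.

(** Besides the equations and the restriction, only the values of Phi and Vinf on w0 are recorded:
    the period map and the universality are derived from these. *)
Lemma F2_unfolding_exists : exists T : qds_data C (2 + 2) 4,
  [/\ flat_qds 2 T 2, qds_restr T = F2_flat Q, qds_Vinf T *m w0 = 0
    & [/\ qds_higgs T p1 *m w0 = - (mext 2 fA1 *m w0), qds_higgs T p2 *m w0 = - (mext 2 fA2 *m w0),
          qds_higgs T ps *m w0 = - w0 & qds_higgs T pt *m w0 = - wp]].
Proof.
pose a0 := mext 2 fA1; pose b0 := mext 2 fA2 - mext 2 fA1.
have [hu hv] : (1 - Q) * u = 1 /\ (1 + Q) * v = 1 by split; [exact: mirror_hu | exact: mirror_hv].
pose p (i : 'I_4) : C := (i == ord_max)%:R.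
have at0_a0 : map_mx (@germ_at0 C (2 + 2)) a0 = flat_A1 0 1 1 0 by rewrite at0_mext flat_A1_at0.
have at0_b0 : map_mx (@germ_at0 C (2 + 2)) b0 = flat_A2 0 1 0 - flat_A1 0 1 1 0.
  by rewrite map_mxB !at0_mext flat_A1_at0 flat_A2_at0.
have pst : params 2 2 pt by exact: params_rshift.
have pss : params 2 2 ps by exact: params_rshift.
have ext_t (A : 'M[germ C 2]_4) : mtheta pt (mext 2 A) = 0 by exact: mext_mtheta_params.
have ext_s (A : 'M[germ C 2]_4) : mtheta ps (mext 2 A) = 0 by exact: mext_mtheta_params.
have [] := @cauchy_kovalevskaya C (2 + 2) pt p1 p2 _ _ a0 b0 p => //.
- exact: ext_t.
- by rewrite mthetaB !ext_t subrr.
- move=> i j; have := (flat_entries_le1 i j).1.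
  by rewrite -at0_a0 mxE.
- move=> i j; have := (flat_entries_le1 i j).2.
  by rewrite -at0_b0 mxE.
- rewrite (bigD1 ord_max) //= /p eqxx normr1 big1 ?addr0 // => i /negbTE ->.
  by rewrite normr0.
- by rewrite -map_word_frame at0_a0 at0_b0 flat_frame0.
set Pt := \col_i germ_const (2 + 2) (p i) => A1 [b [uB ha hb ea eb]].
pose A2 := A1 + b; pose Z := word_op A1 b Pt.
have ebA : b = A2 - A1 by rewrite /A2 addrC addKr.
have ePt : Pt = wp.
  by apply/matrixP => i j; rewrite !mxE (ord1 j) eqxx andbT /p germ_constMn.
have h2 : mvanish (pred1 pt) 1 (A2 - mext 2 fA2).
  have -> : A2 - mext 2 fA2 = (A1 - a0) + (b - b0) by rewrite /A2 /a0 /b0; mx_group.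
  exact: mvanishD.
have e2 : mtheta pt A2 = germ_var C pt *: mtheta p2 Z.
  by rewrite mthetaD ea eb -scalerDr /Z; congr (_ *: _); rewrite addrC subrK.
have ev0 i : germ_var C (lshift 2 i) 0%MM = 0 :> C by exact: gvar0.
have Zdef : Z = word_op A1 (A2 - A1) (\col_i germ_const (2 + 2) (p i)) by rewrite -ebA.
have uA : word_frame A1 (A2 - A1) \in unitmx by rewrite -ebA.
have comm0 : mext 2 fA1 *m mext 2 fA2 = mext 2 fA2 *m mext 2 fA1.
  by rewrite -!mextM flat_A_comm.
have low i (A : 'M[germ C 2]_4) : mtheta (lshift 2 i) (mext 2 A) = mext 2 (mlogder 2 i A).
  have h : (lshift 2 i < 2)%N by exact: ltn_ord i.
  by rewrite (@mtheta_mlogder _ _ 2) h scale1r mext_mlogder.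
have closed0 : mtheta p1 (mext 2 fA2) = mtheta p2 (mext 2 fA1).
  by rewrite !low F2_flat_closed.
pose V := cmx (2 + 2) (flat_V C); pose g := cmx (2 + 2) (flat_g C).
have eV : V = mext 2 (flat_V _).
  by rewrite -(map_flat_V (@germ_cst C 2)); exact: (esym (mext_cmx _ _ _)).
have eg : g = mext 2 (flat_g _).
  by rewrite -(map_flat_g (@germ_cst C 2)); exact: (esym (mext_cmx _ _ _)).
have Vw : V *m w0 = 0 by rewrite -cmx_delta -cmxM flat_V_cyclic; exact: map_mx0.
have Vp : V *m wp = wp *+ 2.
  by rewrite -cmx_delta -cmxM flat_V_point /cmx raddfMn.
have bra (X Y : 'M[germ C 2]_4) : mx_bracket (mext 2 X) (mext 2 Y) = mext 2 (mx_bracket X Y).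
  by rewrite /mx_bracket mextB !mextM.
have hom1 : mtheta p2 (mext 2 fA1) *+ 2 = mext 2 fA1 + mx_bracket (mext 2 fA1) V.
  by rewrite low eV bra -mextD -F2_flat_hom1 // !mulr2n mextD.
have hom2 : mtheta p2 (mext 2 fA2) *+ 2 = mext 2 fA2 + mx_bracket (mext 2 fA2) V.
  by rewrite low eV bra -mextD -F2_flat_hom2 // !mulr2n mextD.
have sym1 : (mext 2 fA1)^T *m g = g *m mext 2 fA1.
  by rewrite eg -mextT -!mextM flat_A1_sym.
have sym2 : (mext 2 fA2)^T *m g = g *m mext 2 fA2.
  by rewrite eg -mextT -!mextM flat_A2_sym.
have p1t : p1 != pt by [].
have p2t : p2 != pt by [].
have pst' : ps != pt by [].
have [c12 c1 c2 cl Zw] := propagate_comm p1t p2t Zdef uA ha h2 ea e2 comm0 closed0.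
have [s1 s2 s3] := propagate_indep p1t p2t Zdef uA ha h2 ea e2 comm0 closed0 pst' (ext_s _) (ext_s _).
have Vt i : mtheta i V = 0 by exact: mtheta_cmx.
have Vpt : V *m Pt = Pt *+ 2 by rewrite ePt.
have [o1 o2 o3] := propagate_hom p1t p2t Zdef uA ha h2 ea e2 comm0 closed0 Vt Vw Vpt hom1 hom2.
have gt i : mtheta i g = 0 by exact: mtheta_cmx.
have [y1 y2 y3] := propagate_sym p1t p2t Zdef ha h2 ea e2 comm0 closed0 gt sym1 sym2.
have [w1 w2] := propagate_cyclic Zdef uA ha h2 ea e2 (ext_t _) (ext_t _).
exists (unfolded_qds A1 A2 Z (flat_V C) (flat_g C)); split.
- exact: (unfolded_qds_flat c12 c1 c2 cl ea e2 s1 s2 s3 o1 o2 o3 y1 y2 y3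
    (flat_V_pair C) (flat_g_sym C) (flat_g_invol C)).
- have rA (A : 'M[G]_4) (A0 : 'M[germ C 2]_4) : mvanish (pred1 pt) 1 (A - mext 2 A0) -> restr_mx A = A0.
    move=> h; rewrite -[RHS](mextK 2); apply/restr_mx_eq => i j.
    by apply: vanish_sub (h i j) => a /eqP ->.
  have r1 := rA _ _ ha; have r2 := rA _ _ h2.
  have z0 := @zs0 C 2 2; rewrite /qds_restr /F2_flat; congr QdsData; cbn [qds_conn qds_higgs qds_V0 qds_Vinf qds_pair unfolded_qds].
  + by apply: funext => i; rewrite restr_mxE msub0 //; exact: zs0.
  + apply: funext; apply: I2_cases; rewrite restr_mxE (msubN z0); congr (- _); [exact: r1 | exact: r2].
  + have two : restr_mx (2 *: A2) = 2 *: fA2.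
      by rewrite restr_mxE (msubZ z0) (subst_nat z0); congr (_ *: _); exact: r2.
    have par (a : 'I_2) (X : 'M[G]_4) : restr_mx (germ_var C (rshift 2 a) *: X) = 0.
      by rewrite restr_mxE (msubZ z0) (subst_var z0) zs_rshift scale0r.
    by rewrite restr_mxE (msubB z0) msubD -!restr_mxE two !par addr0 subr0.
  + by rewrite -/V eV mextK.
  + by rewrite -/g eg mextK.
- exact: Vw.
split.
- by rewrite mulNmx w1.
- by rewrite mulNmx w2.
- by rewrite mulNmx mul1mx.
by rewrite mulNmx -ePt; congr (- _).
Qed.
End Unfolding.

(** * Universality *)

Section Gauge.
Variables (C : numFieldType) (n l r : nat).
Local Notation G := (germ C (n + l)).

(** P0 is parallel on the base, since T0 has zero connection. P is its parallel extension along the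
    parameters, and transport of T by P kills the connection. *)
Lemma flat_gauge (T : qds_data C (n + l) r) (T0 : qds_data C n r) (P0 : 'M[germ C n]_r) d :
  log_qds n T d -> (forall i, qds_conn T0 i = 0) -> qds_iso n (qds_restr T) T0 P0 ->
  exists T1 P, [/\ flat_qds n T1 d, qds_iso n T T1 P, restr_mx P = P0 & qds_restr T1 = T0].
Proof.
move=> hT c0 /qds_isoE[u0 hc hh [hV hW] hg].
have [|P PP hP] := @extend_flat_frame C n l r r (qds_conn T) P0 (log_qds_curvature hT).
  by move=> i; have := hc i; rewrite c0 mul0mx addr0 => /esym.
have uP : P \in unitmx by rewrite -restr_mx_unit PP.
pose cj (X : 'M[G]_r) := P *m X *m invmx P.
pose T1 := QdsData (fun _ => 0) (fun a => cj (qds_higgs T a)) (cj (qds_V0 T)) (cj (qds_Vinf T))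
  ((invmx P)^T *m qds_pair T *m invmx P).
have iso : qds_iso n T T1 P.
  apply/qds_isoE; split => //.
  - by move=> i; rewrite mul0mx addr0 hP.
  - by move=> i; rewrite /T1 /= mulmxKV.
  - by split; rewrite /T1 /= mulmxKV.
  - by rewrite /T1 /= !mulmxA -trmx_mul mulVmx // trmx1 mul1mx -mulmxA mulVmx // mulmx1.
exists T1, P; split; [| exact: iso | exact: PP |].
  have h1 := log_qds_iso iso hT.
  by apply/(@flat_qdsP C n (n + l) r T1 d (fun _ => erefl)).
have rc (X : 'M[G]_r) (X0 : 'M_r) : P0 *m restr_mx X = X0 *m P0 -> restr_mx (cj X) = X0.
  by move=> e; rewrite /cj !restr_mxM restr_mxV // PP e mulmxK.
case: T0 c0 hc hh hV hW hg => co hi V W g c0 hc hh hV hW hg.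
rewrite /qds_restr /=; congr QdsData.
- apply: funext => i; rewrite [RHS]c0; exact: msub0 (@zs0 C n l) _ _.
- by apply: funext => i; apply: rc; exact: hh.
- exact: rc.
- exact: rc.
have rT (X : 'M[G]_r) : restr_mx X^T = (restr_mx X)^T by exact: msubT.
rewrite !restr_mxM rT restr_mxV // PP -[restr_mx (qds_pair T)]hg /= !mulmxA -trmx_mul mulmxV //.
by rewrite trmx1 mul1mx mulmxK.
Qed.

End Gauge.

(** * Integration of closed forms along the parameters *)

Section Potentials.
Variables (C : numFieldType) (n l : nat).
Local Notation G := (germ C (n + l)).
Implicit Types (f g : G) (y : 'I_(n + l) -> G).

(** A solution of df = f y is a flat section of a connection of rank one; closedness of y is its
    integrability. The logarithmic form allows f to vanish on the divisor. *)
Lemma log_potential y (f0 : germ C n) :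
  (forall a b, logder n a (y b) = logder n b (y a)) ->
  (forall i, logder n i f0 = f0 * restr (y (lshift l i))) ->
  exists2 f, restr f = f0 & forall a, logder n a f = f * y a.
Proof.
move=> cl h0; have [] := @extend_flat_frame C n l 1 1 (fun a => (y a)%:M) (f0%:M).
- move=> a b; rewrite -!scalar_mxM mulrC; congr (_ + _).
  by apply/matrixP => i j; rewrite !mxE !ord1 !mulr1n cl.
- move=> i; apply/matrixP => i' j'; rewrite !ord1 mxE mul_scalar_mx !mxE !mulr1n; exact: h0.
move=> P rP hP; exists (P 0 0).
  by have /matrixP/(_ 0 0) := rP; rewrite !mxE mulr1n.
by move=> a; have /matrixP/(_ 0 0) := hP a; rewrite mul_mx_scalar !mxE mulrC.
Qed.

Lemma log_potential_unique y f g : restr f = restr g ->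
  (forall a, logder n a f = f * y a) -> (forall a, logder n a g = g * y a) -> f = g.
Proof.
move=> e hf hg.
suff /matrixP/(_ 0 0) : (f%:M : 'M_1) = g%:M by rewrite !mxE !mulr1n.
have sc h : (forall a, logder n a h = h * y a) -> forall a, mlogder n a (h%:M : 'M_1) = h%:M *m (y a)%:M.
  by move=> hh a; apply/matrixP => i j; rewrite !ord1 -scalar_mxM !mxE !mulr1n hh.
apply: (@flat_frame_unique C n l 1 1 (fun a => (y a)%:M)); [|exact: sc|exact: sc].
by apply/matrixP => i j; rewrite !ord1 !mxE !mulr1n; exact: e.
Qed.

Lemma potential_unique f g : restr f = restr g ->
  (forall a, logder n a f = logder n a g) -> f = g.
Proof.
move=> e h; apply/eqP; rewrite -subr_eq0; apply/eqP.
apply: (@log_potential_unique (fun _ => 0)).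
- by rewrite /restr substB ?subst0 ?[germ_subst _ f]e ?subrr //; exact: zs0.
- by move=> a; rewrite mulr0 logderB h subrr.
by move=> a; rewrite mulr0 logder0.
Qed.

Lemma mpotential_unique m p (A B : 'M[G]_(m, p)) : restr_mx A = restr_mx B ->
  (forall a, mlogder n a A = mlogder n a B) -> A = B.
Proof.
move=> /matrixP e h; apply/matrixP => i j; apply: potential_unique.
  by have := e i j; rewrite !mxE.
by move=> a; have /matrixP/(_ i j) := h a; rewrite !mxE.
Qed.

(** The inhomogeneous equation df = y is made linear: the row (f, 1) is flat for a nilpotent
    connection of rank 2 whose matrices multiply to zero, so that integrability is closedness of
    y. *)
Lemma potential y (f0 : germ C n) :
  (forall a b, logder n a (y b) = logder n b (y a)) ->
  (forall i, logder n i f0 = restr (y (lshift l i))) ->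
  exists2 f, restr f = f0 & forall a, logder n a f = y a.
Proof.
move=> cl h0.
pose Gam a : 'M[G]_2 := y a *: delta_mx ord_max ord0.
have [] := @extend_flat_frame C n l 1 2 Gam (f0 *: delta_mx 0 ord0 + delta_mx 0 ord_max).
- move=> a b; have nil c e : Gam c *m Gam e = 0.
    by rewrite /Gam -scalemxAl -scalemxAr mul_delta_mx_cond !scaler0.
  by rewrite !nil !addr0; apply/matrixP => i j; rewrite !mxE !logderM !logder_nat !mulr0 !addr0 cl.
- move=> i; have z0 := @zs0 C n l; rewrite /Gam restr_mxE msubZ // -(cmx_delta C (n + l)) msub_cmx // cmx_delta.
  rewrite mulmxDl -scalemxAl -!scalemxAr !mul_delta_mx_cond /= mulr0n scaler0 scaler0 add0r mulr1n.
  apply/matrixP => a b; rewrite !mxE logderD logderM !logder_nat mulr0 !addr0; congr (_ * _); exact: h0.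
move=> P rP hP.
have PM a j : (P *m Gam a) 0 j = P 0 ord_max * y a * (j == ord0)%:R.
  rewrite mxE (bigD1 ord_max) //= big1 ?addr0 ?mxE ?eqxx ?mulrA // => k /negbTE hk.
  by rewrite !mxE hk /= !mulr0.
have P1 : P 0 ord_max = 1.
  apply: potential_unique.
    have /matrixP/(_ 0 ord_max) := rP; rewrite !mxE /= mulr0 add0r => e.
    by rewrite [LHS]e /restr subst1 //; exact: zs0.
  by move=> a; have /matrixP/(_ 0 ord_max) := hP a; rewrite mxE PM mulr0 logder1.
exists (P 0 ord0).
  by have /matrixP/(_ 0 ord0) := rP; rewrite !mxE /= mulr1 addr0.
by move=> a; have /matrixP/(_ 0 ord0) := hP a; rewrite mxE PM P1 mul1r mulr1.
Qed.

End Potentials.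

(** * Pull-back of a flat system by a logarithmic map *)

Section Pullback.
Variables (C : numFieldType) (k n p r : nat) (d : int) (T : qds_data C n r).
Variables (phi : {ffun 'I_n -> germ C p}) (J : 'M[germ C p]_(n, p)).
Hypotheses (phi0 : forall a, phi a 0%MM = 0) (hJ : log_jacobian k phi J) (hT : flat_qds k T d).
Hypothesis phiI : forall (a : 'I_n) (f g : germ C p),
  (if (a < k)%N then phi a else 1) * f = (if (a < k)%N then phi a else 1) * g -> f = g.
Local Notation T1 := (qds_pullback phi J T).

(** Row a of J is d log phi_a, or d phi_a off the divisor: [logder k b] and [logder k c] commute on
    phi a, and the factor phi a is cancelled. *)
Lemma log_jacobian_closed a b c : logder k c (J a b) = logder k b (J a c).
Proof.
apply: (phiI (a := a)); have h e : logder k e (if (a < k)%N then phi a else 1) =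
    (if (a < k)%N then phi a else 1) * (if (a < k)%N then J a e else 0).
  by move: (hJ a e); case: ifP => _ h; rewrite ?h ?logder1 ?mulr0.
have := logder_comm k b c (phi a); rewrite !hJ !logderM !h.
case: ifP => _; last by rewrite !(mulr0, mul0r, add0r).
move=> e; apply/esym/(addrI (phi a * J a b * J a c)).
by rewrite e; congr (_ + _); ring.
Qed.

Let sum_mull b (X : 'M[germ C p]_r) (F : 'I_n -> 'M[germ C n]_r) :
  (\sum_a J a b *: msub phi (F a)) *m X = \sum_a J a b *: (msub phi (F a) *m X).
Proof. by rewrite mulmx_suml; apply: eq_bigr => a _; rewrite scalemxAl. Qed.
Let sum_mulr b (X : 'M[germ C p]_r) (F : 'I_n -> 'M[germ C n]_r) :
  X *m (\sum_a J a b *: msub phi (F a)) = \sum_a J a b *: (X *m msub phi (F a)).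
Proof. by rewrite mulmx_sumr; apply: eq_bigr => a _; rewrite scalemxAr. Qed.

Lemma pullback_comm b c : qds_higgs T1 b *m qds_higgs T1 c = qds_higgs T1 c *m qds_higgs T1 b.
Proof.
rewrite [LHS]sum_mull [RHS]sum_mulr; apply: eq_bigr => a _; congr (_ *: _).
rewrite [LHS]sum_mulr [RHS]sum_mull; apply: eq_bigr => e _; congr (_ *: _).
by rewrite -!(msubM phi0) (fq_comm hT).
Qed.

Lemma pullback_closed b c :
  mlogder k b (qds_higgs T1 c) = mlogder k c (qds_higgs T1 b).
Proof.
have e b' c' : mlogder k b' (qds_higgs T1 c') =
    \sum_a logder k b' (J a c') *: msub phi (qds_higgs T a) +
    \sum_a \sum_e (J a c' * J e b') *: msub phi (mlogder k e (qds_higgs T a)).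
  rewrite mlogder_sum -big_split; apply: eq_bigr => a _ /=.
  rewrite mlogderZ (msub_mlogder phi0 hJ) scaler_sumr; congr (_ + _).
  by apply: eq_bigr => e _; rewrite scalerA.
rewrite !e; congr (_ + _); first by apply: eq_bigr => a _; rewrite log_jacobian_closed.
rewrite exchange_big; apply: eq_bigr => a _; apply: eq_bigr => e' _.
by rewrite mulrC (fq_closed hT).
Qed.

Lemma pullback_V0 b : mlogder k b (qds_V0 T1) + qds_higgs T1 b *m qds_Vinf T1 =
  qds_Vinf T1 *m qds_higgs T1 b - qds_higgs T1 b.
Proof.
rewrite [mlogder _ _ _](msub_mlogder phi0 hJ) [_ *m _]sum_mull [qds_Vinf T1 *m _]sum_mulr.
rewrite -big_split -sumrB; apply: eq_bigr => a _ /=; rewrite -scalerDr -scalerBr; congr (_ *: _).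
by rewrite -!(msubM phi0) -(msubD phi) (fq_V0 hT) msubB.
Qed.

Let pull_const (A : 'M[germ C n]_r) : (forall a, mlogder k a A = 0) ->
  forall b, mlogder k b (msub phi A) = 0.
Proof.
by move=> h b; rewrite (msub_mlogder phi0 hJ) big1 // => a _; rewrite h (msub0 phi0) scaler0.
Qed.

Lemma pullback_Vinf b : mlogder k b (qds_Vinf T1) = 0.
Proof. exact/pull_const/(fq_Vinf hT). Qed.

Lemma pullback_pair b : mlogder k b (qds_pair T1) = 0.
Proof. exact/pull_const/(fq_pair hT). Qed.

End Pullback.

Lemma mx_bracket_kernel (R : comNzRingType) r (X Y : 'M[R]_r) (z : 'cV[R]_r) :
  X *m z = 0 -> X *m Y *m z = mx_bracket X Y *m z.
Proof. by move=> e; rewrite /mx_bracket mulmxBl -(mulmxA Y) e mulmx0 subr0. Qed.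

Section Comparison.
Variables (C : numFieldType) (l : nat).
Local Notation G := (germ C (2 + l)).
Local Notation p1 := (lshift l ord0 : 'I_(2 + l)).
Local Notation p2 := (lshift l ord_max : 'I_(2 + l)).
Local Notation W := (mvanish (params 2 l)).
Local Notation w0 := (delta_mx ord0 0 : 'cV[G]_4).
Variables A B : 'I_(2 + l) -> 'M[G]_4.
Hypotheses (cA : forall b c, A b *m A c = A c *m A b) (cB : forall b c, B b *m B c = B c *m B b).
Hypotheses (clA : forall b c, mlogder 2 b (A c) = mlogder 2 c (A b))
  (clB : forall b c, mlogder 2 b (B c) = mlogder 2 c (B b)).
Hypothesis AB_w : forall b, A b *m w0 = B b *m w0.
Hypothesis AB_0 : forall i : 'I_2, W 1 (A (lshift l i) - B (lshift l i)).
Hypothesis frame : word_frame (A p1) (A p2 - A p1) \in unitmx.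

(* Modulo a power of the ideal of the parameters, A b - B b kills w0 and commutes with
   the A c if this holds for the base directions c, hence it is as small as in these;
   closedness then gains one power for the base directions. *)
Lemma cyclic_higgs_unique b : A b = B b.
Proof.
have all w : (forall i : 'I_2, W w (A (lshift l i) - B (lshift l i))) -> forall b, W w (A b - B b).
  move=> hw c; have cm (i : 'I_2) : W w (mx_bracket (A c - B c) (A (lshift l i))).
    have -> : mx_bracket (A c - B c) (A (lshift l i)) = - mx_bracket (B c) (A (lshift l i) - B (lshift l i)).
      rewrite mx_bracketBl mx_bracketBr.
      rewrite ((mx_bracket_eq0 _ _).2 (cA c _)) ((mx_bracket_eq0 (B c) (B _)).2 (cB c _)).
      by rewrite subr0 sub0r.
    by apply: mvanishN; apply: mvanishB; [exact: mvanishMl | exact: mvanishMr].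
  set R := A c - B c in cm *.
  have R0 : R *m w0 = 0 by rewrite mulmxBl AB_w subrr.
  have cmB : W w (mx_bracket R (A p2 - A p1)) by rewrite mx_bracketBr; apply: mvanishB.
  have cmw j : W w (mx_bracket R (word (A p1) (A p2 - A p1) j)).
    have h1 : W w (mx_bracket R 1%:M) by rewrite mx_bracket1; exact: mvanish0.
    have h2 : W w (mx_bracket R (A p1 *m (A p2 - A p1))).
      by rewrite mx_bracketMr; apply: mvanishD; [exact: mvanishMr (cm ord0) | exact: mvanishMl cmB].
    exact: (@word_ind _ _ _ (fun X => W w (mx_bracket R X)) h1 (cm ord0) cmB h2).
  rewrite -(mulmxK frame R); apply: mvanishMr => i j; rewrite mulmx_word_frame.
  by rewrite (mx_bracket_kernel _ R0); exact: mvanishMr (cmw j) _ _.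
have base w : forall i : 'I_2, W w (A (lshift l i) - B (lshift l i)).
  elim: w => [|w ih] i; first exact: mvanish_0.
  move=> a c; apply: vanishS; first exact: AB_0.
  move=> e pe; have /(_ a c) : W w.+1 (mtheta e (A (lshift l i) - B (lshift l i))); last by rewrite mxE.
  have e2 : (e < 2)%N = false by apply/negbTE; rewrite -leqNgt.
  rewrite (@mtheta_mlogder _ _ 2) e2; apply: mvanishZS => //.
  have -> : mlogder 2 e (A (lshift l i) - B (lshift l i)) = mlogder 2 (lshift l i) (A e - B e).
    by rewrite !mlogderB clA clB.
  by apply: mvanish_mlogder; [rewrite params_lshift | exact: all].
apply/eqP; rewrite -subr_eq0; apply/eqP; apply: (@mvanish_eq0 _ _ (params 2 l)) => w.
by apply: all; exact: base.
Qed.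

End Comparison.

Section MirrorCoordinates.
Variable R : comNzRingType.
Variables psi u v f2 J1 J2 f1 : R.
Hypotheses (hu : (1 - psi) * u = 1) (hv : (1 + psi) * v = 1).

(** In this section psi stands for the pull-back of Q, f1 and f2 for those of q_1 and q_2, J1 and J2
    for the logarithmic derivatives of the latter. By [mirror_der], the logarithmic derivative of
    psi is then the h_A-component of the period form minus its h_B-component. *)
Lemma period_psi : psi = f1 * (1 + psi) ^+ 2 ->
  u * (f1 * J1 * (1 + psi) ^+ 3) = psi * (u * J1 + J2 - (- (u * psi) * J1 + J2)).
Proof.
move=> e; have -> : u * (f1 * J1 * (1 + psi) ^+ 3) = u * J1 * (1 + psi) * (f1 * (1 + psi) ^+ 2) by ring.
by rewrite -e; ring.
Qed.

Lemma period_chi y : y = u * J1 + J2 - (- (u * psi) * J1 + J2) ->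
  f2 * J2 * v + f2 * (- (psi * y * v ^+ 2)) = f2 * v * (- (u * psi) * J1 + J2).
Proof.
move=> ->; transitivity (f2 * v * J2 - f2 * v * psi * u * J1 * ((1 + psi) * v)); first by ring.
by rewrite hv; ring.
Qed.

Lemma mirror_phi1 y : psi * y * v ^+ 2 + psi * (2 * (v * - (psi * y * v ^+ 2))) =
  psi * v ^+ 2 * (y * (1 - psi) * v).
Proof.
transitivity (psi * v ^+ 2 * y * (1 - 2 * psi * v)); first by ring.
transitivity (psi * v ^+ 2 * y * ((1 + psi) * v - 2 * psi * v)); last by ring.
by rewrite hv.
Qed.

Lemma mirror_phi2 chi y c2 : chi * c2 * (1 + psi) + chi * (psi * y) =
  chi * (1 + psi) * (c2 + psi * y * v).
Proof.
transitivity (chi * c2 * (1 + psi) + chi * (psi * y) * ((1 + psi) * v)); first by rewrite hv mulr1.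
by ring.
Qed.

Lemma period_column1 c1 c2 : u * ((c1 - c2) * (1 - psi) * v) + (c2 + psi * (c1 - c2) * v) = c1.
Proof.
transitivity ((c1 - c2) * v * ((1 - psi) * u) + c2 + psi * (c1 - c2) * v); first by ring.
rewrite hu; transitivity ((c1 - c2) * ((1 + psi) * v) + c2); first by ring.
by rewrite hv; ring.
Qed.

Lemma period_column2 c1 c2 :
  - (u * psi) * ((c1 - c2) * (1 - psi) * v) + (c2 + psi * (c1 - c2) * v) = c2.
Proof.
transitivity (- ((c1 - c2) * v * psi * ((1 - psi) * u)) + c2 + psi * (c1 - c2) * v); first by ring.
by rewrite hu; ring.
Qed.

End MirrorCoordinates.

Lemma I4_cases (P : 'I_4 -> Prop) : P ord0 -> P (@Ordinal 4 1 isT) -> P (@Ordinal 4 2 isT) ->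
  P (@Ordinal 4 3 isT) -> forall i, P i.
Proof.
by move=> h0 h1 h2 h3 [[|[|[|[|//]]]] lt];
  [move: h0 | move: h1 | move: h2 | move: h3]; congr P; exact: val_inj.
Qed.

(** * The inducing map and the period form *)

Section PeriodEquations.
Variables (C : numFieldType) (l : nat).
Local Notation G := (germ C (2 + l)).
Local Notation p1 := (lshift 2 ord0 : 'I_(2 + 2)).
Local Notation p2 := (lshift 2 ord_max : 'I_(2 + 2)).
Local Notation ps := (rshift 2 ord0 : 'I_(2 + 2)).
Local Notation pt := (rshift 2 ord_max : 'I_(2 + 2)).
Local Notation q1 := (germ_var C (ord0 : 'I_2)).
Local Notation q2 := (germ_var C (ord_max : 'I_2)).
Variable Q : germ C 2.
Hypotheses (Q0 : Q 0%MM = 0) (hQ : Q = q1 * (1 + Q) ^+ 2).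
Local Notation u := ((1 - Q)^-1).
Local Notation v := ((1 + Q)^-1).
Local Notation fA1 := (flat_A1 Q u v q2).
Local Notation fA2 := (flat_A2 Q v q2).
Variable T : qds_data C (2 + 2) 4.
Hypotheses (hT : flat_qds 2 T 2) (rT : qds_restr T = F2_flat Q).
Local Notation w0 := (delta_mx ord0 0).
Hypotheses (T1 : qds_higgs T p1 *m w0 = - (mext 2 fA1 *m (w0 : 'cV_4)))
  (T2 : qds_higgs T p2 *m w0 = - (mext 2 fA2 *m (w0 : 'cV_4)))
  (Ts : qds_higgs T ps *m w0 = - (w0 : 'cV_4)) (Tt : qds_higgs T pt *m w0 = - (delta_mx ord_max 0 : 'cV_4)).

Lemma sum_I22 (V : nmodType) (F : 'I_(2 + 2) -> V) : \sum_a F a = F p1 + F p2 + (F ps + F pt).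
Proof.
rewrite big_split_ord /= !big_ord_recl !big_ord0 !addr0.
by rewrite (_ : lift ord0 ord0 = ord_max :> 'I_2) //; exact: val_inj.
Qed.

Section Map.
Variables (phi : {ffun 'I_(2 + 2) -> G}) (J : 'M[G]_(2 + 2, 2 + l)).
Hypothesis phi0 : forall a, phi a 0%MM = 0.
Local Notation psi := (germ_subst phi (@ext C 2 2 Q)).

Lemma psi0 : psi 0%MM = 0.
Proof. by rewrite subst_coef0 // /ext subst_coef0 // => i; exact: gvar0. Qed.

Let ev0 (i : 'I_2) : germ_var C (lshift 2 i) 0%MM = 0. Proof. exact: gvar0. Qed.

Lemma psi_mirror : psi = phi p1 * (1 + psi) ^+ 2.
Proof.
have e : germ_subst phi (germ_subst (fun i => germ_var C (lshift 2 i)) (q1 * (1 + Q) ^+ 2)) =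
    phi p1 * (1 + psi) ^+ 2.
  by rewrite !expr2 !(substM ev0, substD) !(substM phi0, substD) (subst1 ev0) (subst1 phi0) (subst_var ev0) (subst_var phi0).
by rewrite -e -hQ.
Qed.

Let hu := mirror_hu psi0.
Let hv := mirror_hv psi0.

Lemma sub_u : germ_subst phi (@ext C 2 2 u) = (1 - psi)^-1.
Proof.
have un : 1 - psi \is a GRing.unit by apply/unitrP; eexists; split; [rewrite mulrC|]; exact: hu.
apply: (mulrI un); rewrite hu.
have := congr1 (fun x => germ_subst phi (@ext C 2 2 x)) (mirror_hu Q0).
by rewrite /ext !(substM ev0) !(substM phi0) !(substB ev0) !(substB phi0) !(subst1 ev0) !(subst1 phi0).
Qed.

(** The coordinates of - Phi(1) for the pulled-back system in the frame 1, h_A, h_B, pt: q_1 d/dq_1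
    corresponds to u (h_A - psi h_B), q_2 d/dq_2 to h_A + h_B, and the parameters to 1 and pt. *)
Definition period_column (u' psi' j1 j2 js jt : G) (i : 'I_4) : G :=
  nth 0 [:: js; u' * j1 + j2; - (u' * psi') * j1 + j2; jt] i.

Lemma period_columnE b i : - (qds_higgs (qds_pullback phi J T) b i ord0) =
  period_column (1 - psi)^-1 psi (J p1 b) (J p2 b) (J ps b) (J pt b) i.
Proof.
have col m (A : 'M[germ C m]_4) j : A j ord0 = (A *m (w0 : 'cV_4)) j 0 by rewrite -colE mxE.
rewrite [qds_higgs _ _]/= sum_I22 !mxE.
have E a (A : 'cV[germ C (2 + 2)]_4) : qds_higgs T a *m w0 = - A ->
    J a b * germ_subst phi (qds_higgs T a i ord0) = - (J a b * germ_subst phi (A i 0)).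
  by move=> h; rewrite col h !mxE (substN phi0) mulrN.
rewrite (E _ _ T1) (E _ _ T2) (E _ _ Ts) (E _ _ Tt) -!col !mxE -sub_u.
pose ev (i : 'I_2) := germ_var C (lshift 2 i).
have e0 : germ_subst phi (germ_subst ev 0) = 0 by rewrite (subst0 ev0) (subst0 phi0).
have e1 : germ_subst phi (germ_subst ev 1) = 1 by rewrite (subst1 ev0) (subst1 phi0).
have eM : germ_subst phi (germ_subst ev (- (u * Q))) = - (germ_subst phi (@ext C 2 2 u) * psi).
  by rewrite (substN ev0) (substN phi0) (substM ev0) (substM phi0).
clear E; case: i => -[|[|[|[|//]]]] ?; cbn [nat_of_ord nth];
  rewrite /period_column; cbn [nat_of_ord nth]; rewrite ?e0 ?e1 ?[germ_subst _ (germ_subst _ (- (u * Q)))]eM ?[germ_subst _ (germ_subst _ u)]/(germ_subst phi (@ext C 2 2 u)) ?(subst0 phi0) ?(subst1 phi0);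
  move: (germ_subst phi (@ext C 2 2 u)) (J _ _) (J _ _) (J _ _) (J _ _) psi => *; ring.
Qed.

End Map.

Section FlatUnfolding.
Variable U : qds_data C (2 + l) 4.
Hypotheses (hU : flat_qds 2 U 2) (rU : qds_restr U = F2_flat Q).
Local Notation e1 := (@Ordinal 4 1 isT).
Local Notation e2 := (@Ordinal 4 2 isT).
Local Notation e3 := (@Ordinal 4 3 isT).
Local Notation zs m := (zero_section C 2 m).
Local Notation b0 := (lshift l ord0 : 'I_(2 + l)).
Local Notation b1 := (lshift l ord_max : 'I_(2 + l)).

Definition period_form i b : G := - qds_higgs U b i ord0.
Local Notation c := period_form.
Local Notation y b := (c e1 b - c e2 b).

Lemma period_closed i a b : logder 2 a (c i b) = logder 2 b (c i a).
Proof. by have /matrixP/(_ i ord0) := fq_closed hU a b; rewrite !mxE !logderN => ->. Qed.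

Let z0 := @zs0 C 2 l.

Lemma period_restr i j : restr (c i (lshift l j)) = (if j == ord0 then fA1 else fA2) i ord0.
Proof.
have := congr1 (fun D => qds_higgs D j i ord0) rU.
rewrite /= mxE /restr /c substN // => ->.
by case: ifP; rewrite mxE opprK.
Qed.

(** Agreement of the Higgs fields on the cyclic vector only; [pullback_eq] extends it to the whole
    systems. *)
Definition period_map_eq (phi : {ffun 'I_(2 + 2) -> G}) (J : 'M[G]_(2 + 2, 2 + l)) :=
  forall b i, qds_higgs (qds_pullback phi J T) b i ord0 = qds_higgs U b i ord0.

(* psi and chi are the pull-backs of the coordinates Q and q_2 / (1 + Q), whose
   logarithmic derivatives are components of the period form. *)
Lemma period_determined (phi : {ffun 'I_(2 + 2) -> G}) J : (forall a, phi a 0%MM = 0) -> log_jacobian 2 phi J ->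
  (forall a, germ_subst (zs l) (phi a) = zs 2 a) -> period_map_eq phi J ->
  let psi := germ_subst phi (@ext C 2 2 Q) in let chi := phi p2 * (1 + psi)^-1 in
  [/\ restr psi = Q, forall b, logder 2 b psi = psi * y b,
      restr chi = q2 * v, forall b, logder 2 b chi = chi * c e2 b &
      (forall b, logder 2 b (phi ps) = c ord0 b) /\ (forall b, logder 2 b (phi pt) = c e3 b)].
Proof.
move=> phi0 hJ rphi per psi chi.
have ps0 : psi 0%MM = 0 by exact: psi0.
have hm : psi = phi p1 * (1 + psi) ^+ 2 by exact: psi_mirror.
have hu := mirror_hu ps0; have hv := mirror_hv ps0.
have J1 b : logder 2 b (phi p1) = phi p1 * J p1 b := hJ p1 b.
have J2 b : logder 2 b (phi p2) = phi p2 * J p2 b := hJ p2 b.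
have Js b : logder 2 b (phi ps) = 1 * J ps b := hJ ps b.
have Jt b : logder 2 b (phi pt) = 1 * J pt b := hJ pt b.
have E b i : c i b = period_column (1 - psi)^-1 psi (J p1 b) (J p2 b) (J ps b) (J pt b) i.
  by rewrite -(period_columnE _ phi0) // per.
have rpsi : restr psi = Q.
  by rewrite /restr (subst_comp phi0 z0 rphi); exact: extK.
have dpsi b : logder 2 b psi = psi * y b.
  transitivity ((1 - psi)^-1 * ((1 - psi) * logder 2 b psi)); first by rewrite mulrA [_^-1 * _]mulrC hu mul1r.
  by rewrite (mirror_der _ _ hm) J1 !E; exact: period_psi.
split => //.
- rewrite /restr (substM z0) rphi zs_lshift; congr (_ * _).
  rewrite (substV z0) ?(substD) ?(subst1 z0) ?[germ_subst _ psi]rpsi //.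
  exact: mirror_v_unit.
- move=> b; rewrite logderM J2 (logder_v ps0) dpsi [c e2 b in RHS]E.
  by apply: (period_chi _ hv); rewrite !E.
by split=> b; rewrite E ?Js ?Jt mul1r.
Qed.

Lemma period_map_unique (phi phi' : {ffun 'I_(2 + 2) -> G}) J J' :
  (forall a, phi a 0%MM = 0) -> log_jacobian 2 phi J ->
  (forall a, germ_subst (zs l) (phi a) = zs 2 a) -> period_map_eq phi J ->
  (forall a, phi' a 0%MM = 0) -> log_jacobian 2 phi' J' ->
  (forall a, germ_subst (zs l) (phi' a) = zs 2 a) -> period_map_eq phi' J' -> phi' = phi.
Proof.
move=> h0 hJ hr hp h0' hJ' hr' hp'.
have [] := period_determined h0 hJ hr hp; set psi := germ_subst _ _ => r1 d1 r2 d2 [d3 d4].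
have [] := period_determined h0' hJ' hr' hp'; set psi' := germ_subst _ _ => r1' d1' r2' d2' [d3' d4'].
have e1 : psi' = psi by apply: (log_potential_unique _ d1' d1); rewrite r1 r1'.
have e2 := log_potential_unique (etrans r2' (esym r2)) d2' d2.
have ps0 : psi 0%MM = 0 by exact: psi0.
have hv := mirror_hv ps0.
apply/ffunP; apply: I22_cases.
- have hm : psi = phi p1 * (1 + psi) ^+ 2 by exact: psi_mirror.
  have hm' : psi' = phi' p1 * (1 + psi') ^+ 2 by exact: psi_mirror.
  by rewrite (mirror_inv ps0 hm) e1 in hm' *; rewrite (mirror_inv ps0 hm').
- rewrite e1 in e2; have := congr1 (fun x => x * (1 + psi)) e2.
  by rewrite -!mulrA [_^-1 * _]mulrC hv !mulr1.
- by apply: potential_unique; [rewrite /restr hr hr' | move=> a; rewrite d3 d3'].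
by apply: potential_unique; [rewrite /restr hr hr' | move=> a; rewrite d4 d4'].
Qed.

Let dvar_base b (a : 'I_(2 + l)) : (a < 2)%N -> logder 2 b (germ_var C a) = (b == a)%:R * germ_var C a :> G.
Proof. by move=> la; rewrite logder_var; case: eqP => [->|_]; rewrite ?la // !mul0r. Qed.

Let restrB (f g : G) : restr (f - g) = restr f - restr g. Proof. exact: substB. Qed.

Let restrM (f g : G) : restr (f * g) = restr f * restr g. Proof. exact: substM. Qed.

Let log_base (a : 'I_(2 + l)) (h : 'I_(2 + l) -> G) (f : G) : (a < 2)%N ->
  (forall b, logder 2 b f = f * (h b - (b == a)%:R)) ->
  forall b, logder 2 b (germ_var C a * f) = germ_var C a * f * h b.
Proof. by move=> la hf b; rewrite logderM dvar_base // hf; ring. Qed.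

Let base_closed (a : 'I_(2 + l)) (h : 'I_(2 + l) -> G) : (forall b e, logder 2 b (h e) = logder 2 e (h b)) ->
  forall b e, logder 2 b (h e - (e == a)%:R) = logder 2 e (h b - (b == a)%:R).
Proof. by move=> hh b e; rewrite !logderB !logder_nat !subr0. Qed.

Let y_closed a b : logder 2 a (y b) = logder 2 b (y a).
Proof. by rewrite !logderB !(period_closed _ a b). Qed.

(** The map must preserve the components of the divisor, so the potential is sought as x_a times a
    unit. The equation solved is that of the unit, for the form minus d log x_a. *)
Lemma log_potential_base (a : 'I_2) (h : 'I_(2 + l) -> G) (f0 : germ C 2) :
  (forall b e, logder 2 b (h e) = logder 2 e (h b)) -> f0 0%MM = 1 ->
  (forall j, logder 2 j f0 = f0 * (restr (h (lshift l j)) - (j == a)%:R)) ->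
  exists f, [/\ f \is a GRing.unit, restr f = f0 &
    forall b, logder 2 b (germ_var C (lshift l a) * f) = germ_var C (lshift l a) * f * h b].
Proof.
move=> hh f1 hf0.
have [j|f rf hf] := log_potential (base_closed (lshift l a) hh) (f0 := f0).
  by rewrite restrB [restr _%:R](subst_nat z0) hf0 -val_eqE.
exists f; split => //; last by apply: log_base => //; exact: (ltn_ord a).
by rewrite germ_unitE -(subst_coef0 z0) [germ_subst _ f]rf f1 oner_neq0.
Qed.

Lemma period_map_exists : exists (phi : {ffun 'I_(2 + 2) -> G}) J,
  [/\ log_map 2 phi, forall a, germ_subst (zs l) (phi a) = zs 2 a, log_jacobian 2 phi J
    & period_map_eq phi J].
Proof.
have hu := mirror_hu Q0; have hv := mirror_hv Q0.
have Q1 : (1 + Q) 0%MM = 1 by rewrite gcoefD gcoef1 eqxx Q0 addr0.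
(* On the base psi is Q = q_1 (1 + Q)^2 and chi is q_2 / (1 + Q), which gives the initial values (1
   + Q)^2 and v of the unit factors. *)
have [] := @log_potential_base ord0 (fun b => y b) ((1 + Q) ^+ 2) y_closed.
- by rewrite expr2 gcoefM0 Q1 mulr1.
- apply: I2_cases; rewrite expr2 logderM logderD logder1 add0r restrB !period_restr.
    rewrite (logder_mirror Q0 hQ) eqxx; cbv iota; rewrite !mxE; cbn [nat_of_ord nth nat_of_bool ord0].
    transitivity ((1 + Q) * (1 + Q) * (u + u * Q - (1 - Q) * u)); [by ring|].
    by rewrite hu; ring.
  by rewrite (logder_mirror1 Q0 hQ) (_ : (ord_max == ord0 :> 'I_2) = false) // !mxE; cbn [nat_of_ord nth nat_of_bool ord0]; ring.
move=> g1 [ug1 rg1 dpsi].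
have [] := @log_potential_base ord_max (c e2) v (period_closed e2).
- have := congr1 (fun f : germ C 2 => f 0%MM) hv.
  by rewrite gcoefM0 Q1 mul1r gcoef1 eqxx.
- apply: I2_cases; rewrite (logder_v Q0) !period_restr.
    rewrite (logder_mirror Q0 hQ) (_ : (ord0 == ord_max :> 'I_2) = false) // eqxx !mxE.
    cbn [nat_of_ord nth nat_of_bool ord0].
    transitivity (- (Q * u * v * ((1 + Q) * v))); [by ring|].
    by rewrite hv; ring.
  by rewrite (logder_mirror1 Q0 hQ) (_ : (ord_max == ord0 :> 'I_2) = false) // eqxx !mxE; cbn [nat_of_ord nth nat_of_bool ord0]; ring.
move=> g2 [ug2 rg2 dchi].
have [psi epsi] : exists psi, psi = germ_var C b0 * g1 by eexists.
have [chi echi] : exists chi, chi = germ_var C b1 * g2 by eexists.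
rewrite -epsi in dpsi; rewrite -echi in dchi.
have [|f3 r3 d3] := potential (period_closed ord0) (f0 := 0).
  apply: I2_cases; rewrite logder0 period_restr.
    by rewrite eqxx mxE; cbn [nat_of_ord nth ord0].
  by rewrite (_ : (ord_max == ord0 :> 'I_2) = false) // mxE; cbn [nat_of_ord nth ord0].
have [|f4 r4 d4] := potential (period_closed e3) (f0 := 0).
  apply: I2_cases; rewrite logder0 period_restr.
    by rewrite eqxx mxE; cbn [nat_of_ord nth ord0].
  by rewrite (_ : (ord_max == ord0 :> 'I_2) = false) // mxE; cbn [nat_of_ord nth ord0].
have ps0 : psi 0%MM = 0 by rewrite epsi gcoefM0 gvar0 mul0r.
have hu' := mirror_hu ps0; have hv' := mirror_hv ps0; have uv := mirror_v_unit ps0.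
have rpsi : restr psi = Q.
  by rewrite epsi /restr (substM z0) (subst_var z0) zs_lshift [germ_subst _ g1]rg1 -hQ.
have r1psi : restr (1 + psi) = 1 + Q.
  by rewrite /restr substD (subst1 z0) [germ_subst _ psi]rpsi.
have rvv : restr (1 + psi)^-1 = v by rewrite /restr (substV z0) // [germ_subst _ (1 + psi)]r1psi.
have rchi : restr chi = q2 * v.
  by rewrite echi /restr (substM z0) (subst_var z0) zs_lshift [germ_subst _ g2]rg2.
have dw b : logder 2 b (1 + psi)^-1 = - (psi * y b * (1 + psi)^-1 ^+ 2) by rewrite (logder_v ps0) dpsi.
have uw : (1 + psi)^-1 \is a GRing.unit by rewrite unitrV.
move: ((1 + psi)^-1) hv' rvv dw uw => w hv' rvv dw uw.
(* The coordinates q_1 and q_2 are recovered from Q = psi and q_2 / (1 + Q) = chi by q_1 = psi / (1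
   + psi)^2 and q_2 = chi (1 + psi). *)
pose phi : {ffun 'I_(2 + 2) -> G} :=
  [ffun a : 'I_(2 + 2) => nth 0 [:: psi * w ^+ 2; chi * (1 + psi); f3; f4] a].
pose J : 'M[G]_(2 + 2, 2 + l) := \matrix_(a < 2 + 2, b < 2 + l)
  nth 0 [:: y b * (1 - psi) * w; c e2 b + psi * y b * w; c ord0 b; c e3 b] a.
have F1 : phi p1 = psi * w ^+ 2 by rewrite ffunE.
have F2 : phi p2 = chi * (1 + psi) by rewrite ffunE.
have F3 : phi ps = f3 by rewrite ffunE.
have F4 : phi pt = f4 by rewrite ffunE.
have rphi : forall a, germ_subst (zs l) (phi a) = zs 2 a.
  apply: I22_cases; rewrite ?F1 ?F2 ?F3 ?F4 ?zs_lshift ?zs_rshift //.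
    by rewrite -[LHS]/(restr _) (restrM psi) rpsi (expr2 w) (restrM w) rvv -expr2 -(mirror_inv Q0 hQ).
  by rewrite -[LHS]/(restr _) (restrM chi) rchi r1psi -mulrA [v * _]mulrC hv mulr1.
have phi0 a : phi a 0%MM = 0 by rewrite -(subst_coef0 z0) rphi zs0.
have lm : log_map 2 phi.
  split=> [|a b la ab]; first exact: phi0.
  have eb (i : 'I_2) : a = lshift 2 i -> germ_var C b = germ_var C (lshift l i).
    by move=> ea; congr germ_var; apply: val_inj; rewrite /= -[val b]ab ea.
  move: la eb {ab}; move: a; apply: I22_cases => // _ /(_ _ erefl) ->.
    exists (g1 * w ^+ 2); first by rewrite unitrM ug1; apply: unitrX.
    by rewrite F1 epsi; ring.
  exists (g2 * (1 + psi)); first by rewrite unitrM ug2.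
  by rewrite F2 echi; ring.
have hJ : log_jacobian 2 phi J.
  apply: I22_cases => b; rewrite mxE ?F1 ?F2 ?F3 ?F4; cbn [nth].
  - by rewrite /= (expr2 w) !logderM dpsi dw -mirror_phi1 // /period_form; ring.
  - by rewrite /= logderM logderD logder1 add0r dpsi dchi -mirror_phi2.
  - by rewrite /= mul1r d3.
  by rewrite /= mul1r d4.
exists phi, J; split => // b i; apply: oppr_inj; rewrite period_columnE //.
(* psi was built before phi; both it and the pull-back of Q solve the mirror equation for phi p1,
   whose solution is unique. *)
have -> : germ_subst phi (@ext C 2 2 Q) = psi.
  apply: (mirror_unique (f := phi p1)); [exact: phi0 | exact: psi_mirror |].
  by rewrite F1 -mulrA -exprMn [w * _]mulrC hv' expr1n mulr1.
rewrite -/(c i b) !mxE /period_column; cbn [nth nat_of_ord].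
move: i; apply: I4_cases; cbn [nth nat_of_ord ord0] => //.
- exact: period_column1.
exact: period_column2.
Qed.

End FlatUnfolding.
End PeriodEquations.

Section LogMaps.
Variables (C : numFieldType) (n l m : nat).
Local Notation G := (germ C (n + l)).
Variables (phi : {ffun 'I_(n + m) -> G}) (J : 'M[G]_(n + m, n + l)).
Hypotheses (hphi : log_map n phi) (hJ : log_jacobian n phi J).
Hypothesis rphi : forall a, germ_subst (zero_section C n l) (phi a) = zero_section C n m a.

Lemma log_map_cancel (a : 'I_(n + m)) (f g : G) :
  (if (a < n)%N then phi a else 1) * f = (if (a < n)%N then phi a else 1) * g -> f = g.
Proof.
case: ifP => [la|_]; last by rewrite !mul1r.
have [w uw ->] := hphi.2 a (lshift l (Ordinal la)) la erefl.
by rewrite -!mulrA => /(mulrI uw)/germ_varI.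
Qed.

Let z0 := @zs0 C n l.

Lemma restr_jacobian (a : 'I_(n + m)) (i : 'I_n) : restr (J a (lshift l i)) = (a == lshift m i)%:R.
Proof.
have := congr1 (fun f => restr f) (hJ a (lshift l i)).
rewrite restr_logder /restr (substM z0) rphi -[germ_subst _ (J _ _)]/(restr (J _ _)).
case: (split_ordP a) => j ->.
  rewrite rphi zs_lshift logder_var => e; apply: (@germ_varI _ _ j).
  rewrite -e (inj_eq (@lshift_inj _ _)) eq_sym; case: eqP => [->|_]; last by rewrite mul0r mulr0.
  by rewrite ltn_ord mulrC.
by rewrite zs_rshift logder0 (subst1 z0) mul1r eq_sym eq_lrshift.
Qed.

Lemma restr_msub p q (A : 'M[germ C (n + m)]_(p, q)) : restr_mx (msub phi A) = restr_mx A.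
Proof.
by apply/matrixP => i j; rewrite !mxE; exact: (subst_comp hphi.1 z0 rphi).
Qed.

Lemma restr_pullback r (T : qds_data C (n + m) r) :
  qds_restr (qds_pullback phi J T) = qds_restr T.
Proof.
have rs (F : 'I_(n + m) -> 'M[germ C (n + m)]_r) i :
    restr_mx (\sum_a J a (lshift l i) *: msub phi (F a)) = restr_mx (F (lshift m i)).
  rewrite restr_mxE (msub_sum z0) (bigD1 (lshift m i)) //= (msubZ z0) -!restr_mxE restr_msub.
  rewrite [germ_subst _ _]restr_jacobian eqxx scale1r big1 ?addr0 // => a /negbTE ne.
  by rewrite (msubZ z0) [germ_subst _ _]restr_jacobian ne scale0r.
rewrite /qds_restr; congr QdsData; try exact: restr_msub.
  by apply: funext => i; exact: rs.
by apply: funext => i; exact: rs.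
Qed.

End LogMaps.

Section Universality.
Variables (C : numFieldType) (l : nat).
Local Notation G := (germ C (2 + l)).
Local Notation p1 := (lshift 2 ord0 : 'I_(2 + 2)).
Local Notation p2 := (lshift 2 ord_max : 'I_(2 + 2)).
Local Notation ps := (rshift 2 ord0 : 'I_(2 + 2)).
Local Notation pt := (rshift 2 ord_max : 'I_(2 + 2)).
Local Notation q1 := (germ_var C (ord0 : 'I_2)).
Local Notation q2 := (germ_var C (ord_max : 'I_2)).
Variable Q : germ C 2.
Hypotheses (Q0 : Q 0%MM = 0) (hQ : Q = q1 * (1 + Q) ^+ 2).
Variables (T : qds_data C (2 + 2) 4) (U : qds_data C (2 + l) 4).
Hypotheses (hT : flat_qds 2 T 2) (rT : qds_restr T = F2_flat Q).
Hypotheses (hU : flat_qds 2 U 2) (rU : qds_restr U = F2_flat Q).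

Lemma F2_frame_unit : word_frame (- qds_higgs U (lshift l ord0))
  (- qds_higgs U (lshift l ord_max) - - qds_higgs U (lshift l ord0)) \in unitmx.
Proof.
rewrite unitmx_at0 -map_word_frame.
have e (i : 'I_2) : map_mx (@germ_at0 C (2 + l)) (qds_higgs U (lshift l i)) =
    map_mx (@germ_at0 C 2) (qds_higgs (F2_flat Q) i).
  rewrite -rU; apply/matrixP => a b; rewrite !mxE /germ_at0 subst_coef0 //; exact: zs0.
rewrite map_mxB !map_mxN !e /= !map_mxN !opprK.
by rewrite flat_A1_at0 // flat_A2_at0 // flat_frame0 unitmx1.
Qed.

(** The Higgs fields agree on the cyclic vector, hence everywhere by [cyclic_higgs_unique]. V0, Vinf
    and the pairing then have equal derivatives and equal restrictions to the base. *)
Lemma pullback_eq (phi : {ffun 'I_(2 + 2) -> G}) J : log_map 2 phi -> log_jacobian 2 phi J ->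
  (forall a, germ_subst (zero_section C 2 l) (phi a) = zero_section C 2 2 a) ->
  (forall b i, qds_higgs (qds_pullback phi J T) b i ord0 = qds_higgs U b i ord0) ->
  [/\ forall b, qds_conn (qds_pullback phi J T) b = 0,
      forall b, qds_higgs (qds_pullback phi J T) b = qds_higgs U b,
      qds_V0 (qds_pullback phi J T) = qds_V0 U, qds_Vinf (qds_pullback phi J T) = qds_Vinf U
    & qds_pair (qds_pullback phi J T) = qds_pair U].
Proof.
move=> hphi hJ rphi per; have phi0 := hphi.1; have phiI := log_map_cancel hphi.
have rP := restr_pullback hphi hJ rphi T; rewrite rT -rU in rP.
set D := qds_pullback phi J T in per rP *.
have eh b : qds_higgs D b = qds_higgs U b.
  apply/esym/oppr_inj; apply: (@cyclic_higgs_unique C l (fun b => - qds_higgs U b) (fun b => - qds_higgs D b)).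
  - by move=> a e; rewrite !(mulNmx, mulmxN) (fq_comm hU).
  - by move=> a e; rewrite !(mulNmx, mulmxN) (pullback_comm _ phi0 hT).
  - by move=> a e; rewrite !mlogderN (fq_closed hU).
  - by move=> a e; rewrite !mlogderN (pullback_closed phi0 hJ hT phiI).
  - move=> a; rewrite !mulNmx; congr (- _); apply/matrixP => i j.
    by rewrite -!colE !mxE per.
  - move=> i; apply/restr_mx_eq.
    rewrite !restr_mxE !(msubN (@zs0 C 2 l)); congr (- _).
    by have := congr1 (fun X => qds_higgs X i) rP.
  exact: F2_frame_unit.
have eW : qds_Vinf D = qds_Vinf U.
  apply: mpotential_unique; first by have := congr1 (fun X => qds_Vinf X) rP.
  by move=> a; rewrite (pullback_Vinf phi0 hJ hT) (fq_Vinf hU).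
split => //.
- move=> b; rewrite /D /= big1 // => a _.
  by rewrite (fq_conn hT) -[map_mx _ _]/(msub phi 0) (msub0 phi0) scaler0.
- apply: mpotential_unique; first by have := congr1 (fun X => qds_V0 X) rP.
  move=> a; apply: (addIr (qds_higgs U a *m qds_Vinf U)).
  by rewrite (fq_V0 hU) -eh -eW (pullback_V0 phi0 hJ hT).
apply: mpotential_unique; first by have := congr1 (fun X => qds_pair X) rP.
by move=> a; rewrite (pullback_pair phi0 hJ hT) (fq_pair hU).
Qed.

End Universality.

Section RestrictionAndIsomorphism.
Variables (C : numFieldType) (k n r : nat).

Lemma flat_qds_restr l (T : qds_data C (n + l) r) d : flat_qds n T d -> flat_qds n (qds_restr T) d.
Proof.
have z0 := @zs0 C n l.
have rM := @restr_mxM C n l r r r; have rl := @restr_mlogder C n l n.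
have rT (X : 'M[germ C (n + l)]_r) : restr_mx X^T = (restr_mx X)^T by exact: msubT.
have rD (X Y : 'M[germ C (n + l)]_r) : restr_mx (X + Y) = restr_mx X + restr_mx Y by exact: msubD.
have rB (X Y : 'M[germ C (n + l)]_r) : restr_mx (X - Y) = restr_mx X - restr_mx Y by exact: msubB.
have r0 : restr_mx (0 : 'M[germ C (n + l)]_r) = 0 by exact: msub0.
have rZ (X : 'M[germ C (n + l)]_r) : restr_mx (d%:~R *: X) = d%:~R *: restr_mx X.
  rewrite restr_mxE (msubZ z0); congr (_ *: _).
  by rewrite -!germ_const_int; exact: (subst_const z0).
move=> [h1 h2 h3 h4 h5 h6 h7 h8 h9 h10 h11 h12]; split => /=.
- by move=> i; rewrite h1.
- by move=> i j; rewrite -!rM h2.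
- by move=> i j; rewrite -!rl h3.
- by move=> i; rewrite -!rM h4.
- by move=> i; rewrite -rl -!rM -rD h5 rB.
- by move=> i; rewrite -rl h6.
- by move=> i; rewrite -rl h7.
- by move=> i; rewrite -rT -!rM h8.
- by rewrite -rT -!rM h9.
- by rewrite -rT -!rM -rD h10 rZ.
- by rewrite -rT h11.
by rewrite restr_mx_unit.
Qed.

Lemma qds_iso_div (A A' B : qds_data C n r) (i i' : 'M[germ C n]_r) :
  qds_iso k A B i -> qds_iso k A' B i' -> qds_iso k A' A (invmx i *m i').
Proof.
move=> /qds_isoE[ui hc hh [hV hW] hg] /qds_isoE[ui' hc' hh' [hV' hW'] hg'].
have e : i *m (invmx i *m i') = i' by rewrite mulKVmx.
have uP : invmx i *m i' \in unitmx by rewrite unitmx_mul unitmx_inv ui ui'.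
move: (invmx i *m i') e uP => P e uP.
have inj (X Y : 'M[germ C n]_r) : i *m X = i *m Y -> X = Y by exact: (can_inj (mulKmx ui)).
have conj (X X' Y : 'M[germ C n]_r) : i *m X = Y *m i -> i' *m X' = Y *m i' -> P *m X' = X *m P.
  by move=> h h'; apply: inj; rewrite !mulmxA h e h' -mulmxA e.
apply/qds_isoE; split.
- exact: uP.
- move=> a; apply: inj; rewrite mulmxA e hc' mulmxDr (mulmxA i (qds_conn A a)) hc mulmxDl -mulmxA e.
  by rewrite -{1}e mlogderM [RHS]addrCA addrA.
- by move=> a; exact: conj (hh a) (hh' a).
- by split; [exact: conj hV hV' | exact: conj hW hW'].
by rewrite -hg -hg' -[in RHS]e trmx_mul !mulmxA.
Qed.

End RestrictionAndIsomorphism.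

Lemma pullback_conn0 (C : numFieldType) n p r (T : qds_data C n r) (phi : {ffun 'I_n -> germ C p}) J :
  (forall a, phi a 0%MM = 0) -> (forall a, qds_conn T a = 0) ->
  forall b, qds_conn (qds_pullback phi J T) b = 0.
Proof.
by move=> phi0 h b; rewrite /= big1 // => a _; rewrite h -[map_mx _ _]/(msub phi 0) (msub0 phi0) scaler0.
Qed.

Section Main.
Variable C : numFieldType.
Local Notation p1 := (lshift 2 ord0 : 'I_(2 + 2)).
Local Notation p2 := (lshift 2 ord_max : 'I_(2 + 2)).
Local Notation ps := (rshift 2 ord0 : 'I_(2 + 2)).
Local Notation pt := (rshift 2 ord_max : 'I_(2 + 2)).
Local Notation q1 := (germ_var C (ord0 : 'I_2)).
Local Notation q2 := (germ_var C (ord_max : 'I_2)).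
Local Notation w0 := (delta_mx ord0 0).
Variable Q : germ C 2.
Hypotheses (Q0 : Q 0%MM = 0) (hQ : Q = q1 * (1 + Q) ^+ 2).
Variable T : qds_data C (2 + 2) 4.
Hypotheses (hT : flat_qds 2 T 2) (rT : qds_restr T = F2_flat Q) (V0 : qds_Vinf T *m (w0 : 'cV_4) = 0).
Hypotheses (T1 : qds_higgs T p1 *m w0 = - (mext 2 (flat_A1 Q (1 - Q)^-1 (1 + Q)^-1 q2) *m (w0 : 'cV_4)))
  (T2 : qds_higgs T p2 *m w0 = - (mext 2 (flat_A2 Q (1 + Q)^-1 q2) *m (w0 : 'cV_4)))
  (Ts : qds_higgs T ps *m w0 = - (w0 : 'cV_4)) (Tt : qds_higgs T pt *m w0 = - (delta_mx ord_max 0 : 'cV_4)).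

(** The equations of the unfolding restrict to the parameters 0, and the change of frame carries
    them to the given basis. *)
Lemma F2_log_qds : log_qds 2 (F2_qds C) 2.
Proof.
apply: (log_qds_iso (F2_flat_iso Q0 hQ)).
by apply/(@flat_qdsP C 2 2 4 (F2_flat Q) 2 (fun _ => erefl)); rewrite -rT; exact: flat_qds_restr.
Qed.

Lemma F2_universal : universal_unfolding 2 2 (F2_qds C) T (flat_P Q (1 + Q)^-1).
Proof.
set i := flat_P _ _; have iso : qds_iso 2 (F2_flat Q) (F2_qds C) i by exact: F2_flat_iso.
split=> [|l T' i' [hT' iso']].
  split; last by rewrite rT.
  exact/(@flat_qdsP C 2 4 4 T 2 (fq_conn hT)).
have flat0 a : qds_conn (F2_flat Q) a = 0 by [].
(* U is T' in a flat frame which restricts exactly to [F2_flat]; the gauge P restricts to i^-1 i',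
   as required of an inducing isomorphism. *)
have [U [P [hU isoU rP rU]]] := flat_gauge hT' flat0 (qds_iso_div iso iso').
have [phi [J [hphi rphi hJ per]]] := period_map_exists Q0 hQ T1 T2 Ts Tt hU rU.
have [ec eh eV eW eg] := pullback_eq Q0 hT rT hU rU hphi hJ rphi per.
have ui : i \in unitmx by exact: F2_flat_P_unit.
have [uP hPc hPh [hPV hPW] hPg] := (@qds_isoE _ _ _ _ _ _ _).1 isoU.
exists phi, P; split.
  split => //; last by rewrite rP mulKVmx.
  exists J; split => //; apply/qds_isoE; rewrite eV eW eg; split => // a.
    by rewrite ec hPc (fq_conn hU).
  by rewrite eh.
(* The pull-back of T by any map has zero connection, so P' is parallel for the connection of T', as
   P is, and P' = P. The Higgs fields of the two pull-backs then coincide, so that phi' satisfies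
   the same period equations as phi. *)
move=> phi' P' [hphi' rphi' [J' [hJ' isoD]] rP'].
have [uP' hc' hh' _ _] := (@qds_isoE _ _ _ _ _ _ _).1 isoD.
have eP : P' = P.
  apply: (@flat_frame_unique C 2 l 4 4 (qds_conn T')).
  - by rewrite rP -rP' mulKmx.
  - by move=> a; rewrite hc' (pullback_conn0 _ hphi'.1 (fq_conn hT)) mul0mx addr0.
  by move=> a; rewrite hPc (fq_conn hU) mul0mx addr0.
split=> //; apply: (period_map_unique Q0 hQ T1 T2 Ts Tt hphi.1 hJ rphi per hphi'.1 hJ' rphi').
move=> b a; congr (fun_of_matrix _ a ord0).
apply: (can_inj (mulmxK uP)); rewrite -hPh.
by have := hh' b; rewrite eP.
Qed.

Lemma F2_log_frobenius : defines_log_frobenius 2 T (w0 : 'cV[germ C (2 + 2)]_4).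
Proof.
apply: (@flat_qds_log_frobenius C 2 4 2) => //.
  by move=> a; rewrite -cmx_delta mlogder_cmx.
set M := (X in X \in unitmx).
have col (a : 'I_4) (c : 'cV[germ C (2 + 2)]_4) j : qds_higgs T a *m w0 = - c -> M j a = c j 0.
  by move=> h; rewrite mxE mulNmx h opprK.
(* At the origin the four directions are mapped to h_A, h_A + h_B, 1 and pt, the columns of M0; N0
   is its inverse. *)
pose M0 : 'M[C]_4 := rows4 [:: [:: 0; 0; 1; 0]; [:: 1; 1; 0; 0]; [:: 0; 1; 0; 0]; [:: 0; 0; 0; 1]].
pose N0 : 'M[C]_4 := rows4 [:: [:: 0; 1; - 1; 0]; [:: 0; 0; 1; 0]; [:: 1; 0; 0; 0]; [:: 0; 0; 0; 1]].
have eM : map_mx (@germ_at0 C 4) M = M0.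
  have at0 (A : 'M[germ C 2]_4) (B : 'M[C]_4) j : map_mx (@germ_at0 C 2) A = B ->
      germ_at0 ((mext 2 A *m (w0 : 'cV_4)) j 0) = B j ord0.
    by move=> <-; rewrite -(at0_mext 2) -colE !mxE.
  have e1 : germ_at0 (1 : germ C (2 + 2)) = 1 by exact: rmorph1.
  have e0 : germ_at0 (0 : germ C (2 + 2)) = 0 by exact: rmorph0.
  apply/matrixP => j a; rewrite mxE; move: a; apply: I22_cases.
  - rewrite (col _ _ _ T1) (at0 _ _ _ (flat_A1_at0 Q0)) !mxE.
    by move: j; apply: I4_cases; cbn [nth nat_of_ord ord0]; rewrite ?mulr0 ?oppr0.
  - rewrite (col _ _ _ T2) (at0 _ _ _ (flat_A2_at0 Q0)) !mxE.
    by move: j; apply: I4_cases; cbn [nth nat_of_ord ord0].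
  - rewrite (col _ _ _ Ts) !mxE; move: j; apply: I4_cases; [exact: e1 | exact: e0 | exact: e0 | exact: e0].
  rewrite (col _ _ _ Tt) !mxE; move: j; apply: I4_cases; [exact: e0 | exact: e0 | exact: e0 | exact: e1].
rewrite unitmx_at0 eM; apply: (proj1 (mulmx1_unit (B := N0) _)).
apply/matrixP => -[[|[|[|[|//]]]] ?] -[[|[|[|[|//]]]] ?];
  rewrite !mxE ?big_ord_recl ?big_ord0 ?mxE /= ?big_ord_recl ?big_ord0 ?mxE /=; ring.
Qed.

End Main.

Theorem theorem11p4p2 (R : realType) :
  log_qds 2 (F2_qds R[i]) 2 /\
  exists (l : nat) (T : qds_data R[i] (2 + l) 4) (i : 'M[germ R[i] 2]_4),
    universal_unfolding 2 2 (F2_qds R[i]) T i /\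
    exists w : 'cV[germ R[i] (2 + l)]_4,
      i *m restr_mx w = F2_omega0 R[i] /\
      defines_log_frobenius 2 T w.
Proof.
have [Q Q0 hQ] := mirror_exists (@gvar0 R[i] 2 ord0).
have [T [hT rT V0 [T1 T2 Ts Tt]]] := F2_unfolding_exists Q0 hQ.
split; first by have := F2_log_qds Q0 hQ hT rT.
exists 2, T, (flat_P Q (1 + Q)^-1); split; first exact: F2_universal.
exists (delta_mx ord0 0); split; last exact: F2_log_frobenius hT V0 T1 T2 Ts Tt.
(* The first column of [flat_P] is e_0: the unit of the flat frame is omega_0. *)
rewrite -cmx_delta restr_mxE (msub_cmx (@zs0 R[i] 2 2)) cmx_delta -colE.
by apply/matrixP => a b; rewrite !mxE (ord1 b); move: a; apply: I4_cases; cbn [nth nat_of_ord ord0].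
Qed.
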